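(* Let $K=\mathbb{C}$ and let $f\in K[x,y]$ be a polynomial such that $\dim V(f,f_x,f_y)\le 0$, $\dim V(f,f_x)\le 1$ and $\dim V(f,f_y)\le 1$, where $f_x,f_y$ are the partial derivatives of $f$ and $V(\cdot)$ denotes the common zero set in $\mathbb{C}^2$. Then the following algorithm for computing a $K$-basis of $H^2(\Omega^\bullet(\log f))=\Omega^2(\log f)/d\,\Omega^1(\log f)$ is correct. Step 1. Find a finite set of generators $(p_i,q_i,r_i)$, $i=1,\dots,m$, of the $K[x,y]$-module of triples $(p,q,r)\in K[x,y]^3$ satisfying $f_y p-f_x q+f r=0$, and put $$L_i=q_i\partial_x-p_i\partial_y+(q_i)_x-(p_i)_y+\frac{f_y p_i-f_x q_i}{f}\in D .$$ Step 2. Let $I^*=D\cdot\{L_1^*,\dots,L_m^*\}$ be the left ideal of $D$ generated by the formal adjoints of the $L_i$. Compute a finite Gröbner basis $\{{L^1}^*,\dots,{L^{m'}}^*\}$ of $I^*$ with respect to the weight vector $w=(1,1,-1,-1)$, and let $L^j$ be the formal adjoint of ${L^j}^*$. Step 3. Find the monic generator $b(-\partial_x x-\partial_y y)$ of $\mathrm{in}_w(I^* )\cap K[-\partial_x x-\partial_y y]$. Step 4. Let $k_0$ be the maximal non-negative integer root of $b(s)=0$ (if there is none, return the empty basis). Return polynomials $c_1,\dots,c_N$ whose classes form a $K$-basis of the vector space $$F_{k_0}\Big/\sum_j L^j\cdot F_{k_0-\mathrm{ord}_w(L^j)} .$$ That is, the ideal $\mathrm{in}_w(I^* )\cap K[-\partial_x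 x-\partial_y y]$ in Step 3 is nonzero (so that $b$ exists), and the classes of the forms $c_i\,\dfrac{dx\wedge dy}{f}$ returned in Step 4 form a $K$-basis of $H^2(\Omega^\bullet(\log f))$.
   Context: $D=K\langle x,y,\partial_x,\partial_y\rangle$ is the Weyl algebra in two variables over $K=\mathbb{C}$, acting on $K[x,y]$ in the usual way; $L\cdot F$ denotes the image of a subspace $F\subset K[x,y]$ under the operator $L$. The formal adjoint $P\mapsto P^*$ is the $K$-linear anti-automorphism of $D$ with $x^*=x$, $y^*=y$, $\partial_x^*=-\partial_x$, $\partial_y^*=-\partial_y$. Logarithmic forms: $\Omega^k_f$ is the space of $k$-forms with coefficients in $K[x,y,1/f]$. A form $\omega\in\Omega^k_f$ is logarithmic iff both $f\omega$ and $df\wedge\omega$ have polynomial coefficients; $\Omega^k(\log f)$ is the space of logarithmic $k$-forms. One has $\Omega^2(\log f)=K[x,y]\,\frac{dx\wedge dy}{f}$. Weights: for $w=(1,1,-1,-1)$, the variables $x,y$ have weight $1$ and $\partial_x,\partial_y$ have weight $-1$. For a nonzero $P=\sum c_{\alpha\beta\gamma\delta}\,x^\alpha y^\beta\partial_x^\gamma\partial_y^\delta\in D$, $\mathrm{ord}_w(P)$ is the maximum of $\alpha+\beta-\gamma-\delta$ over the monomials with nonzero coefficient, and $\mathrm{in}_w(P)\in D$ is the sum of the terms attaining this maximum. For a left ideal $I^*\subset D$, $\mathrm{in}_w(I^* )$ is the left ideal of $D$ spanned by all $\mathrm{in}_w(P)$, $0\ne P\in I^*$; a Gröbner basis of $I^*$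 with respect to $w$ is a finite generating set $G$ of $I^*$ such that $\{\mathrm{in}_w(P) \mid P\in G\}$ generates $\mathrm{in}_w(I^* )$. $F_k\subset K[x,y]$ is the $K$-subspace of polynomials of total degree at most $k$ ($F_k=0$ for $k<0$). Convention: the empty set has dimension $\le 0$. *)

(* Defs.v *)
From HB Require Import structures.
From mathcomp Require Import all_boot all_order all_algebra.
From mathcomp Require Import classical_sets reals.
From mathcomp Require Import complex.
From mathcomp Require Import mpoly ring.

Set Implicit Arguments.
Unset Strict Implicit.
Unset Printing Implicit Defensive.

Import Order.TTheory GRing.Theory Num.Theory.
Local Open Scope ring_scope.
Local Open Scope classical_set_scope.

Section SupportSum.
Context (n : nat) (A : nzRingType) (V : zmodType).
Variable F : 'X_{1..n} -> A -> V.

Definition msum (p : {mpoly A[n]}) : V := \sum_(m <- msupp p) F m p@_m.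

Hypothesis F0 : forall m, F m 0 = 0.
Hypothesis FD : forall m, {morph F m : a b / a + b}.

Lemma msum_sub (s : seq 'X_{1..n}) (p : {mpoly A[n]}) :
  uniq s -> {subset msupp p <= s} -> msum p = \sum_(m <- s) F m p@_m.
Proof.
move=> us sub; rewrite (bigID (mem (msupp p))) /= [X in _ + X]big1 ?addr0.
  rewrite -[RHS]big_filter; apply: perm_big; apply: uniq_perm.
  - exact: msupp_uniq.
  - exact: filter_uniq.
  - by move=> m; rewrite mem_filter; case: (boolP (m \in msupp p)) => // /sub ->.
by move=> m /memN_msupp_eq0 ->.
Qed.

Lemma msumD (p q : {mpoly A[n]}) : msum (p + q) = msum p + msum q.
Proof.
pose s := undup (msupp p ++ msupp q ++ msupp (p + q)).
have us : uniq s by apply: undup_uniq.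
rewrite !(msum_sub us) ?big_split -?big_split /=.
- by apply: eq_bigr => m _; rewrite mcoeffD FD.
- by move=> m; rewrite mem_undup !mem_cat => ->; rewrite orbT.
- by move=> m; rewrite mem_undup !mem_cat => ->.
- by move=> m; rewrite mem_undup !mem_cat => ->; rewrite !orbT.
Qed.

Lemma msum0 : msum 0 = 0.
Proof. by rewrite /msum msupp0 big_nil. Qed.

Lemma msum_term (a : A) m : msum (a *: 'X_[m]) = F m a.
Proof.
rewrite (@msum_sub [:: m]) //; first by rewrite big_seq1 mcoeffZ mcoeffX eqxx mulr1.
by move=> m' /msuppZ_le; rewrite msuppX.
Qed.

End SupportSum.

Lemma mterm_ind (n : nat) (A : nzRingType) (P : {mpoly A[n]} -> Prop) :
  P 0 -> (forall a m, P (a *: 'X_[m])) -> (forall p q, P p -> P q -> P (p + q)) ->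
  forall p, P p.
Proof. by move=> P0 Pt PD; elim/mpolyind => // a m p _ _ ih; apply: PD. Qed.

Lemma mnm_ind (n : nat) (P : 'X_{1..n} -> Prop) :
  P 0%MM -> (forall m i, P m -> P (m + U_(i))%MM) -> forall m, P m.
Proof.
move=> P0 PS m; move: {2}(mdeg m) (leqnn (mdeg m)) => d.
elim: d m => [|d ih] m; first by rewrite leqn0 mdeg_eq0 => /eqP->.
have [->//|m0] := eqVneq m 0%MM; have [i mi] : exists i, (0 < m i)%N.
  apply/existsP; apply: contraNT m0; rewrite negb_exists => /forallP H.
  by apply/eqP/mnmP => i; rewrite mnm0E; have := H i; case: (m i).
have -> : m = (m - U_(i) + U_(i))%MM.
  by rewrite submK //; apply/mnm_lepP => j; rewrite mnm1E; case: eqVneq => // <-.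
by rewrite mdegD mdeg1 addn1 ltnS => /ih /PS.
Qed.

Lemma mderiv1 (n : nat) (A : nzRingType) (i : 'I_n) : (1 : {mpoly A[n]})^`M(i) = 0.
Proof. by rewrite -mpolyC1 mderivC. Qed.

(* The n-th Weyl algebra over K.  An operator is stored by its normally ordered
   expansion: the element P stands for \sum_g P@_g * d^g with coefficients
   P@_g in K[x_1, .., x_n] on the left.  The alias keeps the noncommutative
   product below apart from the product of commutative polynomials. *)
Definition weyl (n : nat) (K : comNzRingType) : Type := {mpoly {mpoly K[n]}[n]}.

(* Locks the operations below, so that unification never expands them. *)
Fact weyl_key : unit. Proof. by []. Qed.

HB.instance Definition _ n K :=
  GRing.Zmodule.copy (weyl n K) {mpoly {mpoly K[n]}[n]}.

Section WeylMul.
Context (n : nat) (K : comNzRingType).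
Local Notation A := {mpoly K[n]}.
Local Notation M := {mpoly {mpoly K[n]}[n]}.
Implicit Types (P Q T : M) (a b : A) (g m : 'X_{1..n}).

(* Left composition with d_i:  d_i (a d^g) = a d_i d^g + (da/dx_i) d^g. *)
Definition weyl_dl : 'I_n -> M -> M := locked_with weyl_key
  (fun i Q => 'X_i * Q + map_mpoly (mderiv i) Q).

Definition weyl_dlm : 'X_{1..n} -> M -> M := locked_with weyl_key
  (fun m Q => foldr (fun i => iter (m i) (weyl_dl i)) Q (enum 'I_n)).

Definition weyl_mul : weyl n K -> weyl n K -> weyl n K := locked_with weyl_key
  (fun P Q => msum (fun m a => a *: weyl_dlm m Q) P).

Lemma weyl_dlE i Q : weyl_dl i Q = 'X_i * Q + map_mpoly (mderiv i) Q.
Proof. by rewrite /weyl_dl unlock. Qed.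

Lemma weyl_dlmE m Q :
  weyl_dlm m Q = foldr (fun i => iter (m i) (weyl_dl i)) Q (enum 'I_n).
Proof. by rewrite /weyl_dlm unlock. Qed.

Lemma weyl_mulE (P Q : weyl n K) :
  weyl_mul P Q = msum (fun m a => a *: weyl_dlm m Q) P.
Proof. by rewrite /weyl_mul unlock. Qed.

Lemma weyl_dlD i : {morph weyl_dl i : P Q / P + Q}.
Proof. by move=> P Q; rewrite !weyl_dlE mulrDr raddfD /= addrACA. Qed.

Lemma weyl_dl0 i : weyl_dl i 0 = 0.
Proof. by have /eqP := weyl_dlD i 0 0; rewrite addr0 -subr_eq0 opprD addNKr oppr_eq0 => /eqP. Qed.

Lemma map_mderivZ i a Q :
  map_mpoly (mderiv i) (a *: Q) = a^`M(i) *: Q + a *: map_mpoly (mderiv i) Q.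
Proof.
apply/mpolyP => m.
by rewrite mcoeff_map_mpoly mcoeffD !mcoeffZ mcoeff_map_mpoly /= mderivM.
Qed.

Lemma weyl_dlZ i a Q : weyl_dl i (a *: Q) = a *: weyl_dl i Q + a^`M(i) *: Q.
Proof. by rewrite !weyl_dlE map_mderivZ -scalerAr scalerDr addrAC addrA -addrA. Qed.

Lemma map_mderivX i m : map_mpoly (mderiv i) 'X_[A, m] = 0.
Proof.
apply/mpolyP => m'; rewrite mcoeff_map_mpoly mcoeffX mcoeff0.
by case: eqP => _; rewrite /= ?mderiv0 ?mderiv1.
Qed.

Lemma weyl_dl_term i a m :
  weyl_dl i (a *: 'X_[m]) = a *: 'X_[m + U_(i)] + a^`M(i) *: 'X_[m].
Proof. by rewrite weyl_dlZ !weyl_dlE map_mderivX addr0 -mpolyXD addmC. Qed.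

Lemma weyl_dlC i j Q : weyl_dl i (weyl_dl j Q) = weyl_dl j (weyl_dl i Q).
Proof.
elim/mterm_ind: Q => [|a m|P Q ihP ihQ].
- by rewrite !weyl_dl0.
- rewrite !weyl_dl_term !weyl_dlD !weyl_dl_term (mderiv_comm i j a).
  have -> : (m + U_(j) + U_(i) = m + U_(i) + U_(j))%MM.
    by apply/mnmP => k; rewrite !mnmDE addnAC.
  exact: addrACA.
- by rewrite !weyl_dlD ihP ihQ.
Qed.

Lemma weyl_dlmD m : {morph weyl_dlm m : P Q / P + Q}.
Proof.
move=> P Q; rewrite !weyl_dlmE; elim: (enum _) => //= i s ->.
by elim: (m i) => //= k ->; rewrite weyl_dlD.
Qed.

Lemma weyl_dlm0 Q : weyl_dlm 0 Q = Q.
Proof. by rewrite !weyl_dlmE; elim: (enum _) => //= i s ->; rewrite mnm0E. Qed.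

Lemma weyl_dlm_dl m i Q : weyl_dlm m (weyl_dl i Q) = weyl_dl i (weyl_dlm m Q).
Proof.
rewrite !weyl_dlmE; elim: (enum _) => //= j s ->.
by elim: (m j) => //= k ->; rewrite weyl_dlC.
Qed.

Lemma weyl_dlmS m i Q : weyl_dlm (m + U_(i)) Q = weyl_dl i (weyl_dlm m Q).
Proof.
rewrite !weyl_dlmE; have := enum_uniq 'I_n; have := mem_enum 'I_n i.
have H s Q' : i \notin s ->
    foldr (fun j => iter ((m + U_(i))%MM j) (weyl_dl j)) Q' s
      = foldr (fun j => iter (m j) (weyl_dl j)) Q' s.
  elim: s => //= j s ih; rewrite inE negb_or => /andP[ij /ih->].
  by rewrite mnmDE mnm1E (negPf ij) addn0.
elim: (enum _) => //= j s ih; rewrite inE; case: eqVneq => [<- _|ij] /=.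
  by case/andP=> is0 _; rewrite H // mnmDE mnm1E eqxx addn1.
move=> si /andP[_ us]; rewrite ih // mnmDE mnm1E (negPf ij) addn0.
by elim: (m j) => //= k ->; rewrite weyl_dlC.
Qed.

Lemma weyl_mul_term a m Q : weyl_mul (a *: 'X_[m]) Q = a *: weyl_dlm m Q.
Proof. by rewrite !weyl_mulE msum_term // => *; rewrite scale0r. Qed.

Lemma weyl_mulDl : left_distributive weyl_mul +%R.
Proof.
move=> P Q T; rewrite !weyl_mulE msumD // => m; first by rewrite scale0r.
by move=> a b; rewrite scalerDl.
Qed.

Lemma weyl_mulDr : right_distributive weyl_mul +%R.
Proof.
move=> P Q T; rewrite !weyl_mulE /msum -big_split /=; apply: eq_bigr => m _.
by rewrite weyl_dlmD scalerDr.
Qed.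

Lemma weyl_mul0 P : weyl_mul 0 P = 0.
Proof. by rewrite !weyl_mulE msum0. Qed.

Lemma weyl_mulZ a Q T : weyl_mul (a *: Q) T = a *: weyl_mul Q T.
Proof.
elim/mterm_ind: Q => [|b m|P Q ihP ihQ].
- by rewrite scaler0 weyl_mul0 scaler0.
- by rewrite scalerA !weyl_mul_term scalerA.
- by rewrite scalerDr !weyl_mulDl ihP ihQ scalerDr.
Qed.

Lemma weyl_mul_dl i Q T : weyl_mul (weyl_dl i Q) T = weyl_dl i (weyl_mul Q T).
Proof.
elim/mterm_ind: Q => [|b m|P Q ihP ihQ].
- by rewrite weyl_dl0 weyl_mul0 weyl_dl0.
- by rewrite weyl_dl_term weyl_mulDl !weyl_mul_term weyl_dlmS weyl_dlZ.
- by rewrite weyl_dlD !weyl_mulDl ihP ihQ weyl_dlD.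
Qed.

Lemma weyl_mul_dlm m Q T : weyl_mul (weyl_dlm m Q) T = weyl_dlm m (weyl_mul Q T).
Proof.
rewrite !weyl_dlmE; elim: (enum _) => //= i s <-.
by elim: (m i) => //= k <-; rewrite weyl_mul_dl.
Qed.

Lemma weyl_mulA : associative weyl_mul.
Proof.
move=> P Q T; elim/mterm_ind: P => [|a m|P P' ihP ihP'].
- by rewrite !weyl_mul0.
- by rewrite !weyl_mul_term weyl_mulZ weyl_mul_dlm.
- by rewrite !weyl_mulDl ihP ihP'.
Qed.

Lemma weyl_mul1 : left_id (1%:MP : M) weyl_mul.
Proof.
move=> Q; rewrite mpolyC1 -mpolyX0 -['X_[0]]scale1r.
by rewrite weyl_mul_term weyl_dlm0 scale1r.
Qed.

Lemma weyl_dlm1 m : weyl_dlm m 1%:MP = 'X_[m].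
Proof.
elim/mnm_ind: m => [|m i ih]; first by rewrite weyl_dlm0 mpolyX0.
by rewrite weyl_dlmS ih -['X_[m]]scale1r weyl_dl_term mderiv1 scale0r addr0 scale1r.
Qed.

Lemma weyl_mul_1 : right_id (1%:MP : M) weyl_mul.
Proof.
move=> P; rewrite !weyl_mulE /msum [RHS]mpolyE; apply: eq_bigr => m _.
by rewrite weyl_dlm1.
Qed.

Lemma weyl_1neq0 : (1%:MP : M) != 0.
Proof. exact: oner_neq0. Qed.

HB.instance Definition _ := GRing.Zmodule_isNzRing.Build (weyl n K)
  weyl_mulA weyl_mul1 weyl_mul_1 weyl_mulDl weyl_mulDr weyl_1neq0.

Definition weyl_scale (c : K) (P : weyl n K) : weyl n K := (c%:MP : A) *: (P : M).

Lemma weyl_scaleA c d P : weyl_scale c (weyl_scale d P) = weyl_scale (c * d) P.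
Proof. by rewrite /weyl_scale scalerA mpolyCM. Qed.
Lemma weyl_scale1 : left_id 1 weyl_scale.
Proof. by move=> P; rewrite /weyl_scale scale1r. Qed.
Lemma weyl_scaleDr : right_distributive weyl_scale +%R.
Proof. by move=> c P Q; rewrite /weyl_scale scalerDr. Qed.
Lemma weyl_scaleDl P : {morph weyl_scale^~ P : c d / c + d}.
Proof. by move=> c d; rewrite /weyl_scale mpolyCD scalerDl. Qed.

HB.instance Definition _ := GRing.Zmodule_isLmodule.Build K (weyl n K)
  weyl_scaleA weyl_scale1 weyl_scaleDr weyl_scaleDl.

Lemma weyl_scaleAl (c : K) (P Q : weyl n K) : c *: (P * Q) = (c *: P) * Q.
Proof. by rewrite /GRing.scale /= /weyl_scale [in RHS]/GRing.mul /= weyl_mulZ. Qed.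

HB.instance Definition _ := GRing.Lmodule_isLalgebra.Build K (weyl n K) weyl_scaleAl.

Lemma weyl_dlm_scale m (c : K) Q :
  weyl_dlm m ((c%:MP : A) *: Q) = (c%:MP : A) *: weyl_dlm m Q.
Proof.
rewrite !weyl_dlmE; elim: (enum _) => //= i s ->.
by elim: (m i) => //= k ->; rewrite weyl_dlZ mderivC scale0r addr0.
Qed.

Lemma weyl_scaleAr (c : K) (P Q : weyl n K) : c *: (P * Q) = P * (c *: Q).
Proof.
rewrite /GRing.scale /= /weyl_scale /GRing.mul /= !weyl_mulE /msum scaler_sumr.
by apply: eq_bigr => m _; rewrite weyl_dlm_scale !scalerA mulrC.
Qed.

HB.instance Definition _ := GRing.Lalgebra_isAlgebra.Build K (weyl n K) weyl_scaleAr.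

End WeylMul.

Section WeylOps.
Context (n : nat) (K : comNzRingType).
Local Notation A := {mpoly K[n]}.
Local Notation D := (weyl n K).
Implicit Types (P Q : D) (a b h : A) (g m : 'X_{1..n}).

Definition wpoly (a : A) : D := a%:MP.
Definition wdiff (g : 'X_{1..n}) : D := 'X_[g].
Definition wx (i : 'I_n) : D := wpoly 'X_i.
Definition wd (i : 'I_n) : D := wdiff U_(i).

Definition weyl_act (P : D) (h : A) : A :=
  \sum_(g <- msupp P) P@_g * h^`M[g].

(* (a d^g)^* = (-d)^g a *)
Definition weyl_adj (P : D) : D :=
  \sum_(g <- msupp P) (-1) ^+ mdeg g * (wdiff g * wpoly P@_g).

Lemma wpolyE a : wpoly a = (a *: 'X_[0] : {mpoly A[n]}).
Proof. by rewrite /wpoly mpolyX0 -mul_mpolyC mulr1. Qed.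

Lemma wpoly_mul a P : wpoly a * P = (a *: (P : {mpoly A[n]}) : D).
Proof. by rewrite wpolyE {1}/GRing.mul /= weyl_mul_term weyl_dlm0. Qed.

Lemma wterm a g : wpoly a * wdiff g = (a *: 'X_[g] : {mpoly A[n]}).
Proof. exact: wpoly_mul. Qed.

Lemma weyl_ind (S : D -> Prop) :
  S 0 -> (forall a g, S (wpoly a * wdiff g)) ->
  (forall P Q, S P -> S Q -> S (P + Q)) -> forall P, S P.
Proof.
by move=> S0 St SD; apply: mterm_ind => // a g; rewrite -wterm.
Qed.

Lemma wpolyM a b : wpoly (a * b) = wpoly a * wpoly b.
Proof. by rewrite wpoly_mul /wpoly mpolyCM mul_mpolyC. Qed.

Lemma wpolyD a b : wpoly (a + b) = wpoly a + wpoly b.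
Proof. exact: mpolyCD. Qed.

Lemma wpoly0 : wpoly 0 = 0. Proof. exact: mpolyC0. Qed.
Lemma wpoly1 : wpoly 1 = 1. Proof. by []. Qed.

Lemma wdiff_mul g P : wdiff g * P = weyl_dlm g P.
Proof. by rewrite {1}/GRing.mul /= /wdiff -['X_[g]]scale1r weyl_mul_term scale1r. Qed.

Lemma wdiff0 : wdiff 0 = 1. Proof. exact: mpolyX0. Qed.

Lemma wd_dl i P : wd i * P = weyl_dl i P.
Proof. by rewrite wdiff_mul -[U_(i)%MM]add0m weyl_dlmS weyl_dlm0. Qed.

Lemma wdiffS g i : wdiff (g + U_(i)) = wd i * wdiff g.
Proof.
rewrite wd_dl /wdiff -['X_[g]]scale1r weyl_dl_term mderiv1 scale0r addr0.
by rewrite scale1r.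
Qed.

Lemma wdiffD g m : wdiff (g + m) = wdiff g * wdiff m.
Proof.
elim/mnm_ind: g => [|g i ih]; first by rewrite add0m wdiff0 mul1r.
by rewrite -addmA [(_ + m)%MM]addmC addmA !wdiffS ih mulrA.
Qed.

Lemma wd_poly i a : wd i * wpoly a = wpoly a * wd i + wpoly a^`M(i).
Proof.
have -> : wpoly a * wd i = (a *: 'X_[U_(i)] : {mpoly A[n]}) by exact: wterm.
by rewrite wd_dl !wpolyE weyl_dl_term add0m.
Qed.

Lemma wx_comm i j : wx i * wx j = wx j * wx i.
Proof. by rewrite -!wpolyM mulrC. Qed.

Lemma wd_comm i j : wd i * wd j = wd j * wd i.
Proof. by rewrite -!wdiffD addmC. Qed.

Lemma wd_wx i j : wd i * wx j = wx j * wd i + (i == j)%:R.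
Proof.
rewrite wd_poly mderivX mnm1E eq_sym; congr (_ + _); case: eqVneq => [->|_].
  have -> : (U_(j) - U_(j) = 0 :> 'X_{1..n})%MM.
    by apply/mnmP => k; rewrite mnmBE mnm0E subnn.
  by rewrite mpolyX0 scale1r wpoly1.
by rewrite scale0r wpoly0.
Qed.

Lemma weyl_act_msum P h : weyl_act P h = msum (fun g a => a * h^`M[g]) P.
Proof. by []. Qed.

Lemma weyl_actD P Q h : weyl_act (P + Q) h = weyl_act P h + weyl_act Q h.
Proof.
rewrite !weyl_act_msum msumD // => g; first by rewrite mul0r.
by move=> a b; rewrite mulrDl.
Qed.

Lemma weyl_act0 h : weyl_act 0 h = 0.
Proof. by rewrite weyl_act_msum msum0. Qed.

Lemma weyl_act_term a g h : weyl_act (wpoly a * wdiff g) h = a * h^`M[g].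
Proof. by rewrite wterm weyl_act_msum msum_term // => *; rewrite mul0r. Qed.

Lemma weyl_act_polyM a P h : weyl_act (wpoly a * P) h = a * weyl_act P h.
Proof.
elim/weyl_ind: P => [|b g|P Q ihP ihQ].
- by rewrite mulr0 !weyl_act0 mulr0.
- by rewrite mulrA -wpolyM !weyl_act_term mulrA.
- by rewrite mulrDr !weyl_actD ihP ihQ mulrDr.
Qed.

Lemma weyl_act_dM i P h : weyl_act (wd i * P) h = (weyl_act P h)^`M(i).
Proof.
elim/weyl_ind: P => [|b g|P Q ihP ihQ].
- by rewrite mulr0 !weyl_act0 mderiv0.
- rewrite mulrA wd_poly mulrDl -mulrA -wdiffS weyl_actD !weyl_act_term.
  by rewrite mderivM mderivmDm mderivmU1m addrC.
- by rewrite mulrDr !weyl_actD ihP ihQ mderivD.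
Qed.

Lemma weyl_actM P Q h : weyl_act (P * Q) h = weyl_act P (weyl_act Q h).
Proof.
elim/weyl_ind: P => [|a g|P P' ihP ihP'].
- by rewrite mul0r !weyl_act0.
- rewrite -mulrA weyl_act_polyM weyl_act_term; congr (_ * _).
  elim/mnm_ind: g => [|g i ih]; first by rewrite wdiff0 mul1r mderivm0m.
  by rewrite wdiffS -mulrA weyl_act_dM ih mderivmDm mderivmU1m.
- by rewrite mulrDl !weyl_actD ihP ihP'.
Qed.

Lemma weyl_act_x i h : weyl_act (wx i) h = 'X_i * h.
Proof. by rewrite -[wx i]mulr1 -wdiff0 weyl_act_term mderivm0m. Qed.

Lemma weyl_act_d i h : weyl_act (wd i) h = h^`M(i).
Proof. by rewrite -[wd i]mul1r -wpoly1 weyl_act_term mul1r mderivmU1m. Qed.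

Lemma weyl_adj_msum P :
  weyl_adj P = msum (fun g a => (-1) ^+ mdeg g * (wdiff g * wpoly a)) P.
Proof. by []. Qed.

Lemma weyl_adjD : {morph weyl_adj : P Q / P + Q}.
Proof.
move=> P Q; rewrite !weyl_adj_msum msumD // => g; first by rewrite wpoly0 !mulr0.
by move=> a b; rewrite wpolyD !mulrDr.
Qed.

Lemma weyl_adj0 : weyl_adj 0 = 0.
Proof. by rewrite weyl_adj_msum msum0. Qed.

Lemma weyl_adj_term a g :
  weyl_adj (wpoly a * wdiff g) = (-1) ^+ mdeg g * (wdiff g * wpoly a).
Proof.
by rewrite wterm weyl_adj_msum msum_term // => m; rewrite wpoly0 !mulr0.
Qed.

Lemma weyl_adj_polyM a P : weyl_adj (wpoly a * P) = weyl_adj P * wpoly a.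
Proof.
elim/weyl_ind: P => [|b g|P Q ihP ihQ].
- by rewrite mulr0 !weyl_adj0 mul0r.
- by rewrite mulrA -wpolyM !weyl_adj_term mulrC wpolyM !mulrA.
- by rewrite mulrDr !weyl_adjD ihP ihQ mulrDl.
Qed.

Lemma weyl_adj_dM i P : weyl_adj (wd i * P) = - weyl_adj P * wd i.
Proof.
elim/weyl_ind: P => [|b g|P Q ihP ihQ].
- by rewrite mulr0 !weyl_adj0 oppr0 mul0r.
- rewrite mulrA wd_poly mulrDl -mulrA -wdiffS weyl_adjD !weyl_adj_term.
  rewrite mdegD mdeg1 addn1 exprS mulN1r wdiffD.
  by rewrite !mulNr -mulrA wd_poly !mulrDr opprD -!mulrA addrNK.
- by rewrite mulrDr !weyl_adjD ihP ihQ opprD mulrDl.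
Qed.

Lemma weyl_adjM P Q : weyl_adj (P * Q) = weyl_adj Q * weyl_adj P.
Proof.
elim/weyl_ind: P => [|a g|P P' ihP ihP'].
- by rewrite mul0r weyl_adj0 mulr0.
- rewrite -mulrA weyl_adj_polyM weyl_adj_term !mulrA; congr (_ * _).
  elim/mnm_ind: g => [|g i ih]; first by rewrite wdiff0 mul1r mdeg0 expr0 !mulr1.
  rewrite wdiffS -mulrA weyl_adj_dM ih mdegD mdeg1 addn1 exprS mulN1r.
  by rewrite mulrN !mulNr -wdiffS wdiffD !mulrA.
- by rewrite mulrDl !weyl_adjD ihP ihP' mulrDr.
Qed.

Lemma weyl_adj_poly a : weyl_adj (wpoly a) = wpoly a.
Proof.
by rewrite -[wpoly a]mulr1 -wdiff0 weyl_adj_term mdeg0 expr0 wdiff0 !mul1r mulr1.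
Qed.

Lemma weyl_adj_x i : weyl_adj (wx i) = wx i.
Proof. exact: weyl_adj_poly. Qed.

Lemma weyl_adj_d i : weyl_adj (wd i) = - wd i.
Proof.
by rewrite -[wd i]mul1r -wpoly1 weyl_adj_term mdeg1 expr1 mulN1r mulr1 mul1r.
Qed.

Lemma weyl_scaleE (c : K) P : c *: P = wpoly c%:MP * P.
Proof. by rewrite wpoly_mul. Qed.

Lemma weyl_adjZ (c : K) P : weyl_adj (c *: P) = c *: weyl_adj P.
Proof.
rewrite weyl_scaleE weyl_adj_polyM.
have -> : wpoly c%:MP = c%:A by rewrite weyl_scaleE mulr1.
by rewrite -scalerAr mulr1.
Qed.

End WeylOps.

Section Ideals.
Context (D : nzRingType).

Definition lideal (S : set D) : set D :=
  [set P | exists (k : nat) (a s : 'I_k -> D),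
     (forall i, S (s i)) /\ P = \sum_(i < k) a i * s i].

End Ideals.

Section Weights.
Context (n : nat) (K : comNzRingType).
Local Notation D := (weyl n K).
Implicit Types (P : D) (S : set D).

(* The monomials x^a d^g of P, as pairs (a, g). *)
Definition wsupp (P : D) : seq ('X_{1..n} * 'X_{1..n}) :=
  [seq (a, g) | g <- msupp P, a <- msupp P@_g].

Definition wweight (ag : 'X_{1..n} * 'X_{1..n}) : int :=
  (mdeg ag.1)%:Z - (mdeg ag.2)%:Z.

(* For P = 0 this is 0, and inw 0 = 0. *)
Definition ordw (P : D) : int :=
  let s := [seq wweight ag | ag <- wsupp P] in \big[Num.max/head 0 s]_(k <- s) k.

Definition inw (P : D) : D :=
  \sum_(ag <- wsupp P | wweight ag == ordw P)
    (P@_ag.2)@_ag.1 *: (wpoly 'X_[ag.1] * wdiff K ag.2).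

Definition inw_ideal (I : set D) : set D :=
  lideal [set inw P | P in [set P | I P /\ P != 0]].

Definition groebner (I : set D) (m : nat) (G : 'I_m -> D) : Prop :=
  lideal (range G) = I /\ lideal (range (fun j => inw (G j))) = inw_ideal I.

Lemma wsupp_neq0 P : P != 0 -> wsupp P != [::].
Proof.
move=> P0; have : msupp P != [::] by rewrite msupp_eq0.
rewrite /wsupp; have := @mcoeff_msupp _ _ P.
case: (msupp P) => //= g s /(_ g); rewrite mem_head => Pg _.
have : msupp P@_g != [::] by rewrite msupp_eq0 -Pg.
by case: (msupp P@_g).
Qed.

Lemma ordw_max P ag : ag \in wsupp P -> wweight ag <= ordw P.
Proof.
by move=> agP; rewrite /ordw big_map; exact: (@le_bigmax_seq _ _ _ _ _ ag predT).
Qed.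

Lemma ordw_attained P : P != 0 -> exists2 ag, ag \in wsupp P & wweight ag = ordw P.
Proof.
move=> /wsupp_neq0 s0.
suff /mapP[ag agP ->] : ordw P \in [seq wweight ag | ag <- wsupp P] by exists ag.
rewrite /ordw; move: s0; case: (wsupp P) => [//|x s] _ /=.
set t := _ :: _; have : {subset t <= t} by [].
rewrite {1}/t -/t; move: {1 3}t => u; elim: u => [|y u ih] ut.
  by rewrite big_nil mem_head.
rewrite big_cons; have /ih uP : {subset u <= t}.
  by move=> z zu; apply: ut; rewrite inE zu orbT.
by rewrite /Num.max; case: ifP => // _; apply: ut; rewrite mem_head.
Qed.

End Weights.

Section BFunction.
Context (n : nat) (K : fieldType).

(* s = - d_1 x_1 - .. - d_n x_n *)
Definition theta : weyl n K := - \sum_(i < n) wd K i * wx K i.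

Definition bideal (I : set (weyl n K)) : set (weyl n K) :=
  inw_ideal I `&` range (horner_alg theta).

(* b(s) is the monic generator of the ideal in_w(I) /\ K[s] of K[s]. *)
Definition is_bfunction (I : set (weyl n K)) (b : {poly K}) : Prop :=
  b \is monic /\ bideal I = range (fun h : {poly K} => horner_alg theta (h * b)).

End BFunction.

Section Dimension.
Context (n : nat) (K : fieldType).
Local Notation point := ('I_n -> K).

Definition zeroset (S : set {mpoly K[n]}) : set point :=
  [set v | forall g, S g -> g.@[v] = 0].

Definition zclosed (Z : set point) : Prop := exists S, Z = zeroset S.

Definition zirreducible (Z : set point) : Prop :=
  Z !=set0 /\ forall A B, zclosed A -> zclosed B ->
    Z `<=` A `|` B -> Z `<=` A \/ Z `<=` B.

(* Chains Z_0 < .. < Z_k of irreducible closed subsets of V have k <= d; this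
   holds for every d when V is empty. *)
Definition dim_le (V : set point) (d : nat) : Prop :=
  forall (k : nat) (Z : nat -> set point),
    (forall i, (i <= k)%N -> [/\ zclosed (Z i), zirreducible (Z i) & Z i `<=` V]) ->
    (forall i, (i < k)%N -> Z i `<` Z i.+1) -> (k <= d)%N.

End Dimension.

Definition ratfun (n : nat) (K : fieldType) : Type := {fraction {mpoly K[n]}}.

HB.instance Definition _ n K := GRing.Field.on (ratfun n K).

Lemma quotient_rule_aux (R : comNzRingType) (a b p q a' b' p' q' : R) :
  p * b = a * q -> p' * b + p * b' = a' * q + a * q' ->
  (a' * b - a * b') * q ^+ 2 = (p' * q - p * q') * b ^+ 2.
Proof.
move=> E dE; apply/eqP; rewrite -subr_eq0; apply/eqP.
have -> : (a' * b - a * b') * q ^+ 2 - (p' * q - p * q') * b ^+ 2 =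
    b * q * ((a' * q + a * q') - (p' * b + p * b'))
    + (p * b - a * q) * (b' * q + b * q') by ring.
by rewrite E dE !subrr mulr0 mul0r addr0.
Qed.

Section RatFun.
Context (n : nat) (K : fieldType).
Local Notation A := {mpoly K[n]}.
Local Notation F := (ratfun n K).
Implicit Types (u v : F) (c d : K) (p q f : A).

Definition ratf (p : A) : F := @FracField.tofrac A p.

HB.instance Definition _ := GRing.RMorphism.copy ratf (@FracField.tofrac A).

Definition rat_scale (c : K) (u : F) : F := ratf c%:MP * u.

Lemma rat_scaleA c d u : rat_scale c (rat_scale d u) = rat_scale (c * d) u.
Proof. by rewrite /rat_scale mulrA -rmorphM mpolyCM. Qed.
Lemma rat_scale1 : left_id 1 rat_scale.
Proof. by move=> u; rewrite /rat_scale mpolyC1 rmorph1 mul1r. Qed.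
Lemma rat_scaleDr : right_distributive rat_scale +%R.
Proof. by move=> c u v; rewrite /rat_scale mulrDr. Qed.
Lemma rat_scaleDl u : {morph rat_scale^~ u : c d / c + d}.
Proof. by move=> c d; rewrite /rat_scale mpolyCD rmorphD mulrDl. Qed.

HB.instance Definition _ := GRing.Zmodule_isLmodule.Build K F
  rat_scaleA rat_scale1 rat_scaleDr rat_scaleDl.

Lemma rat_eq0 p : (ratf p == 0) = (p == 0).
Proof. exact: tofrac_eq0. Qed.

Lemma rat_inj : injective ratf.
Proof.
by move=> p q /eqP; rewrite -subr_eq0 -rmorphB rat_eq0 subr_eq0 => /eqP.
Qed.

Lemma repr_ratfun u :
  let x := repr (u : {fraction A}) in u = ratf \n_x / ratf \d_x.
Proof.
move=> x; have dx : ratf \d_x != 0 by rewrite rat_eq0 denom_ratioP.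
apply: (mulIf dx); rewrite mulfVK //.
rewrite -[u in LHS](@reprK _ {fraction A}) -/x /ratf; unlock FracField.tofrac.
rewrite -[LHS]FracField.pi_mul; apply/eqmodP => /=.
rewrite FracField.equivfE /FracField.mulf.
by rewrite !numden_Ratio ?(oner_eq0, mulf_neq0, denom_ratioP) // !mulr1 mulrC.
Qed.

(* Quotient rule on the chosen representative; see [rat_derivE]. *)
Definition rat_deriv (i : 'I_n) (u : F) : F :=
  let x := repr (u : {fraction A}) in
  ratf ((\n_x)^`M(i) * \d_x - \n_x * (\d_x)^`M(i)) / ratf (\d_x) ^+ 2.

Lemma rat_derivE i p q : q != 0 ->
  rat_deriv i (ratf p / ratf q) = ratf (p^`M(i) * q - p * q^`M(i)) / ratf q ^+ 2.
Proof.
move=> q0; rewrite /rat_deriv; set x := repr _.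
have b0 : \d_x != 0 by exact: denom_ratioP.
have E : p * \d_x = \n_x * q.
  apply: rat_inj; rewrite !rmorphM; have := repr_ratfun (ratf p / ratf q).
  move/eqP; rewrite eqr_div ?rat_eq0 // => /eqP; exact.
have dE := congr1 (mderiv i) E; rewrite !mderivM in dE.
apply/eqP; rewrite eqr_div ?expf_neq0 ?rat_eq0 // -!rmorphXn -!rmorphM /=.
by apply/eqP; congr (ratf _); exact: quotient_rule_aux.
Qed.

Definition polynomial_rat : set F := range ratf.

(* K[x_1, .., x_n, 1/f] *)
Definition localized (f : A) : set F :=
  [set u | exists p k, u = ratf p / ratf f ^+ k].

(* p / f as a polynomial, when f divides p. *)
Definition mquot (p f : A) : A := xget 0 [set h | ratf h = ratf p / ratf f].

Lemma mquotE p f h : f != 0 -> p = h * f -> mquot p f = h.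
Proof.
move=> f0 ->; rewrite /mquot; have f0' : ratf f != 0 by rewrite rat_eq0.
case: xgetP => [g _|/(_ h)] /=; rewrite rmorphM mulfK //.
by move/rat_inj.
Qed.

End RatFun.

Arguments polynomial_rat {n K}.

Section QuotientBasis.
Context (K : fieldType) (E : lmodType K).

(* The classes of v_1, .., v_N form a K-basis of V / W, where W is a subspace
   of V. *)
Definition quotient_basis (V W : set E) (N : nat) (v : 'I_N -> E) : Prop :=
  [/\ forall i, V (v i),
      forall a : 'I_N -> K, W (\sum_(i < N) a i *: v i) -> forall i, a i = 0 &
      forall u, V u -> exists a : 'I_N -> K, W (u - \sum_(i < N) a i *: v i)].

End QuotientBasis.

Section LogarithmicForms.
Context (K : fieldType).
Local Notation A := {mpoly K[2]}.
Local Notation F := (ratfun 2 K).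
Local Notation ix := (0 : 'I_2).
Local Notation iy := (1 : 'I_2).

(* The 1-form u dx + v dy is the pair (u, v), and the 2-form u dx/\dy is u. *)
Definition form1 : Type := (F * F)%type.
Definition form2 : Type := F.

Definition d1 (omega : form1) : form2 :=
  rat_deriv ix omega.2 - rat_deriv iy omega.1.

(* df /\ (u dx + v dy) = (f_x v - f_y u) dx /\ dy *)
Definition dwedge (f : A) (omega : form1) : form2 :=
  ratf f^`M(ix) * omega.2 - ratf f^`M(iy) * omega.1.

Definition Omega1_log (f : A) : set form1 :=
  [set omega | [/\ localized f omega.1 /\ localized f omega.2,
     polynomial_rat (ratf f * omega.1) /\ polynomial_rat (ratf f * omega.2) &
     polynomial_rat (dwedge f omega)]].

(* No condition on df /\ omega: it is a 3-form in two variables, hence 0. *)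
Definition Omega2_log (f : A) : set form2 :=
  [set omega | localized f omega /\ polynomial_rat (ratf f * omega)].

(* The classes of the given logarithmic 2-forms are a basis of
   H^2(Omega^*(log f)). *)
Definition H2_log_basis (f : A) (N : nat) (omega : 'I_N -> form2) : Prop :=
  quotient_basis (Omega2_log f) (d1 @` Omega1_log f) omega.

End LogarithmicForms.

Section Algorithm.
Context (K : fieldType).
Local Notation A := {mpoly K[2]}.
Local Notation D := (weyl 2 K).
Local Notation ix := (0 : 'I_2).
Local Notation iy := (1 : 'I_2).
Implicit Types (f : A).

Definition syzygy (f p q r : A) : Prop :=
  f^`M(iy) * p - f^`M(ix) * q + f * r = 0.

Definition syzygy_generators (f : A) (m : nat) (p q r : 'I_m -> A) : Prop :=
  (forall i, syzygy f (p i) (q i) (r i)) /\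
  forall p' q' r', syzygy f p' q' r' -> exists a : 'I_m -> A,
    [/\ p' = \sum_(i < m) a i * p i, q' = \sum_(i < m) a i * q i &
        r' = \sum_(i < m) a i * r i].

Definition log_operator (f p q : A) : D :=
  wpoly q * wd K ix - wpoly p * wd K iy
  + wpoly (q^`M(ix) - p^`M(iy) + mquot (f^`M(iy) * p - f^`M(ix) * q) f).

Definition log_adj_ideal (f : A) (m : nat) (p q : 'I_m -> A) : set D :=
  lideal (range (fun i => weyl_adj (log_operator f (p i) (q i)))).

(* Polynomials of total degree at most k: this is 0 for k < 0. *)
Definition Fdeg (k : int) : set A :=
  [set h | forall a, a \in msupp h -> (mdeg a)%:Z <= k].

(* \sum_j L^j . F_(k - ord_w(L^j)) *)
Definition Fimage (m : nat) (L : 'I_m -> D) (k : int) : set A :=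
  [set u | exists h : 'I_m -> A,
     (forall j, Fdeg (k - ordw (L j)) (h j)) /\
     u = \sum_(j < m) weyl_act (L j) (h j)].

Definition max_nat_root (b : {poly K}) (k : nat) : Prop :=
  root b k%:R /\ forall l : nat, root b l%:R -> (l <= k)%N.

Definition final_step (b : {poly K}) (m : nat) (L : 'I_m -> D)
    (N : nat) (c : 'I_N -> A) : Prop :=
  (exists k0 : nat, max_nat_root b k0 /\
     quotient_basis (Fdeg k0%:Z) (Fimage L k0%:Z) c)
  \/ ((forall k : nat, ~~ root b k%:R) /\ N = 0%N).

End Algorithm.

(* Main.v *)
From HB Require Import structures.
Require Import Defs.
From mathcomp Require Import all_boot all_order all_algebra.
From mathcomp Require Import boolp classical_sets reals.
From mathcomp Require Import complex.
From mathcomp Require Import mpoly.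
From mathcomp Require Import zify ring.

(** The classes u dx dy / f identify H^2 with the quotient of K[x,y] by the sum
    of the images of the L_i, and this sum only depends on the right ideal that
    the L_i generate.  Modulo lower degree, b(theta)^* acts on the polynomials of
    degree k as the scalar b(k), so for k above all roots of b everything of
    degree k can be reduced, and likewise the relations of degree k can be
    pushed down one degree (using the initial forms of the Groebner basis up to
    an error of arbitrarily low order, which kills polynomials of bounded
    degree).

    The polynomial b exists because D / I^* has quadratic growth for the Bernstein
    filtration.  The hypothesis on V(f, f_x, f_y) produces nonzero polynomials in
    x alone and in y alone in the ideal (f, f_x, f_y), so that the symbol
    f_y xi - f_x eta of the annihilator f_y d_x - f_x d_y is regular modulo f; as
    I^* also contains d_x f and d_y f, counting monomials bounds the codimension
    of I^* by a second difference of C(k+4, 4).  The bound passes to the initial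
    ideal J.  If no b(theta) were in J, Joseph's argument would embed the
    operators sum P_i theta^i with deg P_i, i < n, a space of dimension at least
    n^5, into the linear maps between two spaces of dimension O(n^2). *)

Set Implicit Arguments.
Unset Strict Implicit.
Unset Printing Implicit Defensive.

Import Order.TTheory GRing.Theory Num.Theory.
Local Open Scope ring_scope.
Local Open Scope classical_set_scope.

(** * Filtrations of the Weyl algebra *)

Section Filtrations.
Context (n : nat) (K : numFieldType).
Local Notation A := {mpoly K[n]}.
Local Notation D := (weyl n K).
Local Notation mono := ('X_{1..n} * 'X_{1..n})%type.
Implicit Types (P Q : D) (a b h : A) (ag bh : mono).

(** Relations can be pushed down because in_w(G_j), homogeneous of some weight o, satisfies b(theta
    + o) in_w(G_j) = in_w(G_j) b(theta). The shift by o compensates the degree bound k - o on the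
    argument of L^j, so one scalar b(k) serves all j at once.

    The growth bound treats f and f_y xi - f_x eta as two hypersurfaces of degree deg f in 4-space
    without common component, hence with intersection of dimension 2. An obstacle is that f maps 1/f
    to 1, so f itself is not in I^*; but P f is, for P in D d_x + D d_y, which loses only the O(k^2)
    monomials of order 0. Regularity needs a polynomial h(x) and a polynomial g(y) because these are
    coprime: if both multiply a into (f), then f divides a.

    In Joseph's argument quadratic growth gives the space of linear maps dimension O(n^4), matched
    by the monomials alone; the decisive factor n comes from the powers of theta. Hence some nonzero
    tuple (P_i) has sum P_i u theta^i in J for all u of degree at most 4 n. Commutators with x, y,
    d_x, d_y then turn the P_i into scalars, the coefficients of b. *)

Definition wmon ag : D := wpoly 'X_[ag.1] * wdiff K ag.2.
Definition wc ag P : K := ((P : {mpoly A[n]})@_ag.2)@_ag.1.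

Lemma wc_is_zmod_morphism ag : zmod_morphism (wc ag).
Proof. by move=> P Q; rewrite /wc !mcoeffB. Qed.
HB.instance Definition _ ag :=
  GRing.isZmodMorphism.Build D K (wc ag) (wc_is_zmod_morphism ag).

Lemma wcZ ag (c : K) P : wc ag (c *: P) = c * wc ag P.
Proof. by rewrite /wc weyl_scaleE wpoly_mul mcoeffZ mcoeffCM. Qed.

Lemma wmonE ag : wmon ag = ('X_[ag.1] : A) *: ('X_[ag.2] : {mpoly A[n]}).
Proof. exact: wterm. Qed.

Lemma wc_wmon ag bh : wc ag (wmon bh) = (ag == bh)%:R.
Proof.
rewrite /wc wmonE mcoeffZ mcoeffX; case: ag bh => [a g] [b h] /=.
rewrite xpair_eqE [g == h]eq_sym [a == b]eq_sym.
by case: (h == g); rewrite ?mulr1 ?mulr0 ?mcoeff0 ?andbF ?andbT ?mcoeffX.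
Qed.

Lemma wc_eqP P Q : (forall ag, wc ag P = wc ag Q) -> P = Q.
Proof. by move=> h; apply/mpolyP => g; apply/mpolyP => a; apply: (h (a, g)). Qed.

Lemma mem_wsupp ag P : (ag \in wsupp P) = (wc ag P != 0).
Proof.
apply/allpairsPdep/idP => [[g [a [gP aP ->]]]|]; first by rewrite /wc -mcoeff_msupp.
rewrite /wc; case: ag => a g /= h; exists g, a; split => //.
  by rewrite mcoeff_msupp; apply: contraNneq h => ->; rewrite mcoeff0.
by rewrite mcoeff_msupp.
Qed.

Lemma wsupp_uniq P : uniq (wsupp P).
Proof.
apply: allpairs_uniq_dep; first exact: msupp_uniq.
  by move=> g _; apply: msupp_uniq.
by move=> [g a] [g' a'] _ _ /= [-> ->].
Qed.

Lemma wc_sum_wmon (T : Type) (s : seq T) (Pr : pred T) (c : T -> K)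
    (e : T -> mono) ag :
  wc ag (\sum_(t <- s | Pr t) c t *: wmon (e t)) =
  \sum_(t <- s | Pr t && (e t == ag)) c t.
Proof.
rewrite raddf_sum /= big_mkcondr /=; apply: eq_bigr => t _.
by rewrite wcZ wc_wmon eq_sym; case: eqP; rewrite ?mulr1 ?mulr0.
Qed.

Lemma wexpand P : P = \sum_(ag <- wsupp P) wc ag P *: wmon ag.
Proof.
apply: wc_eqP => ag; rewrite (wc_sum_wmon _ _ _ id) /=.
have [agP|agP] := boolP (ag \in wsupp P).
  by rewrite -big_filter filter_pred1_uniq ?wsupp_uniq // big_seq1.
rewrite big_seq_cond big1 ?mem_wsupp ?(negPf agP) //.
  by apply/eqP; move: agP; rewrite mem_wsupp negbK.
by move=> bh /andP[bhP /eqP E]; rewrite E (negPf agP) in bhP.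
Qed.

Section Fil.
Variables (u v : int).
Hypothesis uv : 0 <= u + v.

(** The weights in use are (1, -1) for ord_w, (-1, 1) for its opposite, (0, 1) for the order in the
    derivatives and (1, 1) for the Bernstein filtration. The condition [uv] says that the term 1 in
    d_i x_i = x_i d_i + 1 does not exceed the weight of the product, which makes them all
    multiplicative. *)
Definition mwt ag : int := u * (mdeg ag.1)%:Z + v * (mdeg ag.2)%:Z.
Variant Fil (o : int) P : Prop :=
  FilI of (forall ag, wc ag P != 0 -> mwt ag <= o).

Lemma Fil_wc o P ag : Fil o P -> wc ag P != 0 -> mwt ag <= o.
Proof. by case=> /(_ ag). Qed.

Lemma Fil0 o : Fil o 0.
Proof. by split=> ag; rewrite raddf0 eqxx. Qed.

Lemma FilD o P Q : Fil o P -> Fil o Q -> Fil o (P + Q).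
Proof.
case=> hP [hQ]; split=> ag; rewrite raddfD /=.
by have [P0|/hP//] := eqVneq (wc ag P) 0; rewrite P0 add0r => /hQ.
Qed.

Lemma FilN o P : Fil o P -> Fil o (- P).
Proof. by case=> hP; split=> ag; rewrite raddfN /= oppr_eq0 => /hP. Qed.

Lemma FilB o P Q : Fil o P -> Fil o Q -> Fil o (P - Q).
Proof. by move=> hP hQ; apply: FilD => //; apply: FilN. Qed.

Lemma FilZ o c P : Fil o P -> Fil o (c *: P).
Proof. by case=> hP; split=> ag; rewrite wcZ mulf_eq0 negb_or => /andP[_ /hP]. Qed.

Lemma Fil_sum o (I : Type) (s : seq I) (Pr : pred I) (F : I -> D) :
  (forall i, Pr i -> Fil o (F i)) -> Fil o (\sum_(i <- s | Pr i) F i).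
Proof. by move=> h; apply: big_ind => //; [apply: Fil0 | apply: FilD]. Qed.

Lemma FilS o o' P : o <= o' -> Fil o P -> Fil o' P.
Proof. by move=> oo [hP]; split=> ag /hP /le_trans; apply. Qed.

Lemma Fil_wmon ag : Fil (mwt ag) (wmon ag).
Proof. by split=> bh; rewrite wc_wmon; have [->|_] := eqVneq bh ag; rewrite ?eqxx. Qed.

Lemma Fil_ind (S : D -> Prop) o :
  S 0 -> (forall P Q, S P -> S Q -> S (P + Q)) ->
  (forall c ag, mwt ag <= o -> S (c *: wmon ag)) ->
  forall P, Fil o P -> S P.
Proof.
move=> S0 SD Sm P hP; rewrite [P]wexpand big_seq; apply: big_ind => // ag.
by rewrite mem_wsupp => /(Fil_wc hP); apply: Sm.
Qed.

Lemma wx_wmon i ag : wx K i * wmon ag = wmon (ag.1 + U_(i), ag.2)%MM.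
Proof. by rewrite /wmon mulrA -wpolyM -mpolyXD addmC. Qed.

Lemma wd_wmon i ag : wd K i * wmon ag =
  wmon (ag.1, ag.2 + U_(i))%MM + (ag.1 i)%:R *: wmon (ag.1 - U_(i), ag.2)%MM.
Proof.
rewrite /wmon mulrA wd_poly mulrDl -mulrA -wdiffS; congr (_ + _).
rewrite mderivX weyl_scaleE mulrA -wpolyM; congr (wpoly _ * _).
by rewrite -mul_mpolyC.
Qed.

Lemma Fil_wx i o P : Fil o P -> Fil (u + o) (wx K i * P).
Proof.
move: P; apply: Fil_ind => [|P1 P2|c ag h]; rewrite ?mulr0; [exact: Fil0| |].
  by rewrite mulrDr; apply: FilD.
rewrite -scalerAr wx_wmon; apply: FilZ; apply: (FilS _ (Fil_wmon _)).
by move: h; rewrite /mwt /= mdegD mdeg1; lia.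
Qed.

Lemma Fil_wd i o P : Fil o P -> Fil (v + o) (wd K i * P).
Proof.
move: P; apply: Fil_ind => [|P1 P2|c ag h]; rewrite ?mulr0; [exact: Fil0| |].
  by rewrite mulrDr; apply: FilD.
rewrite -scalerAr wd_wmon; apply: FilZ; apply: FilD.
  by apply: (FilS _ (Fil_wmon _)); move: h; rewrite /mwt /= mdegD mdeg1; lia.
have [->|i0] := eqVneq (ag.1 i) 0%N; first by rewrite scale0r; apply: Fil0.
apply: FilZ; apply: (FilS _ (Fil_wmon _)); move: h; rewrite /mwt /=.
have {1}-> : ag.1 = (ag.1 - U_(i) + U_(i))%MM by rewrite submK // lep1mP.
by rewrite mdegD mdeg1; lia.
Qed.

Lemma Fil_wpolyX m o P : Fil o P -> Fil (u * (mdeg m)%:Z + o) (wpoly 'X_[m] * P).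
Proof.
move=> hP; elim/mnm_ind: m => [|m i ih].
  by rewrite mpolyX0 wpoly1 mul1r mdeg0; apply: FilS hP; lia.
rewrite addmC mpolyXD wpolyM -mulrA; apply: (FilS _ (Fil_wx i ih)).
by rewrite mdegD mdeg1; lia.
Qed.

Lemma Fil_wdiff m o P : Fil o P -> Fil (v * (mdeg m)%:Z + o) (wdiff K m * P).
Proof.
move=> hP; elim/mnm_ind: m => [|m i ih].
  by rewrite wdiff0 mul1r mdeg0; apply: FilS hP; lia.
rewrite wdiffS -mulrA; apply: (FilS _ (Fil_wd i ih)).
by rewrite mdegD mdeg1; lia.
Qed.

Lemma FilM o o' P Q : Fil o P -> Fil o' Q -> Fil (o + o') (P * Q).
Proof.
move=> hP hQ; move: P hP; apply: Fil_ind => [|P1 P2|c ag h].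
- by rewrite mul0r; apply: Fil0.
- by rewrite mulrDl; apply: FilD.
rewrite -scalerAl; apply: FilZ; rewrite /wmon -mulrA.
apply: (FilS _ (Fil_wpolyX _ (Fil_wdiff _ hQ))); move: h; rewrite /mwt; lia.
Qed.

Lemma Fil1 : Fil 0 1.
Proof.
have -> : (1 : D) = wmon (0, 0)%MM by rewrite /wmon mpolyX0 wdiff0 wpoly1 mulr1.
by apply: (FilS _ (Fil_wmon _)); rewrite /mwt !mdeg0; lia.
Qed.

Lemma Fil_x i : Fil u (wx K i).
Proof.
have -> : wx K i = wmon (U_(i), 0)%MM by rewrite /wmon wdiff0 mulr1.
by apply: (FilS _ (Fil_wmon _)); rewrite /mwt /= mdeg0 mdeg1; lia.
Qed.

Lemma Fil_d i : Fil v (wd K i).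
Proof.
have -> : wd K i = wmon (0, U_(i))%MM by rewrite /wmon mpolyX0 wpoly1 mul1r.
by apply: (FilS _ (Fil_wmon _)); rewrite /mwt /= mdeg0 mdeg1; lia.
Qed.

Lemma Fil_adj o P : Fil o P -> Fil o (weyl_adj P).
Proof.
move: P; apply: Fil_ind => [|P1 P2|c ag h]; first by rewrite weyl_adj0; apply: Fil0.
  by rewrite weyl_adjD; apply: FilD.
rewrite weyl_adjZ weyl_adj_term; apply: FilZ.
have hm : Fil o (wdiff K ag.2 * wpoly 'X_[ag.1]).
  rewrite -[wpoly 'X_[_]]mulr1; apply: (FilS _ (Fil_wdiff _ (Fil_wpolyX _ Fil1))).
  by move: h; rewrite /mwt; lia.
by rewrite -signr_odd; case: (odd _); rewrite ?expr1 ?expr0 ?mulN1r ?mul1r //; apply: FilN.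
Qed.

End Fil.
End Filtrations.

(** * Left ideals and homogeneous operators *)

Section LeftIdeals.
Context (D : nzRingType).
Implicit Types (S T : set D) (P Q : D).

Lemma lideal0 S : lideal S 0.
Proof.
by exists 0%N, (fun=> 0), (fun=> 0); split=> [[]//|]; rewrite big_ord0.
Qed.

Lemma lideal_mem S P : S P -> lideal S P.
Proof.
by move=> SP; exists 1%N, (fun=> 1), (fun=> P); split => //; rewrite big_ord1 mul1r.
Qed.

Lemma lidealD S P Q : lideal S P -> lideal S Q -> lideal S (P + Q).
Proof.
move=> [k [a [s [hs ->]]]] [l [b [t [ht ->]]]].
exists (k + l)%N, (fun i => match split i with inl j => a j | inr j => b j end),
  (fun i => match split i with inl j => s j | inr j => t j end).
split=> [i|]; first by case: split.
rewrite big_split_ord /=; congr (_ + _); apply: eq_bigr => i _.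
  by rewrite -[lshift _ _]/(unsplit (inl i)) unsplitK.
by rewrite -[rshift _ _]/(unsplit (inr i)) unsplitK.
Qed.

Lemma lidealM S P Q : lideal S Q -> lideal S (P * Q).
Proof.
move=> [k [a [s [hs ->]]]]; exists k, (fun i => P * a i), s; split => //.
by rewrite mulr_sumr; apply: eq_bigr => i _; rewrite mulrA.
Qed.

Lemma lidealN S P : lideal S P -> lideal S (- P).
Proof. by move=> h; rewrite -mulN1r; apply: lidealM. Qed.

Lemma lidealB S P Q : lideal S P -> lideal S Q -> lideal S (P - Q).
Proof. by move=> hP hQ; apply: lidealD => //; apply: lidealN. Qed.

Lemma lideal_sum S (I : Type) (s : seq I) (Pr : pred I) (F : I -> D) :
  (forall i, Pr i -> lideal S (F i)) -> lideal S (\sum_(i <- s | Pr i) F i).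
Proof. by move=> h; apply: big_ind => //; [apply: lideal0 | apply: lidealD]. Qed.

Lemma lideal_rangeP m (X : 'I_m -> D) P :
  lideal (range X) P -> exists a : 'I_m -> D, P = \sum_(j < m) a j * X j.
Proof.
move=> [k [a [s [hs ->]]]]; elim/big_ind : _ => [|P1 P2 [a1 ->] [a2 ->]|i _].
- by exists (fun=> 0); rewrite big1 // => j _; rewrite mul0r.
- exists (fun j => a1 j + a2 j); rewrite -big_split /=.
  by apply: eq_bigr => j _; rewrite mulrDl.
have [j _ <-] := hs i; exists (fun j' => if j' == j then a i else 0).
rewrite (bigD1 j) //= eqxx big1 ?addr0 // => j' /negPf ->.
by rewrite mul0r.
Qed.

End LeftIdeals.

Lemma lidealZ (K : comNzRingType) (D : algType K) (S : set D) (c : K) P :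
  lideal S P -> lideal S (c *: P).
Proof. by move=> h; rewrite -[P]mul1r scalerAl; apply: lidealM. Qed.

Section Homogeneous.
Context (n : nat) (K : numFieldType).
Local Notation A := {mpoly K[n]}.
Local Notation D := (weyl n K).
Local Notation mono := ('X_{1..n} * 'X_{1..n})%type.
Local Notation V := (@Fil n K 1 (-1)).
Implicit Types (P Q H : D) (ag : mono) (d o : int).

Lemma mwt_weight ag : mwt 1 (-1) ag = wweight ag.
Proof. by rewrite /mwt /wweight; lia. Qed.

Lemma weyl_adjK : involutive (@weyl_adj n K).
Proof.
elim/weyl_ind => [|a g|P Q ihP ihQ]; rewrite ?weyl_adj0 //; last first.
  by rewrite !weyl_adjD ihP ihQ.
rewrite weyl_adjM weyl_adjM !weyl_adj_poly; congr (_ * _).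
elim/mnm_ind: g => [|g i ih].
  by rewrite wdiff0 -wpoly1 !weyl_adj_poly.
rewrite wdiffS weyl_adjM weyl_adjM ih.
have -> : weyl_adj (weyl_adj (wd K i)) = wd K i.
  have aN P : weyl_adj (- P) = - weyl_adj P :> D.
    by rewrite -scaleN1r weyl_adjZ scaleN1r.
  by rewrite weyl_adj_d aN weyl_adj_d opprK.
by [].
Qed.

Definition wpart d P : D :=
  \sum_(ag <- wsupp P | wweight ag == d) wc ag P *: wmon K ag.

Lemma wc_wpart d P ag : wc ag (wpart d P) = if wweight ag == d then wc ag P else 0.
Proof.
rewrite /wpart (wc_sum_wmon _ _ _ id) /=; case: ifP => wd; last first.
  by rewrite big1 // => bh /andP[/eqP E1 /eqP E2]; rewrite -E2 E1 eqxx in wd.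
under eq_bigl => bh do rewrite andbC.
have [agP|agP] := boolP (ag \in wsupp P).
  rewrite -big_filter_cond filter_pred1_uniq ?wsupp_uniq //.
  by rewrite big_cons big_nil wd addr0.
rewrite big_seq_cond big1.
  by apply/esym/eqP; move: agP; rewrite mem_wsupp negbK.
by move=> bh /and3P[bhP /eqP E _]; rewrite E (negPf agP) in bhP.
Qed.

Lemma inwE P : inw P = wpart (ordw P) P.
Proof. by []. Qed.

Lemma wpartD d P Q : wpart d (P + Q) = wpart d P + wpart d Q.
Proof.
by apply: wc_eqP => ag; rewrite raddfD /= !wc_wpart raddfD /=; case: ifP; rewrite ?addr0.
Qed.

Lemma wpart0 d : wpart d 0 = 0.
Proof. by apply: wc_eqP => ag; rewrite wc_wpart raddf0 if_same. Qed.

Variant whom d P : Prop := Whom of (forall ag, wc ag P != 0 -> wweight ag = d).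

Lemma whom_wpart d P : whom d (wpart d P).
Proof. by split=> ag; rewrite wc_wpart; case: ifP => [/eqP//|_]; rewrite eqxx. Qed.

(** Splitting homogeneity into membership in two opposite filtrations lets its stability under
    products and sums be inherited from [Fil]. *)
Lemma whomE d P : whom d P <-> V d P /\ @Fil n K (-1) 1 (- d) P.
Proof.
split=> [[h]|[[h1] [h2]]].
  by split; split=> ag /h <-; rewrite /mwt /wweight; lia.
by split=> ag wP; have := h1 _ wP; have := h2 _ wP; rewrite /mwt /wweight; lia.
Qed.

Lemma whomM d e P Q : whom d P -> whom e Q -> whom (d + e) (P * Q).
Proof.
move=> /whomE[P1 P2] /whomE[Q1 Q2]; apply/whomE; split; first exact: FilM.
by rewrite opprD; apply: FilM.
Qed.

Lemma whom_wmon ag : whom (wweight ag) (wmon K ag).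
Proof. by split=> bh; rewrite wc_wmon; have [->|] := eqVneq bh ag; rewrite ?eqxx. Qed.

Lemma wpart_whom d e P : whom e P -> wpart d P = if d == e then P else 0.
Proof.
case=> h; apply: wc_eqP => ag; rewrite wc_wpart.
have [P0|/h ->] := eqVneq (wc ag P) 0; last first.
  by rewrite eq_sym; case: eqP; rewrite ?raddf0.
by rewrite P0 if_same; case: ifP; rewrite ?raddf0.
Qed.

Lemma wpartZ d c P : wpart d (c *: P) = c *: wpart d P.
Proof.
by apply: wc_eqP => ag; rewrite wcZ !wc_wpart wcZ; case: ifP; rewrite ?mulr0.
Qed.

Lemma wpartM d e P H : whom e H -> wpart (d + e) (P * H) = wpart d P * H.
Proof.
move=> hH; rewrite [P]wexpand mulr_suml.
elim/big_ind2 : _ => [|P1 P2 Q1 Q2 h1 h2|ag _].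
- by rewrite !wpart0 mul0r.
- by rewrite !wpartD mulrDl h1 h2.
rewrite -scalerAl !wpartZ -scalerAl; congr (_ *: _).
rewrite (wpart_whom _ (whomM (whom_wmon ag) hH)) (wpart_whom _ (whom_wmon ag)).
by rewrite (inj_eq (addIr _)); case: ifP; rewrite ?mul0r.
Qed.

Lemma Fil_ordw P : V (ordw P) P.
Proof. by split=> ag; rewrite -mem_wsupp mwt_weight => /ordw_max. Qed.

Lemma ordw_le o P : P != 0 -> V o P -> ordw P <= o.
Proof.
move=> /ordw_attained[ag]; rewrite mem_wsupp => agP <- /Fil_wc /(_ agP).
by rewrite mwt_weight.
Qed.

Lemma Fil_wpart_sub o P : V o P -> V (o - 1) (P - wpart o P).
Proof.
case=> h; split=> ag; rewrite raddfB /= wc_wpart; case: ifP => E.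
  by rewrite subrr eqxx.
rewrite subr0 => /h; move: E; rewrite mwt_weight => /negbT /eqP; lia.
Qed.

Lemma ordw_adj P : ordw (weyl_adj P) = ordw P.
Proof.
have [->|P0] := eqVneq P 0; first by rewrite weyl_adj0.
have aP0 : weyl_adj P != 0.
  by apply: contraNneq P0 => E; rewrite -[P]weyl_adjK E weyl_adj0.
apply/eqP; rewrite eq_le; apply/andP; split; apply: ordw_le => //.
  by apply: Fil_adj => //; apply: Fil_ordw.
by rewrite -{2}[P]weyl_adjK; apply: Fil_adj => //; apply: Fil_ordw.
Qed.

Lemma theta_wx i : theta n K * wx K i = wx K i * (theta n K - 1).
Proof.
rewrite /theta mulNr mulrBr mulrN mulr1 mulr_suml mulr_sumr -opprD; congr (- _).
have E j : wd K j * wx K j * wx K i = wx K i * (wd K j * wx K j) + (i == j)%:R * wx K i.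
  rewrite -mulrA wx_comm mulrA wd_wx mulrDl -mulrA; congr (_ + _).
  rewrite eq_sym; case: eqP => [->|]; by rewrite ?mul0r.
under eq_bigr => j _ do rewrite E.
rewrite big_split /=; congr (_ + _); rewrite (bigD1 i) //= eqxx mul1r.
by rewrite big1 ?addr0 // => j; rewrite eq_sym => /negPf ->; rewrite mul0r.
Qed.

Lemma theta_wd i : theta n K * wd K i = wd K i * (theta n K + 1).
Proof.
suff H : wd K i * (\sum_j wd K j * wx K j) = (\sum_j wd K j * wx K j) * wd K i + wd K i.
  by rewrite /theta mulNr mulrDr mulrN H mulr1 opprD subrK.
rewrite mulr_suml mulr_sumr.
have E j : wd K i * (wd K j * wx K j) = wd K j * wx K j * wd K i + (i == j)%:R * wd K i.
  rewrite mulrA wd_comm -!mulrA wd_wx mulrDr; congr (_ + _).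
  by case: eqP => [->|]; rewrite ?mulr0 ?mul0r // mulr1 mul1r.
under eq_bigr => j _ do rewrite E.
rewrite big_split /=; congr (_ + _); rewrite (bigD1 i) //= eqxx mul1r.
by rewrite big1 ?addr0 // => j; rewrite eq_sym => /negPf ->; rewrite mul0r.
Qed.

(** Up to sign and an additive constant, [theta] is the Euler operator sum x_i d_i, whose commutator
    with an operator of weight d multiplies that operator by d. *)
Lemma theta_whom d H : whom d H -> theta n K * H = H * (theta n K - d%:~R).
Proof.
case=> h; rewrite [H]wexpand mulr_sumr mulr_suml big_seq [RHS]big_seq.
apply: eq_bigr => -[a g]; rewrite mem_wsupp => /h <-.
rewrite -scalerAl -scalerAr; congr (_ *: _); rewrite /wmon /wweight /=.
have -> : ((mdeg a)%:Z - (mdeg g)%:Z)%:~R = (mdeg a)%:R - (mdeg g)%:R :> D.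
  by rewrite intrB.
have Ea : theta n K * wpoly 'X_[a] = wpoly 'X_[a] * (theta n K - (mdeg a)%:R).
  elim/mnm_ind: a {h} => [|a i ih]; first by rewrite mpolyX0 mdeg0 wpoly1 mul1r mulr1 subr0.
  rewrite mpolyXD wpolyM mulrA ih -!mulrA; congr (_ * _); rewrite mulrBl theta_wx.
  by rewrite mdegD mdeg1 natrD -[_%:R * wx _ _]commr_nat -mulrBr addrAC opprD addrA addrAC.
have Eg (t : D) : (forall i, t * wd K i = wd K i * (t + 1)) ->
    t * wdiff K g = wdiff K g * (t + (mdeg g)%:R).
  move=> ht; elim/mnm_ind: g {h} => [|g i ih].
    by rewrite wdiff0 mdeg0 mul1r mulr1 addr0.
  rewrite addmC wdiffD -/(wd K i) mulrA ht -!mulrA; congr (_ * _).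
  by rewrite mulrDl ih mul1r mdegD mdeg1 -{2}[wdiff K g]mulr1 -mulrDr natrD -addrA [1 + _]addrC.
rewrite mulrA Ea -!mulrA; congr (_ * _); rewrite Eg => [|i].
  by rewrite opprB addrA addrAC.
rewrite mulrBl theta_wd -[_%:R * wd _ _]commr_nat -mulrBr; congr (_ * _).
by rewrite addrAC.
Qed.

End Homogeneous.

(** * Action on polynomials *)

Section PlaneOperators.
Context (K : numFieldType).
Local Notation A := {mpoly K[2]}.
Local Notation D := (weyl 2 K).
Local Notation V := (@Fil 2 K 1 (-1)).
Local Notation th := (theta 2 K).
Implicit Types (P Q T : D) (h u : A) (k o : int).

Lemma weyl_act_is_linear P : linear (weyl_act P).
Proof.
move=> c a b; rewrite /weyl_act scaler_sumr -big_split /=; apply: eq_bigr => g _.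
by rewrite mderivmD mderivmZ mulrDr scalerAr.
Qed.
HB.instance Definition _ P :=
  GRing.isLinear.Build K A A _ (weyl_act P) (weyl_act_is_linear P).

Lemma weyl_actZ c P h : weyl_act (c *: P) h = c *: weyl_act P h.
Proof. by rewrite weyl_scaleE weyl_act_polyM mul_mpolyC. Qed.

Lemma weyl_actN P h : weyl_act (- P) h = - weyl_act P h.
Proof. by rewrite -scaleN1r weyl_actZ scaleN1r. Qed.

Lemma weyl_actB P Q h : weyl_act (P - Q) h = weyl_act P h - weyl_act Q h.
Proof. by rewrite weyl_actD weyl_actN. Qed.

Lemma weyl_act_sum (I : Type) (s : seq I) (Pr : pred I) (F : I -> D) h :
  weyl_act (\sum_(i <- s | Pr i) F i) h = \sum_(i <- s | Pr i) weyl_act (F i) h.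
Proof.
by apply: (big_morph (fun P => weyl_act P h)) => [P Q|]; rewrite ?weyl_actD ?weyl_act0.
Qed.

Lemma weyl_adj_sum (I : Type) (s : seq I) (Pr : pred I) (F : I -> D) :
  weyl_adj (\sum_(i <- s | Pr i) F i) = \sum_(i <- s | Pr i) weyl_adj (F i).
Proof.
by apply: (big_morph (@weyl_adj 2 K)) => [P Q|]; rewrite ?weyl_adjD ?weyl_adj0.
Qed.

Lemma weyl_adjB P Q : weyl_adj (P - Q) = weyl_adj P - weyl_adj Q.
Proof. by rewrite weyl_adjD -[- Q]scaleN1r weyl_adjZ scaleN1r. Qed.

Lemma FdegP k h : Fdeg k h <-> forall a, h@_a != 0 -> (mdeg a)%:Z <= k.
Proof.
split=> H a; first by rewrite -mcoeff_msupp; apply: H.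
by rewrite mcoeff_msupp; apply: H.
Qed.

Lemma Fdeg0 k : Fdeg k (0 : A).
Proof. by move=> a; rewrite msupp0. Qed.

Lemma FdegD k h u : Fdeg k h -> Fdeg k u -> Fdeg k (h + u).
Proof. by move=> hh hu a /msuppD_le; rewrite mem_cat => /orP[/hh|/hu]. Qed.

Lemma FdegZ k c h : Fdeg k h -> Fdeg k (c *: h).
Proof. by move=> hh a /msuppZ_le /hh. Qed.

Lemma FdegB k h u : Fdeg k h -> Fdeg k u -> Fdeg k (h - u).
Proof. by move=> hh hu; apply: FdegD => //; rewrite -scaleN1r; apply: FdegZ. Qed.

Lemma Fdeg_sum k (I : Type) (s : seq I) (Pr : pred I) (F : I -> A) :
  (forall i, Pr i -> Fdeg k (F i)) -> Fdeg k (\sum_(i <- s | Pr i) F i).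
Proof. by move=> h; apply: big_ind => //; [apply: Fdeg0 | apply: FdegD]. Qed.

Lemma FdegS k k' h : k <= k' -> Fdeg k h -> Fdeg k' h.
Proof. by move=> kk hh a /hh /le_trans; apply. Qed.

Lemma Fdeg_lt0 k h : k < 0 -> Fdeg k h -> h = 0.
Proof.
move=> k0 hh; apply/msuppnil0; case E : (msupp h) => [//|a s].
by have := hh a; rewrite E mem_head => /(_ isT); lia.
Qed.

Lemma Fdeg_exists h : exists k : nat, Fdeg k%:Z h.
Proof. by exists (msize h) => a /msize_mdeg_lt /ltnW; rewrite lez_nat. Qed.

Lemma Fdeg_act o k P h : V o P -> Fdeg k h -> Fdeg (k + o) (weyl_act P h).
Proof.
move=> VP hh; move: P VP; apply: Fil_ind => [|P Q hP hQ|c [a g] wo].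
- by rewrite weyl_act0; apply: Fdeg0.
- by rewrite weyl_actD; apply: FdegD.
rewrite weyl_actZ weyl_act_term; apply: FdegZ => m.
move: wo; rewrite /mwt /= => wo.
rewrite mulrC (perm_mem (msuppMX _ _)) => /mapP[/= b]; rewrite mcoeff_msupp => hb ->.
have : (mdeg b + mdeg g)%N%:Z <= k.
  rewrite -mdegD; apply: hh; rewrite mcoeff_msupp.
  apply: contraNneq hb; rewrite mcoeff_mderivm addmC => ->.
  by rewrite mul0rn.
by rewrite mdegD; lia.
Qed.

(** The adjoint of [theta] is the Euler operator sum x_i d_i, diagonal on monomials with the degree
    as eigenvalue. *)
Lemma mcoeff_adj_theta h a :
  (weyl_act (weyl_adj th) h)@_a = (mdeg a)%:R * h@_a.
Proof.
have -> : weyl_adj th = \sum_(i < 2) wx K i * wd K i.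
  rewrite /theta -sumrN weyl_adj_sum; apply: eq_bigr => i _.
  rewrite -[- (_ * _)]scaleN1r weyl_adjZ weyl_adjM weyl_adj_x weyl_adj_d.
  by rewrite mulrN scaleN1r opprK.
rewrite weyl_act_sum raddf_sum /= mdegE natr_sum mulr_suml; apply: eq_bigr => i _.
rewrite weyl_actM weyl_act_x weyl_act_d mulrC mulrC.
have [a0|a0] := eqVneq (a i) 0%N.
  rewrite a0 mul0r; apply: memN_msupp_eq0; rewrite mulrC (perm_mem (msuppMX _ _)).
  apply/mapP => -[b _ E]; move: a0; rewrite E mnmDE mnm1E eqxx; lia.
have E : a = (a - U_(i) + U_(i))%MM by rewrite submK // lep1mP.
rewrite {1}E addmC mulrC mcoeffMX mcoeff_mderiv -E mnmBE mnm1E eqxx mulr_natl.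
by congr (_ *+ _); lia.
Qed.

Lemma Fdeg_adj_theta k h :
  Fdeg k h -> Fdeg (k - 1) (weyl_act (weyl_adj th) h - k%:~R *: h).
Proof.
move=> /FdegP hh; apply/FdegP => a; rewrite mcoeffB mcoeff_adj_theta mcoeffZ -mulrBl.
rewrite mulf_eq0 negb_or => /andP[ak /hh]; rewrite le_eqVlt => /orP[/eqP E|]; last lia.
by move: ak; rewrite -E -pmulrn subrr eqxx.
Qed.

(** In degree k - o the adjoint of [theta] acts as k - o up to lower degree, so that of [theta] + o
    acts as k. With this shift, arguments of the different degrees k - ord_w(L^j) are all multiplied
    by the same b(k). *)
Lemma Fdeg_adj_horner (b : {poly K}) o k h : Fdeg (k - o) h ->
  Fdeg (k - o - 1)
    (weyl_act (weyl_adj (horner_alg (th + o%:~R) b)) h - b.[k%:~R] *: h).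
Proof.
move=> hh; elim/poly_ind: b => [|b c ih].
  by rewrite rmorph0 weyl_adj0 weyl_act0 horner0 scale0r subr0; apply: Fdeg0.
rewrite rmorphD rmorphM /= horner_algX horner_algC hornerMXaddC.
set B := horner_alg _ b in ih *; set z := weyl_act (weyl_adj B) h in ih *.
have az : weyl_act (weyl_adj (B * (th + o%:~R) + c%:A)) h =
    weyl_act (weyl_adj th) z + o%:~R *: z + c *: h.
  rewrite weyl_adjD weyl_actD weyl_adjZ -wpoly1 weyl_adj_poly wpoly1.
  rewrite weyl_actZ weyl_adjM weyl_actM weyl_adjD weyl_actD -/z; congr (_ + _ + _).
    rewrite -[o%:~R in LHS]scaler_int weyl_adjZ -wpoly1 weyl_adj_poly wpoly1 weyl_actZ.
    by rewrite -wdiff0 -[wdiff K 0]mul1r -wpoly1 weyl_act_term mul1r mderivm0m.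
  by rewrite -wdiff0 -[wdiff K 0]mul1r -wpoly1 weyl_act_term mul1r mderivm0m.
rewrite az.
have zF : Fdeg (k - o) z.
  rewrite -[z](subrK (b.[k%:~R] *: h)); apply: FdegD; last exact: FdegZ.
  by apply: FdegS ih; lia.
have -> : weyl_act (weyl_adj th) z + o%:~R *: z + c *: h - (b.[k%:~R] * k%:~R + c) *: h =
    (weyl_act (weyl_adj th) z - (k - o)%:~R *: z) + k%:~R *: (z - b.[k%:~R] *: h).
  rewrite intrB scalerBl scalerDl scalerBr scalerA [k%:~R * _]mulrC.
  set x1 := weyl_act _ _; set x2 := o%:~R *: _; set x3 := c *: _.
  set x4 := _ *: h; set x5 := _ *: z; clear.
  by rewrite opprD opprB !addrA; ring.
by apply: FdegD; [apply: Fdeg_adj_theta | apply: FdegZ].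
Qed.

(** If the operator were zero, applying its adjoint to x^k, where the leading coefficient becomes
    b(k), would make every natural number a root of b. *)
Lemma horner_theta_neq0 (b : {poly K}) : b != 0 -> horner_alg th b != 0.
Proof.
move=> b0; apply/eqP => E.
have root_nat (k : nat) : root b k%:R.
  have hk : Fdeg k%:Z ('X_[U_(ord0) *+ k] : A).
    by move=> a; rewrite msuppX inE => /eqP ->; rewrite mdegMn mdeg1 mul1n.
  rewrite -[k%:Z]subr0 in hk; have := @Fdeg_adj_horner b 0 k%:Z _ hk.
  rewrite (_ : th + 0%:~R = th) ?mulr0z ?addr0 // E weyl_adj0 weyl_act0 add0r => /FdegP/(_ (U_(ord0) *+ k)%MM).
  rewrite mcoeffN mcoeffZ mcoeffX eqxx mulr1 mdegMn mdeg1 mul1n oppr_eq0.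
  by rewrite /root -pmulrn; case: eqP => // _ /(_ isT); lia.
have := max_poly_roots b0 (rs := [seq (j%:R : K) | j : nat <- iota 0 (size b)]).
rewrite size_map size_iota ltnn => H; suff : false by [].
apply: H; first by apply/allP => _ /mapP[k _ ->].
by rewrite map_inj_uniq ?iota_uniq // => i j /eqP; rewrite eqr_nat => /eqP.
Qed.

End PlaneOperators.

(** * Reduction by a Groebner basis *)

Section OperatorImages.
Context (K : numFieldType).
Local Notation A := {mpoly K[2]}.
Local Notation D := (weyl 2 K).

(** Relations without degree bounds. For the L_i of Step 1 the quotient of K[x,y] by this space is
    H^2, whereas [Fimage] is the bounded version that the algorithm computes. *)
Definition opimage m (L : 'I_m -> D) : set A :=
  [set u | exists h : 'I_m -> A, u = \sum_(j < m) weyl_act (L j) (h j)].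

Lemma opimageD m (L : 'I_m -> D) u v :
  opimage L u -> opimage L v -> opimage L (u + v).
Proof.
move=> [h ->] [h' ->]; exists (fun j => h j + h' j).
by rewrite -big_split; apply: eq_bigr => j _; rewrite raddfD.
Qed.

Lemma opimageZ m (L : 'I_m -> D) c u : opimage L u -> opimage L (c *: u).
Proof.
move=> [h ->]; exists (fun j => c *: h j).
by rewrite scaler_sumr; apply: eq_bigr => j _; rewrite linearZ.
Qed.

(** Since (a X)^* h = X^* (a^* h), coefficients on the left of X are absorbed into the argument.
    Hence the image depends only on the left ideal generated by the X_j. *)
Lemma opimage_lideal m (X : 'I_m -> D) P h :
  lideal (range X) P -> opimage (fun j => weyl_adj (X j)) (weyl_act (weyl_adj P) h).
Proof.
move=> /lideal_rangeP[a ->]; exists (fun j => weyl_act (weyl_adj (a j)) h).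
rewrite weyl_adj_sum weyl_act_sum; apply: eq_bigr => j _.
by rewrite weyl_adjM weyl_actM.
Qed.

Lemma opimage_sub m m' (X : 'I_m -> D) (Y : 'I_m' -> D) :
  (forall j, lideal (range Y) (X j)) ->
  opimage (fun j => weyl_adj (X j)) `<=` opimage (fun j => weyl_adj (Y j)).
Proof.
move=> XY u [h ->]; apply: big_ind => [||j _]; last exact: opimage_lideal.
  by exists (fun=> 0); rewrite big1 // => j _; rewrite raddf0.
exact: opimageD.
Qed.

Lemma Fimage_opimage m (L : 'I_m -> D) k : Fimage L k `<=` opimage L.
Proof. by move=> u [h [_ ->]]; exists h. Qed.

Lemma FimageD m (L : 'I_m -> D) k u v :
  Fimage L k u -> Fimage L k v -> Fimage L k (u + v).
Proof.
move=> [h [hh ->]] [h' [hh' ->]]; exists (fun j => h j + h' j); split.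
  by move=> j; apply: FdegD.
by rewrite -big_split; apply: eq_bigr => j _; rewrite raddfD.
Qed.

Lemma FimageZ m (L : 'I_m -> D) k c u : Fimage L k u -> Fimage L k (c *: u).
Proof.
move=> [h [hh ->]]; exists (fun j => c *: h j); split.
  by move=> j; apply: FdegZ.
by rewrite scaler_sumr; apply: eq_bigr => j _; rewrite linearZ.
Qed.

Lemma FimageB m (L : 'I_m -> D) k u v :
  Fimage L k u -> Fimage L k v -> Fimage L k (u - v).
Proof. by move=> hu hv; apply: FimageD => //; rewrite -scaleN1r; apply: FimageZ. Qed.

Lemma Fimage0 m (L : 'I_m -> D) k : Fimage L k 0.
Proof.
exists (fun=> 0); split=> [j|]; first exact: Fdeg0.
by rewrite big1 // => j _; rewrite raddf0.
Qed.

Lemma Fimage_sum m (L : 'I_m -> D) k (T : Type) (s : seq T) (Pr : pred T) F :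
  (forall i, Pr i -> Fimage L k (F i)) -> Fimage L k (\sum_(i <- s | Pr i) F i).
Proof. by move=> h; apply: big_ind => //; [apply: Fimage0 | apply: FimageD]. Qed.

End OperatorImages.

Section HomogeneousZero.
Context (n : nat) (K : numFieldType).
Local Notation D := (weyl n K).
Local Notation th := (theta n K).

Lemma whomD d (P Q : D) : whom d P -> whom d Q -> whom d (P + Q).
Proof. by move=> /whomE[p1 p2] /whomE[q1 q2]; apply/whomE; split; apply: FilD. Qed.

Lemma whom_alg (c : K) : whom 0 (c%:A : D).
Proof.
have -> : (1 : D) = wmon K (0, 0)%MM by rewrite /wmon mpolyX0 wdiff0 wpoly1 mulr1.
have := whom_wmon K ((0, 0)%MM : 'X_{1..n} * 'X_{1..n}).
by rewrite /wweight !mdeg0 => /whomE[p1 p2]; apply/whomE; split; apply: FilZ.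
Qed.

Lemma whom_theta : whom 0 th.
Proof.
apply/whomE; rewrite oppr0.
split; apply: FilN; apply: Fil_sum => i _;
  [rewrite -[0 : int](addNr 1) | rewrite -[0 : int](subrr 1)].
  by apply: FilM; [lia | apply: Fil_d | apply: Fil_x].
by apply: FilM; [lia | apply: Fil_d | apply: Fil_x].
Qed.

Lemma whom_theta_shift o : whom 0 (th + o%:~R).
Proof. by rewrite -scaler_int; apply: whomD; [apply: whom_theta | apply: whom_alg]. Qed.

Lemma whom_horner (t : D) (b : {poly K}) : whom 0 t -> whom 0 (horner_alg t b).
Proof.
move=> ht; elim/poly_ind: b => [|b' c ih].
  by rewrite rmorph0; split=> ag; rewrite raddf0 eqxx.
rewrite rmorphD rmorphM /= horner_algX horner_algC.
by apply: whomD; [rewrite -[0 : int]addr0; apply: whomM | apply: whom_alg].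
Qed.

Lemma whom_horner_theta (b : {poly K}) : whom 0 (horner_alg th b).
Proof. exact: whom_horner whom_theta. Qed.

Lemma horner_theta_shift (b : {poly K}) o (H : D) : whom o H ->
  horner_alg (th + o%:~R) b * H = H * horner_alg th b.
Proof.
move=> hH; elim/poly_ind: b => [|b' c ih]; first by rewrite !rmorph0 mul0r mulr0.
rewrite !rmorphD !rmorphM /= !horner_algX !horner_algC [LHS]mulrDl [RHS]mulrDr.
congr (_ + _); last by rewrite -scalerAl -scalerAr mulr1 mul1r.
rewrite mulrA -ih -!mulrA; congr (_ * _); rewrite mulrDl (theta_whom hH).
by rewrite mulrBr -[_%:~R * H]commr_int subrK.
Qed.

End HomogeneousZero.

Section GroebnerTruncation.
Context (K : numFieldType) (I : set (weyl 2 K)) (m : nat) (G : 'I_m -> weyl 2 K).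
Hypothesis hG : groebner I G.
Local Notation A := {mpoly K[2]}.
Local Notation D := (weyl 2 K).
Local Notation V := (@Fil 2 K 1 (-1)).
Local Notation th := (theta 2 K).
Local Notation L := (fun j => weyl_adj (G j)).
Implicit Types (P Q T : D) (h u : A) (k o : int).

Lemma V_mul o o' P Q : V o P -> V o' Q -> V (o + o') (P * Q).
Proof. by apply: FilM; lia. Qed.

Lemma groebner_lift o T : inw_ideal I T -> whom o T ->
  exists c : 'I_m -> D, (forall j, V (o - ordw (G j)) (c j)) /\
    V (o - 1) (T - \sum_(j < m) c j * G j).
Proof.
case: hG => _ <- /lideal_rangeP[a E] hT.
pose c j := wpart (o - ordw (G j)) (a j).
have cV j : V (o - ordw (G j)) (c j) by have /whomE[] := whom_wpart (o - ordw (G j)) (a j).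
exists c; split => //.
have -> : T = \sum_(j < m) c j * inw (G j).
  have := wpart_whom o hT; rewrite eqxx => {1}<-; rewrite E.
  rewrite (big_morph _ (wpartD o) (wpart0 _ _ _)); apply: eq_bigr => j _.
  rewrite -[o in LHS](subrK (ordw (G j))) wpartM //.
  by rewrite inwE; apply: whom_wpart.
rewrite -sumrB; apply: Fil_sum => j _; rewrite -mulrBr -[_ - G j]opprB mulrN; apply: FilN.
have -> : o - 1 = (o - ordw (G j)) + (ordw (G j) - 1) by lia.
by apply: V_mul => //; rewrite inwE; apply: Fil_wpart_sub; apply: Fil_ordw.
Qed.

Lemma groebner_step o P : I P -> V o P ->
  exists c : 'I_m -> D, (forall j, V (o - ordw (G j)) (c j)) /\
    V (o - 1) (P - \sum_(j < m) c j * G j).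
Proof.
move=> IP VP; have H0 : V (o - 1) P -> exists c : 'I_m -> D,
    (forall j, V (o - ordw (G j)) (c j)) /\ V (o - 1) (P - \sum_(j < m) c j * G j).
  move=> VP'; exists (fun=> 0); split=> [j|]; first exact: Fil0.
  by rewrite big1 ?subr0 // => j _; rewrite mul0r.
have [P0|P0] := eqVneq P 0; first by apply: H0; rewrite P0; apply: Fil0.
have := ordw_le P0 VP; rewrite le_eqVlt => /orP[/eqP E|lt]; last first.
  by apply: H0; apply: FilS (Fil_ordw P); lia.
have [||c [cV cE]] := @groebner_lift o (inw P).
- by apply: lideal_mem; exists P.
- by rewrite inwE E; apply: whom_wpart.
exists c; split => //; rewrite -(subrK (inw P) P) -addrA; apply: FilD => //.
by rewrite inwE E; apply: Fil_wpart_sub.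
Qed.

Lemma groebner_approx (N : nat) o P : I P -> V o P ->
  exists c : 'I_m -> D, (forall j, V (o - ordw (G j)) (c j)) /\
    V (o - N%:Z) (P - \sum_(j < m) c j * G j).
Proof.
move=> IP VP; elim: N => [|N [c [cV cE]]].
  exists (fun=> 0); split=> [j|]; first exact: Fil0.
  by rewrite big1 ?subr0 // => j _; rewrite mul0r.
have [|c' [c'V c'E]] := groebner_step _ cE.
  case: hG => <- _; apply: lidealB; first by case: hG => ->.
  by apply: lideal_sum => j _; apply: lidealM; apply: lideal_mem; exists j.
exists (fun j => c j + c' j); split=> [j|].
  by apply: FilD => //; apply: FilS (c'V j); lia.
under eq_bigr => j _ do rewrite mulrDl.
rewrite big_split opprD addrA; apply: FilS c'E; lia.
Qed.

Lemma Fdeg_coef o k (c : 'I_m -> D) h j : V (o - ordw (G j)) (c j) -> Fdeg k h ->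
  Fdeg (k + o - ordw (L j)) (weyl_act (weyl_adj (c j)) h).
Proof.
move=> cV hh; rewrite ordw_adj -addrA; apply: Fdeg_act hh.
by apply: Fil_adj => //; lia.
Qed.

Lemma act_adj_sum (c : 'I_m -> D) h :
  weyl_act (weyl_adj (\sum_(j < m) c j * G j)) h =
  \sum_(j < m) weyl_act (L j) (weyl_act (weyl_adj (c j)) h).
Proof.
rewrite weyl_adj_sum weyl_act_sum; apply: eq_bigr => j _.
by rewrite weyl_adjM weyl_actM.
Qed.

(* The approximation need not terminate, since orders are unbounded below,
   but a remainder of order < -k kills the polynomials of degree <= k. *)
Lemma Fimage_ideal o k P h : I P -> V o P -> Fdeg k h ->
  Fimage L (k + o) (weyl_act (weyl_adj P) h).
Proof.
move=> IP VP hh; have [c [cV cE]] := groebner_approx (absz (k + o)%R).+1 IP VP.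
exists (fun j => weyl_act (weyl_adj (c j)) h); split=> [j|].
  exact: Fdeg_coef.
rewrite -act_adj_sum; apply/eqP; rewrite -subr_eq0 -weyl_actB -weyl_adjB; apply/eqP.
apply: (@Fdeg_lt0 _ (k + (o - (absz (k + o)%R).+1%:Z))); first by lia.
by apply: Fdeg_act hh; apply: Fil_adj => //; lia.
Qed.

Section BFunctionReduction.
Variable b : {poly K}.
Hypothesis hb : inw_ideal I (horner_alg th b).

(** Up to an error of order -1, b(theta) equals an element of I, whose adjoint sends u to v. Since
    the adjoint of b(theta) multiplies the part of u of degree k by b(k), the difference has lower
    degree. *)
Lemma Fimage_deg k u : Fdeg k u ->
  exists2 v, Fimage L k v & Fdeg (k - 1) (b.[k%:~R] *: u - v).
Proof.
move=> hu; have [c [cV cE]] := groebner_lift hb (whom_horner_theta _ _).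
exists (weyl_act (weyl_adj (\sum_(j < m) c j * G j)) u).
  exists (fun j => weyl_act (weyl_adj (c j)) u); split; last exact: act_adj_sum.
  by move=> j; rewrite -[k]addr0; apply: Fdeg_coef.
set v := weyl_act _ u.
have -> : b.[k%:~R] *: u - v = weyl_act (weyl_adj (horner_alg th b)) u - v
   - (weyl_act (weyl_adj (horner_alg th b)) u - b.[k%:~R] *: u).
  by rewrite opprB [RHS]addrC addrA subrK.
apply: FdegB.
  rewrite -weyl_actB -weyl_adjB; have -> : k - 1 = k + (0 - 1) by lia.
  by apply: Fdeg_act hu; apply: Fil_adj => //; lia.
have := @Fdeg_adj_horner _ b 0 k u; rewrite mulr0z [th + 0]addr0 [k - 0]subr0; exact.
Qed.

(** Let P0 in I lift b(theta) and let o_j = ord_w(G_j). Both b(theta + o_j) G_j and G_j P0 have the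
    initial part in_w(G_j) b(theta), so their difference Y_j, again in I, has order at most o_j - 1.
    Applying adjoints to u = sum L_j h_j turns this into an expression of b(k) u by relations whose
    degree bound is one lower. *)
Lemma Fimage_descend k u : b.[k%:~R] != 0 ->
  Fimage L k u -> Fdeg (k - 1) u -> Fimage L (k - 1) u.
Proof.
move=> bk [h [hh uE]] hu; have [c [cV cE]] := groebner_lift hb (whom_horner_theta _ _).
set P0 := \sum_(j < m) _ in cE.
pose t j := horner_alg (th + (ordw (G j))%:~R) b.
pose Y j : D := t j * G j - G j * P0.
have IG j : I (G j) by case: hG => <- _; apply: lideal_mem; exists j.
have IP0 : I P0.
  case: hG => E _; rewrite -E; apply: lideal_sum => j _; apply: lidealM; rewrite E.
  exact: IG.
have IM P Q : I Q -> I (P * Q) by case: hG => <- _; apply: lidealM.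
have IY j : I (Y j).
  by case: hG => E _; rewrite /Y -E; apply: lidealB; rewrite E; apply: IM.
have tV j : V 0 (t j).
  by have /whomE[] := whom_horner b (@whom_theta_shift 2 K (ordw (G j))).
have YV j : V (ordw (G j) - 1) (Y j).
  (* Every summand has a factor from which the initial part has been removed; what is left out
     cancels because in_w(G_j) intertwines b(theta + o_j) and b(theta). *)
  have -> : Y j = t j * (G j - inw (G j)) + (inw (G j) - G j) * horner_alg th b
      + G j * (horner_alg th b - P0).
    rewrite /Y /t !mulrBr mulrBl inwE (horner_theta_shift _ (whom_wpart _ _)).
    by rewrite [X in _ = X + _]addrA subrK addrA subrK.
  apply: FilD; last by apply: V_mul => //; exact: Fil_ordw.
  apply: FilD.
    by rewrite -[_ - 1]add0r; apply: V_mul => //; apply: Fil_wpart_sub; apply: Fil_ordw.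
  rewrite -[_ - 1]addr0; apply: V_mul; last by have /whomE[] := whom_horner_theta 2 b.
  by rewrite -[_ - G j]opprB; apply: FilN; apply: Fil_wpart_sub; apply: Fil_ordw.
suff H : Fimage L (k - 1) (b.[k%:~R] *: u).
  by rewrite -[u](scalerK bk); apply: FimageZ.
(* The bound drops for a different reason in each term: Y_j has smaller order, u has degree at most
   k - 1, and t_j^* h_j agrees with b(k) h_j in top degree. *)
have E : b.[k%:~R] *: u = \sum_(j < m) weyl_act (weyl_adj (Y j)) (h j)
   + weyl_act (weyl_adj P0) u
   - \sum_(j < m) weyl_act (L j) (weyl_act (weyl_adj (t j)) (h j) - b.[k%:~R] *: h j).
  have -> : weyl_act (weyl_adj P0) u = \sum_(j < m) weyl_act (weyl_adj (G j * P0)) (h j).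
    rewrite {1}uE raddf_sum; apply: eq_bigr => j _.
    by rewrite weyl_adjM weyl_actM.
  rewrite -big_split -sumrB {1}uE scaler_sumr; apply: eq_bigr => j _ /=.
  rewrite raddfB /= linearZ /= -weyl_actM -weyl_adjM -weyl_actD -weyl_adjD subrK.
  by rewrite opprB addrC subrK.
rewrite E; apply: FimageB; last first.
  exists (fun j => weyl_act (weyl_adj (t j)) (h j) - b.[k%:~R] *: h j); split => // j.
  have := hh j; rewrite ordw_adj => /(@Fdeg_adj_horner _ b).
  by apply: FdegS; lia.
apply: FimageD.
  apply: Fimage_sum => j _; have := Fimage_ideal (IY j) (YV j) (hh j).
  by rewrite ordw_adj; congr (Fimage _ _ _); lia.
rewrite act_adj_sum; exists (fun j => weyl_act (weyl_adj (c j)) u); split=> // j.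
by rewrite -[k - 1]addr0; apply: Fdeg_coef.
Qed.

End BFunctionReduction.
End GroebnerTruncation.

(** * Logarithmic cohomology *)

Section FinalStep.
Context (K : numFieldType) (I : set (weyl 2 K)) (m : nat) (G : 'I_m -> weyl 2 K).
Hypothesis hG : groebner I G.
Variable b : {poly K}.
Hypothesis hb : inw_ideal I (horner_alg (theta 2 K) b).
Local Notation A := {mpoly K[2]}.
Local Notation L := (fun j => weyl_adj (G j)).

Lemma Fdeg_reduce (k0 : int) (d : nat) (u : A) :
  (forall k, k0 < k -> b.[k%:~R] != 0) -> Fdeg (k0 + d%:Z) u ->
  exists2 u0, Fdeg k0 u0 & opimage L (u - u0).
Proof.
move=> hk; elim: d u => [|d ih] u hu.
  exists u; first by rewrite addr0 in hu.
  by rewrite subrr; apply: (@Fimage_opimage _ _ _ 0); apply: Fimage0.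
have [v hv hw] := Fimage_deg hG hb hu; set c := b.[_] in hw.
have c0 : c != 0 by apply: hk; lia.
have [|u0 hu0 hi] := ih (c^-1 *: (c *: u - v)).
  by apply: FdegZ; apply: FdegS hw; lia.
exists u0 => //; rewrite scalerBr scalerK // in hi.
have -> : u - u0 = u - c^-1 *: v - u0 + c^-1 *: v by rewrite [u - _]addrC addrAC addrNK addrC.
apply: opimageD => //; apply: opimageZ; exact: Fimage_opimage hv.
Qed.

Lemma opimage_Fdeg (k0 : int) (u : A) :
  (forall k, k0 < k -> b.[k%:~R] != 0) -> opimage L u -> Fdeg k0 u -> Fimage L k0 u.
Proof.
move=> hk [h uE] hu.
(* For large d the given h_j already satisfy the bounds of degree k0 + d; from there the relation
   descends to k0 one degree at a time. *)
have [d hd] : exists d : nat, forall j, Fdeg (k0 + d%:Z - ordw (L j)) (h j).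
  pose e j := sval (cid (Fdeg_exists (h j))).
  exists (\sum_(j < m) (e j + absz (k0 - ordw (L j))))%N => j.
  apply: FdegS (svalP (cid (Fdeg_exists (h j)))); rewrite -/(e j).
  by rewrite (bigD1 j) //=; lia.
have {hd uE} : Fimage L (k0 + d%:Z) u by exists h.
elim: d => [|d ih] hF; first by rewrite addr0 in hF.
apply: ih; have -> : k0 + d%:Z = k0 + d.+1%:Z - 1 by lia.
apply: (Fimage_descend hG hb) => //; first by apply: hk; lia.
by apply: FdegS hu; lia.
Qed.

Lemma final_step_basis N (c : 'I_N -> A) : final_step b L c ->
  quotient_basis setT (opimage L) c.
Proof.
case=> [[k0 [[_ kmax] [cF cfree cspan]]]|[nroot N0]].
  have hk k : k0%:Z < k -> b.[k%:~R] != 0.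
    case: k => k; rewrite ?NegzE; last by lia.
    by rewrite ltz_nat ltnNge; apply: contraNneq => bk; apply: kmax; apply/rootP.
  split=> // [a ha|u _].
    apply: cfree; apply: opimage_Fdeg => //; apply: Fdeg_sum => i _.
    exact: FdegZ.
  have [d hd] := Fdeg_exists u.
  have [|u0 hu0 hu] := @Fdeg_reduce k0%:Z d u hk; first by apply: FdegS hd; lia.
  have [a ha] := cspan _ hu0; exists a; rewrite -(subrK u0 u) -addrA.
  by apply: opimageD => //; apply: Fimage_opimage ha.
(* Without natural roots the reduction can go on down to k0 = -1, and F_(-1) = 0, so every
   polynomial is a relation. *)
move: c; rewrite N0 => c; split=> [[]//|a _ []//|u _].
exists (fun=> 0); rewrite big_ord0 subr0.
have hk k : -1 < k -> b.[k%:~R] != 0.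
  by case: k => k; rewrite ?NegzE; [move=> _; exact: nroot k | lia].
have [d hd] := Fdeg_exists u.
have [|u0 hu0] := @Fdeg_reduce (-1) d.+1 u hk; first by apply: FdegS hd; lia.
by rewrite (Fdeg_lt0 _ hu0) ?subr0 //.
Qed.

End FinalStep.

(** * Logarithmic forms and syzygies *)

Section FieldIdentities.
Context (F : fieldType).
Implicit Types f fx fy p q r : F.

Lemma dwedge_identity f fx fy p q r : f != 0 ->
  (fx * (q / f) - fy * (p / f) == r) = (fy * p - fx * q + f * r == 0).
Proof.
move=> f0; rewrite -(inj_eq (mulfI f0)).
have -> : f * (fx * (q / f) - fy * (p / f)) = fx * q - fy * p by field.
by rewrite addr_eq0 -[in RHS]eqr_opp opprB opprK.
Qed.

Lemma quotient_rule_identity f fx fy p px q qx r : f != 0 ->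
  fy * p - fx * q + f * r = 0 ->
  (qx * f - q * fx) / f ^+ 2 - (px * f - p * fy) / f ^+ 2 = (qx - px - r) / f.
Proof.
move=> f0 S; apply/eqP; rewrite -subr_eq0; apply/eqP.
by transitivity ((fy * p - fx * q + f * r) / f ^+ 2); [field | rewrite S mul0r].
Qed.

End FieldIdentities.

Section LogCohomology.
Context (K : numFieldType).
Local Notation A := {mpoly K[2]}.
Local Notation ix := (0 : 'I_2).
Local Notation iy := (1 : 'I_2).
Variable f : A.
Hypothesis f0 : f != 0.

Lemma ratf_neq0 : ratf f != 0.
Proof. by rewrite rat_eq0. Qed.

Lemma Omega2_logP om : Omega2_log f om <-> exists u, om = ratf u / ratf f.
Proof.
split=> [[_ [u _ E]]|[u ->]]; first by exists u; rewrite E mulrC mulKf // ratf_neq0.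
split; first by exists u, 1%N; rewrite expr1.
by exists u => //; rewrite mulrC divfK // ratf_neq0.
Qed.

(** With omega = (p dx + q dy) / f the entry r is the coefficient of df /\ omega, so both
    polynomiality conditions together amount to one syzygy. *)
Lemma Omega1_logP om : Omega1_log f om <->
  exists p q r, syzygy f p q r /\ om = (ratf p / ratf f, ratf q / ratf f).
Proof.
have F0 := ratf_neq0; split.
  case: om => om1 om2 [_ [[p _ /= E1] [q _ /= E2]] [r _ /= E3]].
  have e1 : om1 = ratf p / ratf f by rewrite E1 mulrC mulKf.
  have e2 : om2 = ratf q / ratf f by rewrite E2 mulrC mulKf.
  exists p, q, r; split; last by rewrite e1 e2.
  apply: rat_inj; rewrite rmorphD rmorphB !rmorphM rmorph0 /=.
  by apply/eqP; rewrite -dwedge_identity // -e1 -e2 E3.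
move=> [p [q [r [S ->]]]]; split; first split=> /=.
- by exists p, 1%N; rewrite expr1.
- by exists q, 1%N; rewrite expr1.
- split=> /=; [exists p | exists q] => //; by rewrite mulrC divfK.
exists r => //; rewrite /dwedge /=.
move: S; rewrite /syzygy => /(congr1 (@ratf 2 K)).
rewrite rmorphD rmorphB !rmorphM rmorph0 /= => S.
by apply/esym/eqP; rewrite dwedge_identity // S.
Qed.

(** The quotient rule leaves the double pole (f_x q - f_y p) / f^2, which the syzygy reduces to r /
    f. *)
Lemma d1_log p q r : syzygy f p q r ->
  d1 (ratf p / ratf f, ratf q / ratf f) = ratf (q^`M(ix) - p^`M(iy) - r) / ratf f.
Proof.
have F0 := ratf_neq0.
rewrite /syzygy => /(congr1 (@ratf 2 K)); rewrite rmorphD rmorphB !rmorphM rmorph0 /= => S.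
rewrite /d1 /= !rat_derivE // !(rmorphB, rmorphM) /=.
exact: quotient_rule_identity S.
Qed.

(** For omega = (p dx + q dy) / f this is the numerator of d(a omega), which explains the shape of
    L_i: its image consists of the differentials of all polynomial multiples of one logarithmic
    form. *)
Lemma log_operator_act p q r a : syzygy f p q r ->
  weyl_act (log_operator f p q) a =
  q * a^`M(ix) - p * a^`M(iy) + (q^`M(ix) - p^`M(iy) - r) * a.
Proof.
move=> S; rewrite /log_operator weyl_actD weyl_actB !weyl_act_polyM !weyl_act_d.
rewrite (@mquotE _ _ _ f (- r)) //; last first.
  by apply/eqP; rewrite mulNr -addr_eq0 [r * _]mulrC; apply/eqP.
by congr (_ + _); rewrite -[wpoly _]mulr1 weyl_act_polyM -wdiff0 -[wdiff K 0]mul1r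
  -wpoly1 weyl_act_term mul1r mderivm0m.
Qed.

Variables (m : nat) (p q r : 'I_m -> A).
Hypothesis hpqr : syzygy_generators f p q r.

Lemma d1_Omega1_log : @d1 K @` Omega1_log f =
  [set om | exists2 u, opimage (fun i => log_operator f (p i) (q i)) u & om = ratf u / ratf f].
Proof.
case: hpqr => hs hgen.
have E (a : 'I_m -> A) : let P := \sum_(i < m) a i * p i in
    let Q := \sum_(i < m) a i * q i in let R := \sum_(i < m) a i * r i in
    Q^`M(ix) - P^`M(iy) - R =
    \sum_(i < m) weyl_act (log_operator f (p i) (q i)) (a i).
  rewrite /= (raddf_sum (mderiv ix)) (raddf_sum (mderiv iy)) /= -!sumrB; apply: eq_bigr => i _.
  by rewrite (log_operator_act _ (hs i)) !mderivM; ring.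
rewrite predeqE => om; split.
  move=> [_ /Omega1_logP[p' [q' [r' [S ->]]]] <-]; rewrite (d1_log S).
  have [a [-> -> ->]] := hgen _ _ _ S.
  by exists (\sum_(i < m) weyl_act (log_operator f (p i) (q i)) (a i)); [exists a | rewrite E].
move=> [_ [a ->] ->]; rewrite -E.
set P := \sum_(i < m) a i * p i; set Q := \sum_(i < m) a i * q i.
set R := \sum_(i < m) a i * r i.
have S : syzygy f P Q R.
  rewrite /syzygy !mulr_sumr -sumrB -big_split big1 //= => i _.
  have := hs i; rewrite /syzygy => S.
  by transitivity (a i * (f^`M(iy) * p i - f^`M(ix) * q i + f * r i));
    [ring | rewrite S mulr0].
exists (ratf P / ratf f, ratf Q / ratf f); last exact: d1_log.
by apply/Omega1_logP; exists P, Q, R.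
Qed.

Lemma H2_log_basis_opimage N (c : 'I_N -> A) :
  quotient_basis setT (opimage (fun i => log_operator f (p i) (q i))) c ->
  H2_log_basis f (fun i => ratf (c i) / ratf f).
Proof.
have F0 := ratf_neq0.
have lin (a : 'I_N -> K) : \sum_(i < N) a i *: (ratf (c i) / ratf f) =
    ratf (\sum_(i < N) a i *: c i) / ratf f.
  rewrite raddf_sum mulr_suml; apply: eq_bigr => i _.
  by rewrite /GRing.scale /= /rat_scale mulrA -rmorphM mul_mpolyC.
move=> [_ cfree cspan]; split.
- by move=> i; apply/Omega2_logP; exists (c i).
- move=> a; rewrite lin d1_Omega1_log => -[u hu /(mulIf (invr_neq0 F0)) /rat_inj E].
  by apply: cfree; rewrite E.
move=> _ /Omega2_logP[u ->]; have [a ha] := cspan u I; exists a.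
rewrite lin d1_Omega1_log; exists (u - \sum_(i < N) a i *: c i) => //.
by rewrite rmorphB mulrBl.
Qed.

End LogCohomology.

(** * Bivariate elimination *)

Section PolynomialFacts.

(** The zero polynomial is included because the greatest common divisor in [zero_dim_elimination]
    may vanish. *)
Lemma irreducible_factor (F : fieldType) (g : {poly F}) : size g != 1%N ->
  exists2 d, irreducible_poly d & d %| g.
Proof.
have [->|g0] := eqVneq g 0.
  by exists ('X - 0%:P); [apply: irredp_XsubC | apply: dvdp0].
move: {2}(size g) (leqnn (size g)) => k; elim: k g g0 => [|k ih] g g0 gk g1.
  by rewrite leqn0 size_poly_eq0 (negPf g0) in gk.
have gsz : (1 < size g)%N by rewrite ltn_neqAle eq_sym g1 size_poly_gt0.
have [irr|/existsNP[q /not_implyP[q1 /not_implyP[qg nqg]]]] :=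
    pselect (forall q : {poly F}, size q != 1%N -> q %| g -> q %= g).
  by exists g.
have q0 : q != 0 by apply: contraTneq qg => ->; rewrite dvd0p.
have [|d dirr dq] := ih q q0 _ q1; last by exists d => //; apply: dvdp_trans qg.
rewrite -ltnS; apply: leq_trans gk; rewrite ltn_neqAle dvdp_leq // andbT.
by apply/negP => /eqP sz; apply: nqg; rewrite -dvdp_size_eqp // sz.
Qed.

Lemma exists_nonroot (K : numDomainType) (p : {poly K}) : p != 0 -> exists x, p.[x] != 0.
Proof.
move=> p0; apply: contrapT => /forallNP hr.
have := max_poly_roots p0 (rs := [seq (j%:R : K) | j : nat <- iota 0 (size p)]).
rewrite size_map size_iota ltnn => H; suff : false by [].
apply: H; first by apply/allP => _ /mapP[k _ ->]; apply: contrapT => /negP; exact: hr.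
by rewrite map_inj_uniq ?iota_uniq // => i j /eqP; rewrite eqr_nat => /eqP.
Qed.

Local Notation tofrac := (@FracField.tofrac _).

Lemma frac_quotient (R : idomainType) (x : {fraction R}) :
  exists n d : R, d != 0 /\ x * tofrac d = tofrac n.
Proof.
exists \n_(repr x), \d_(repr x); split; first exact: denom_ratioP.
rewrite -{1}[x]reprK; unlock FracField.tofrac.
rewrite -[LHS]FracField.pi_mul; apply/eqmodP => /=.
rewrite FracField.equivfE /FracField.mulf.
by rewrite !numden_Ratio ?(oner_eq0, mulf_neq0, denom_ratioP) // !mulr1 mulrC.
Qed.

Lemma clear_denominators (R : idomainType) (u : {poly {fraction R}}) :
  exists (c : R) (U : {poly R}), c != 0 /\ tofrac c *: u = map_poly tofrac U.
Proof.
elim/poly_ind: u => [|u x [c [U [c0 E]]]].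
  by exists 1, 0; rewrite oner_neq0 scaler0 rmorph0.
have [n [d [d0 Ex]]] := frac_quotient x.
exists (d * c), ((d *: U) * 'X + (c * n)%:P); split; first by rewrite mulf_neq0.
rewrite tofracM rmorphD /= (rmorphM (map_poly tofrac)) /= map_polyX map_polyC /=.
rewrite map_polyZ /= -E tofracM -Ex scalerDr scalerAl scalerA; congr (_ + _).
by rewrite -mul_polyC -polyCM; congr _%:P; rewrite mulrC [_ * tofrac c]mulrC mulrCA mulrA.
Qed.

End PolynomialFacts.

Section Bivariate.
Context (K : fieldType) (i j : 'I_2).
Hypothesis ij : i != j.
Local Notation A := {mpoly K[2]}.
Local Notation B := {poly {poly K}}.

Lemma ord2_cases (k : 'I_2) : k = i \/ k = j.
Proof.
case: i j ij k => [[|[|//]] ?] [[|[|//]] ?] // _ [[|[|//]] ?];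
  by [left; apply: val_inj | right; apply: val_inj].
Qed.

(** The main variable is x_j and the coefficients lie in K[x_i], so that passing to K(x_i)[x_j]
    gives a Euclidean domain. *)
Definition to_bipoly : A -> B :=
  mmap ((@polyC {poly K}) \o (@polyC K)) (fun k => if k == i then 'X%:P else 'X).
HB.instance Definition _ := GRing.RMorphism.on to_bipoly.

Definition of_bipoly : B -> A := horner_eval ('X_j : A) \o map_poly (horner_alg ('X_i : A)).
HB.instance Definition _ := GRing.RMorphism.on of_bipoly.

Lemma to_bipolyC c : to_bipoly c%:MP = c%:P%:P.
Proof. by rewrite /to_bipoly mmapC. Qed.

Lemma to_bipolyXi : to_bipoly 'X_i = 'X%:P.
Proof. by rewrite /to_bipoly mmapX mmap1U eqxx. Qed.

Lemma to_bipolyXj : to_bipoly 'X_j = 'X.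
Proof. by rewrite /to_bipoly mmapX mmap1U eq_sym (negPf ij). Qed.

Lemma of_bipolyC c : of_bipoly c%:P = horner_alg 'X_i c.
Proof. by rewrite /of_bipoly /= map_polyC /horner_eval hornerC. Qed.

Lemma of_bipolyX : of_bipoly 'X = 'X_j.
Proof. by rewrite /of_bipoly /= map_polyX /horner_eval hornerX. Qed.

Lemma to_bipolyK : cancel to_bipoly of_bipoly.
Proof.
elim/mterm_ind => [|a m|p q ihp ihq]; last 1 first.
- by rewrite !rmorphD /= ihp ihq.
- by rewrite !rmorph0.
 rewrite -mul_mpolyC rmorphM /= rmorphM /= to_bipolyC of_bipolyC horner_algC alg_mpolyC.
rewrite mpolyXE_id; congr (_ * _).
rewrite (rmorph_prod to_bipoly) (rmorph_prod of_bipoly); apply: eq_bigr => k _.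
rewrite (rmorphXn to_bipoly) (rmorphXn of_bipoly) /=; congr (_ ^+ _).
case: (ord2_cases k) => ->; first by rewrite to_bipolyXi of_bipolyC horner_algX.
by rewrite to_bipolyXj of_bipolyX.
Qed.

Lemma to_bipoly_alg_i c : to_bipoly (horner_alg 'X_i c) = c%:P.
Proof.
elim/poly_ind: c => [|c x ih]; first by rewrite !rmorph0.
rewrite rmorphD rmorphM /= horner_algX horner_algC (rmorphD to_bipoly) (rmorphM to_bipoly) /= ih.
by rewrite alg_mpolyC to_bipolyC to_bipolyXi rmorphD rmorphM.
Qed.

Lemma to_bipoly_alg_j c : to_bipoly (horner_alg 'X_j c) = map_poly polyC c.
Proof.
elim/poly_ind: c => [|c x ih]; first by rewrite !rmorph0.
rewrite rmorphD rmorphM /= horner_algX horner_algC (rmorphD to_bipoly) (rmorphM to_bipoly) /= ih.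
rewrite alg_mpolyC to_bipolyC to_bipolyXj rmorphD rmorphM /= map_polyX.
by rewrite map_polyC.
Qed.

Lemma meval_bipoly v a : a.@[v] = (to_bipoly a).[(v j)%:P].[v i].
Proof.
elim/mterm_ind: a => [|a m|p q ihp ihq]; last 1 first.
- by rewrite mevalD rmorphD !hornerD ihp ihq.
- by rewrite meval0 rmorph0 !horner0.
rewrite -mul_mpolyC mevalM mevalC mevalX rmorphM /= to_bipolyC !hornerM !hornerC.
rewrite mpolyXE_id (rmorph_prod to_bipoly) !horner_prod; congr (_ * _).
apply: eq_bigr => k _; rewrite (rmorphXn to_bipoly) !horner_exp /=; congr (_ ^+ _).
case: (ord2_cases k) => ->; first by rewrite to_bipolyXi hornerC hornerX.
by rewrite to_bipolyXj hornerX hornerC.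
Qed.

(** As a polynomial in x_j over K[x_i], g has a constant leading coefficient, so b can be divided by
    it. The remainder times h(x_i) is a multiple of g of smaller degree in x_j, hence zero. *)
Lemma coprime_regular (g h : {poly K}) (a b : A) : g != 0 -> h != 0 ->
  horner_alg 'X_j g * a = horner_alg 'X_i h * b ->
  exists c, b = c * horner_alg 'X_j g.
Proof.
move=> g0 h0 /(congr1 to_bipoly); rewrite !rmorphM /= to_bipoly_alg_i to_bipoly_alg_j.
set a' := to_bipoly a; set b' := to_bipoly b; set G := map_poly polyC g => E.
have szG : size G = size g by exact: size_map_polyC.
have lG : lead_coef G \is a GRing.unit.
  by rewrite lead_coef_map_inj // ?rmorph_unit ?unitfE ?lead_coef_eq0 //; apply: polyC_inj.
have := Pdiv.IdomainUnit.divp_eq lG b'; set q := _ %/ _; set r := _ %% _ => Eb.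
have G0 : G != 0 by rewrite -size_poly_gt0 szG size_poly_gt0.
have r0 : r = 0.
  apply/eqP; have : h *: r = (a' - h *: q) * G.
    rewrite -!mul_polyC mulrBl [a' * G]mulrC E Eb mulrDr.
    by rewrite mulrA addrC addKr.
  have [// |r0] := eqVneq r 0; move/(congr1 (size \o polyseq)) => /=.
  rewrite size_scale //; have [->|q0] := eqVneq (a' - h *: q) 0.
    by rewrite mul0r size_poly0 => /eqP; rewrite size_poly_eq0 (negPf r0).
  move=> sr; have : (size r < size G)%N by rewrite ltn_modp.
  by rewrite sr size_mul // (polySpred q0) addSn /= ltnNge leq_addl.
exists (of_bipoly q); rewrite -[b]to_bipolyK -/b' Eb r0 addr0 rmorphM; congr (_ * _).
by rewrite /= /G -to_bipoly_alg_j to_bipolyK.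
Qed.

End Bivariate.

Lemma bezout_scale2 (R : comNzRingType) (c0 c1 c2 u d w h : R) :
  c0 * c1 * c2 * (u * d + w * h) = c2 * (c1 * u) * (c0 * d) + c0 * c1 * (c2 * w) * h.
Proof. by ring. Qed.

Lemma bezout_scale3 (R : comNzRingType) (c1 c2 c3 s t u w h1 h2 h3 : R) :
  c1 * c2 * c3 * (s * (u * h1 + w * h2) + t * h3) =
  c2 * c3 * (c1 * (s * u)) * h1 + c1 * c3 * (c2 * (s * w)) * h2 + c1 * c2 * (c3 * t) * h3.
Proof. by ring. Qed.

Section IrreducibleCurve.
Context (K : numClosedFieldType) (i j : 'I_2).
Hypothesis ij : i != j.
Local Notation A := {mpoly K[2]}.
Local Notation B := {poly {poly K}}.
Local Notation tofrac := (@FracField.tofrac {poly K}).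
Local Notation hat := (map_poly tofrac).
Local Notation chi := (@to_bipoly K i).
Implicit Types (a : A) (v : 'I_2 -> K).

Lemma tofrac_inj : injective tofrac.
Proof. by move=> x y /eqP; rewrite tofrac_eq => /eqP. Qed.

Lemma hat_inj : injective hat.
Proof. by apply: map_inj_poly; [apply: tofrac_inj | apply: rmorph0]. Qed.

Lemma size_hat (b : B) : size (hat b) = size b.
Proof. by apply: size_map_inj_poly; [apply: tofrac_inj | apply: rmorph0]. Qed.

Lemma hatZ (c : {poly K}) (b : B) : hat (c *: b) = tofrac c *: hat b.
Proof. by rewrite map_polyZ. Qed.

Variable d : {poly {fraction {poly K}}}.
Hypothesis dirr : irreducible_poly d.

(** The zero set of the contraction to K[x,y] of the prime ideal (d) of K(x_i)[x_j]. *)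
Definition curve : set ('I_2 -> K) := zeroset [set a | d %| hat (chi a)].

(** Choose a value of x_i at which neither p nor the leading coefficient of d1 vanishes. The
    specialization of d1 keeps its positive degree in x_j, so it has a root over the algebraically
    closed field. *)
Lemma curve_point : exists2 d1 : B,
  (exists2 c0, c0 != 0 & tofrac c0 *: d = hat d1) &
  forall p : {poly K}, p != 0 ->
    exists v, [/\ curve v, p.[v i] != 0 & d1.[(v j)%:P].[v i] = 0].
Proof.
have [c0 [d1 [c00 Ed]]] := clear_denominators d.
exists d1; first by exists c0.
have sd1 : size d1 = size d by rewrite -size_hat -Ed size_scale // tofrac_eq0.
have d10 : d1 != 0 by rewrite -size_poly_gt0 sd1; case: dirr => /ltnW.
set l := lead_coef d1; have l0 : l != 0 by rewrite lead_coef_eq0.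
move=> p p0; have [x0] := exists_nonroot (mulf_neq0 p0 l0).
rewrite hornerM mulf_eq0 negb_or => /andP[px lx].
pose dx := map_poly (horner_eval x0) d1.
have sdx : size dx = size d1 by rewrite /dx size_map_poly_id0.
have [y0 /rootP ry] : exists y, root dx y.
  by apply/closed_rootP; rewrite sdx sd1; case: dirr => /gtn_eqF ->.
have evE (b : B) : b.[y0%:P].[x0] = (map_poly (horner_eval x0) b).[y0].
  by rewrite -{2}[y0](hornerC y0 x0) -/(horner_eval x0 y0%:P) horner_map.
pose v k := if k == i then x0 else y0.
have vi : v i = x0 by rewrite /v eqxx.
have vj : v j = y0 by rewrite /v eq_sym (negPf ij).
have d1v : d1.[(v j)%:P].[v i] = 0 by rewrite vi vj evE.
exists v; split => //; last by rewrite vi.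
(* Pseudo-division gives l^N a = q d1 + r. Over K(x_i) the remainder is divisible by d and has
   smaller degree, so it is zero; as l does not vanish at v, a does. *)
move=> a /= da; have := Pdiv.Idomain.divp_eq (chi a) d1; set N := scalp _ _.
set q := _ %/ _; set r := _ %% _ => E.
have r0 : r = 0.
  apply: hat_inj; rewrite rmorph0; apply/eqP; apply: contraT => hr0.
  have : d %| hat r.
    have -> : hat r = tofrac (l ^+ N) *: hat (chi a) - hat q * (tofrac c0 *: d).
      by rewrite -hatZ E Ed rmorphD rmorphM /= addrC addKr.
    apply: dvdp_sub; first by rewrite dvdpZr // tofrac_eq0 expf_neq0.
    by apply: dvdp_mull; rewrite dvdpZr ?tofrac_eq0.
  by move/(dvdp_leq hr0); rewrite size_hat -sd1 leqNgt ltn_modp d10.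
move: E; rewrite r0 addr0 => /(congr1 (fun b : B => b.[(v j)%:P].[v i])).
rewrite hornerZ !hornerM horner_exp d1v mulr0 -meval_bipoly // => /eqP.
by rewrite mulf_eq0 vi expf_eq0 (negPf lx) andbF => /eqP.
Qed.

Lemma irreducible_coprimep (q : {poly {fraction {poly K}}}) :
  ~~ (d %| q) -> coprimep d q.
Proof.
apply: contraR => co; case: dirr => _ /(_ _ co (dvdp_gcdl _ _)) /eqp_dvdl <-.
exact: dvdp_gcdr.
Qed.

(** Clearing denominators in a Bezout identity for d and a yields a nonzero polynomial in x_i alone
    that vanishes wherever d1 and a do. A point of the curve at which it is nonzero is then not a
    zero of a. *)
Lemma curve_nonvanishing a : ~~ (d %| hat (chi a)) -> exists2 v, curve v & a.@[v] != 0.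
Proof.
move=> /irreducible_coprimep /Bezout_eq1_coprimepP[[u w] /= uw].
have [d1 [c0 c00 Ed] hpt] := curve_point.
have [c1 [U [c10 EU]]] := clear_denominators u.
have [c2 [W [c20 EW]]] := clear_denominators w.
have [|v [cv pv d1v]] := hpt (c0 * c1 * c2); first by rewrite !mulf_neq0.
exists v => //; apply: contraNneq pv => av.
have E : (c0 * c1 * c2)%:P = (c2 *: U) * d1 + (c0 * c1) *: W * chi a.
  apply: hat_inj; rewrite map_polyC /= rmorphD !rmorphM /= !hatZ -Ed -EU -EW !rmorphM /=.
  rewrite -[LHS]mulr1 -uw -!mul_polyC !rmorphM /=.
  exact: bezout_scale2.
have := congr1 (fun b : B => b.[(v j)%:P].[v i]) E.
by rewrite /= hornerC hornerD !hornerM hornerD !hornerM d1v -meval_bipoly // av !mulr0 addr0 => ->.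
Qed.

(** Two closed sets not containing the curve provide equations s1 and s2 prime to d. Then d does not
    divide s1 s2, and a point of the curve where this product is nonzero lies in neither set. *)
Lemma curve_irreducible : zirreducible curve.
Proof.
split.
  have [d1 _ hpt] := curve_point; have [v [cv _ _]] := hpt 1 (oner_neq0 _).
  by exists v.
move=> _ _ [S1 ->] [S2 ->] sub; apply: contrapT => /not_orP[n1 n2].
have key S : ~ (curve `<=` zeroset S) -> exists2 s, S s & coprimep d (hat (chi s)).
  move=> nS; apply: contrapT => nex; apply: nS => v cv s Ss; apply: cv => /=.
  apply: contraT => nd; case: nex; exists s => //; exact: irreducible_coprimep.
have [s1 hs1 co1] := key _ n1; have [s2 hs2 co2] := key _ n2.
have [|v cv] := @curve_nonvanishing (s1 * s2).
  rewrite !rmorphM /=; apply/negP => dd.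
  have : coprimep d (hat (chi s1) * hat (chi s2)) by rewrite coprimepMr co1.
  move=> /(coprimep_dvdl dd); rewrite coprimepp => /eqP sz.
  by case: dirr; rewrite sz.
rewrite mevalM mulf_eq0 negb_or => /andP[v1 v2].
by case: (sub _ cv) => [/(_ s1 hs1) E|/(_ s2 hs2) E]; [move: v1 | move: v2]; rewrite E eqxx.
Qed.

(** A second point is found off the line on which x_i has its value at the first; it makes the
    inclusion of a point in the curve strict. *)
Lemma curve_two_points : exists v w, [/\ curve v, curve w & v <> w].
Proof.
have [d1 _ hpt] := curve_point.
have [v [cv _ _]] := hpt 1 (oner_neq0 _).
have [|w [cw pw _]] := hpt ('X - (v i)%:P); first by rewrite polyXsubC_eq0.
by exists v, w; split => // E; rewrite E hornerXsubC subrr eqxx in pw.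
Qed.

End IrreducibleCurve.

Section Elimination.
Context (K : numClosedFieldType) (i j : 'I_2).
Hypothesis ij : i != j.
Local Notation A := {mpoly K[2]}.
Local Notation hat := (map_poly (@FracField.tofrac {poly K})).
Local Notation chi := (@to_bipoly K i).

Lemma zclosed_point (v : 'I_2 -> K) : zclosed [set v].
Proof.
exists [set 'X_k - (v k)%:MP | k in [set: 'I_2]]; apply/seteqP; split=> w /=.
  by move=> -> _ [k _ <-]; rewrite mevalB mevalXU mevalC subrr.
move=> h; apply/funext => k; apply/eqP; rewrite -subr_eq0; apply/eqP.
by have := h ('X_k - (v k)%:MP); rewrite mevalB mevalXU mevalC; apply; exists k.
Qed.

Lemma zirreducible_point (v : 'I_2 -> K) : zirreducible [set v].
Proof.
split; first by exists v.
by move=> S T _ _ /(_ v erefl)[]; [left | right] => w ->.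
Qed.

Lemma of_bipoly_combination (f1 f2 f3 : A) (U1 U2 U3 : {poly {poly K}}) :
  of_bipoly i j (U1 * chi f1 + U2 * chi f2 + U3 * chi f3) =
  of_bipoly i j U1 * f1 + of_bipoly i j U2 * f2 + of_bipoly i j U3 * f3.
Proof.
rewrite !(rmorphD (of_bipoly i j)) /= !(rmorphM (of_bipoly i j)) /=.
by rewrite !to_bipolyK.
Qed.

(** Over K(x_i)[x_j], either the three polynomials generate the unit ideal, and clearing
    denominators in a Bezout identity gives c(x_i), or they share an irreducible factor, whose curve
    lies in the zero set. *)
Lemma zero_dim_elimination (f1 f2 f3 : A) :
  dim_le (zeroset [set f1; f2; f3]) 0 ->
  exists c : {poly K}, c != 0 /\
    exists u1 u2 u3 : A, horner_alg 'X_i c = u1 * f1 + u2 * f2 + u3 * f3.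
Proof.
move=> hdim; have [[u w] /= uw] := Bezoutp (hat (chi f1)) (hat (chi f2)).
set e := _ + _ in uw; have [co|nco] := boolP (coprimep e (hat (chi f3))).
  have /Bezout_eq1_coprimepP[[s t] /= st] := co.
  have [c1 [U1 [c10 E1]]] := clear_denominators (s * u).
  have [c2 [U2 [c20 E2]]] := clear_denominators (s * w).
  have [c3 [U3 [c30 E3]]] := clear_denominators t.
  exists (c1 * c2 * c3); split; first by rewrite !mulf_neq0.
  exists (of_bipoly i j ((c2 * c3) *: U1)), (of_bipoly i j ((c1 * c3) *: U2)),
    (of_bipoly i j ((c1 * c2) *: U3)).
  have E : (c1 * c2 * c3)%:P = ((c2 * c3) *: U1) * chi f1 + ((c1 * c3) *: U2) * chi f2
      + ((c1 * c2) *: U3) * chi f3.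
    apply: hat_inj; rewrite map_polyC /= !rmorphD !rmorphM /= !hatZ -E1 -E2 -E3 !rmorphM /=.
    rewrite -[LHS]mulr1 -st /e -!mul_polyC !rmorphM /=.
    exact: bezout_scale3.
  rewrite -(of_bipolyC i j (c1 * c2 * c3)) E.
  exact: of_bipoly_combination.
exfalso; have [d dirr dg] := irreducible_factor nco.
have de := dvdp_trans dg (dvdp_gcdl _ _); have d3 := dvdp_trans dg (dvdp_gcdr _ _).
have dg12 : d %| gcdp (hat (chi f1)) (hat (chi f2)) by rewrite -(eqp_dvdr _ uw).
have d1 := dvdp_trans dg12 (dvdp_gcdl _ _); have d2 := dvdp_trans dg12 (dvdp_gcdr _ _).
have sub : curve i d `<=` zeroset [set f1; f2; f3].
  by move=> v cv _ [[->|->]|->]; [exact: cv d1 | exact: cv d2 | exact: cv d3].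
have [v [w' [cv cw vw]]] := curve_two_points ij dirr.
(* The chain point < curve has length one, which dimension 0 forbids. *)
suff : (1 <= 0)%N by [].
apply: (hdim 1%N (fun k => if k == 0%N then [set v] else curve i d)) => [[|k] _|[|//] _] /=.
- split; [exact: zclosed_point | exact: zirreducible_point |].
  by move=> _ ->; apply: sub.
- split; [| exact: (curve_irreducible ij dirr) | exact: sub].
  by exists [set a | d %| hat (chi a)].
split; first by move=> _ ->.
by move=> /(_ _ cw) /esym.
Qed.

End Elimination.

(** * Linear algebra modulo a subspace *)

Section SpanCounting.
Context (K : fieldType) (E : lmodType K).
Implicit Types (U : set E).

(** Quotients are not formed: a dimension of E / U is expressed by families that span, or are
    independent, modulo U. *)
Definition subsp U : Prop := U 0 /\ forall c u v, U u -> U v -> U (c *: u + v).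

Section Subspace.
Variable U : set E.
Hypothesis sU : subsp U.

Lemma subspD u v : U u -> U v -> U (u + v).
Proof. by case: sU => _ h hu hv; rewrite -[u]scale1r; apply: h. Qed.

Lemma subspZ c u : U u -> U (c *: u).
Proof. by case: sU => h0 h hu; rewrite -[_ *: _]addr0; apply: h. Qed.

Lemma subspN u : U u -> U (- u).
Proof. by rewrite -scaleN1r; apply: subspZ. Qed.

Lemma subspB u v : U u -> U v -> U (u - v).
Proof. by move=> hu hv; apply: subspD => //; apply: subspN. Qed.

Lemma subsp_sum (I : Type) (s : seq I) (P : pred I) F :
  (forall i, P i -> U (F i)) -> U (\sum_(i <- s | P i) F i).
Proof. by move=> h; apply: big_ind => //; [case: sU | apply: subspD]. Qed.

Lemma dependent_family (I J : finType) (e : I -> E) (v : J -> E) :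
  (forall j, exists c : I -> K, U (v j - \sum_i c i *: e i)) -> (#|I| < #|J|)%N ->
  exists d : J -> K, (exists j, d j != 0) /\ U (\sum_j d j *: v j).
Proof.
move=> /choice[C hC] lt.
pose M : 'M[K]_(#|J|, #|I|) := \matrix_(a, b) C (enum_val a) (enum_val b).
have kerM : kermx M != 0.
  rewrite -mxrank_eq0 mxrank_ker subn_eq0 -ltnNge.
  exact: leq_ltn_trans (rank_leq_col M) lt.
have /row_subPn[a] : ~~ (kermx M <= (0 : 'M_(#|J|)))%MS by rewrite submx0.
rewrite submx0 => wa; pose d j := (row a (kermx M)) 0 (enum_rank j).
exists d; split.
  apply: contrapT => /forallNP dz; move/eqP: wa; apply; apply/rowP => b.
  by have := dz (enum_val b); rewrite /d enum_valK [RHS]mxE => /negP; rewrite negbK => /eqP.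
have -> : \sum_j d j *: v j = \sum_j d j *: (v j - \sum_i C j i *: e i).
  under [RHS]eq_bigr => j _ do rewrite scalerBr scaler_sumr.
  rewrite sumrB exchange_big /= [X in _ - X]big1 ?subr0 // => i _.
  under eq_bigr => j _ do rewrite scalerA.
  rewrite -scaler_suml.
  suff -> : \sum_j d j * C j i = 0 by rewrite scale0r.
  have /rowP/(_ (enum_rank i)) : row a (kermx M) *m M = 0.
    by apply/sub_kermxP; apply: row_sub.
  rewrite mxE [RHS]mxE => h0.
  rewrite (reindex (fun b : 'I_#|J| => enum_val b)) /=; last first.
    by apply: onW_bij; apply: enum_val_bij.
  by rewrite -[RHS]h0; apply: eq_bigr => b _; rewrite /d !mxE !enum_rankK enum_valK.
by apply: subsp_sum => j _; apply: subspZ; apply: hC.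
Qed.

Definition indep_on (T : finType) (e : T -> E) (S : {set T}) : Prop :=
  forall d : T -> K, U (\sum_(t in S) d t *: e t) -> forall t, t \in S -> d t = 0.

Lemma maximal_independent (T : finType) (e : T -> E) :
  exists S : {set T}, indep_on e S /\
    forall t, exists c : T -> K, U (e t - \sum_(s in S) c s *: e s).
Proof.
have P0 : `[< indep_on e finset.set0 >] by apply/asboolP => d _ t; rewrite finset.inE.
have [S /maxsetP[/asboolP iS maxS] _] :=
  maxset_exists (P := fun S : {set T} => `[< indep_on e S >]) P0.
exists S; split => // t; have [tS|tS] := boolP (t \in S).
  exists (fun s => (s == t)%:R).
  rewrite (bigD1 t) //= eqxx scale1r big1 ?addr0 ?subrr; first by case: sU.
  by move=> s /andP[_ /negPf ->]; rewrite scale0r.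
have nI : ~ indep_on e (t |: S).
  move=> iT; have := maxS (t |: S); rewrite finset.subsetUr => /(_ _ isT) E'.
  by rewrite -E' ?finset.setU11 // in tS; apply/asboolP.
move: nI => /existsNP[d /not_implyP[dU /existsNP[s /not_implyP[sT ds]]]].
rewrite big_setU1 //= in dU.
have dt : d t != 0.
  apply/eqP => dt0; apply: ds; move: dU sT; rewrite dt0 scale0r add0r => /iS iSd.
  by rewrite finset.in_setU1 => /orP[/eqP -> //|]; apply: iSd.
exists (fun s => - (d t)^-1 * d s).
have -> : e t - \sum_(s in S) (- (d t)^-1 * d s) *: e s =
    (d t)^-1 *: (d t *: e t + \sum_(s in S) d s *: e s).
  rewrite scalerDr scalerK // scaler_sumr -sumrN; congr (_ + _).
  by apply: eq_bigr => s' _; rewrite mulNr scaleNr opprK scalerA.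
exact: subspZ.
Qed.

End Subspace.

(* The elements of [e] indexed by [S] together with [v] are still independent,
   so their number is at most the dimension of the span of [e]. *)
Lemma codim_le U (T J : finType) (e : T -> E) (v : J -> E) : subsp U ->
  (forall j, U (v j)) ->
  (forall d : J -> K, \sum_j d j *: v j = 0 -> forall j, d j = 0) ->
  (forall j, exists c : T -> K, v j = \sum_t c t *: e t) ->
  exists S : {set T}, (#|S| + #|J| <= #|T|)%N /\
    forall t, exists c : T -> K, U (e t - \sum_(s in S) c s *: e s).
Proof.
move=> sU vU vfree vspan; have [S [iS spS]] := maximal_independent sU e.
exists S; split => //; rewrite leqNgt; apply/negP => lt.
pose w (x : {s | s \in S} + J) := match x with inl s => e (val s) | inr j => v j end.
have s0 : subsp [set (0 : E)] by split=> // c u u' /= -> ->; rewrite scaler0 addr0.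
have [|//|d [[x dx]]] := dependent_family s0 (e := e) (v := w).
- case=> [s|j] /=; last by have [c ->] := vspan j; exists c; rewrite subrr.
  exists (fun t => (t == val s)%:R).
  rewrite (bigD1 (val s)) //= eqxx scale1r big1 ?addr0 ?subrr // => t /negPf ->.
  by rewrite scale0r.
- by rewrite card_sum card_sig.
rewrite /= big_sumType /= => dw.
pose c t := if insub t is Some s then d (inl s) else 0.
have cE s : c (val s) = d (inl s) by rewrite /c valK.
have sumE : \sum_(s : {s | s \in S}) d (inl s) *: e (val s) = \sum_(t in S) c t *: e t.
  by rewrite [RHS]big_sub; apply: eq_bigr => s _; rewrite cE.
rewrite sumE in dw.
have c0 : forall t, t \in S -> c t = 0.
  apply: iS; move/eqP: dw; rewrite addr_eq0 => /eqP ->; apply: subspN => //.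
  by apply: subsp_sum => // j _; apply: subspZ.
move: dw; rewrite big1 ?add0r => [/vfree d0|t /c0 ->]; last by rewrite scale0r.
case: x dx => [s|j]; last by rewrite d0 eqxx.
by rewrite -cE c0 ?eqxx //; apply: valP.
Qed.

End SpanCounting.

(** * Independence of symbols *)

Section CurveRegularity.
Context (K : fieldType).
Local Notation A := {mpoly K[2]}.
Variable f : A.
Local Notation fx := (f^`M(0)).
Local Notation fy := (f^`M(1)).

Definition mdvd (a : A) : Prop := exists c, a = c * f.

Lemma mdvd0 : mdvd 0.
Proof. by exists 0; rewrite mul0r. Qed.

Lemma mdvdD a b : mdvd a -> mdvd b -> mdvd (a + b).
Proof. by move=> [c ->] [e ->]; exists (c + e); rewrite mulrDl. Qed.

Lemma mdvdM a b : mdvd b -> mdvd (a * b).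
Proof. by move=> [c ->]; exists (a * c); rewrite mulrA. Qed.

Lemma mdvdB a b : mdvd a -> mdvd b -> mdvd (a - b).
Proof. by move=> ha hb; apply: mdvdD => //; rewrite -mulN1r; apply: mdvdM. Qed.

(** The leading monomial of a nonzero multiple c f is the product of those of c and f. So
    polynomials without monomials divisible by [mlead f] are in normal form modulo f. *)
Lemma mdvd_lead a : mdvd a -> (forall m, a@_m != 0 -> ~~ (mlead f <= m)%MM) -> a = 0.
Proof.
move=> [c ->] h; have [->|f0] := eqVneq f 0; first by rewrite mulr0.
have [->|c0] := eqVneq c 0; first by rewrite mul0r.
have := h (mlead c + mlead f)%MM; rewrite mleadcM mulf_neq0 ?mleadc_eq0 //.
by move=> /(_ isT); rewrite lem_addl.
Qed.

Hypothesis f0 : f != 0.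
Hypothesis elim_f : forall i : 'I_2, exists c : {poly K}, c != 0 /\
  exists u1 u2 u3 : A, horner_alg 'X_i c = u1 * f + u2 * fx + u3 * fy.

(** The ideal (f, f_x, f_y) contains some h(x) and g(y), so h a = s f and g a = t f. Then g s = h t,
    and coprimality of g(y) and h(x) makes t = c g, whence a = c f. *)
Lemma gradient_regular a : mdvd (fx * a) -> mdvd (fy * a) -> mdvd a.
Proof.
move=> hx hy.
have key i : exists2 c : {poly K}, c != 0 & mdvd (horner_alg 'X_i c * a).
  have [c [c0 [u1 [u2 [u3 E]]]]] := elim_f i; exists c => //.
  rewrite E !mulrDl -!mulrA; apply: mdvdD; last exact: mdvdM.
  by apply: mdvdD; apply: mdvdM => //; exists a; rewrite mulrC.
have [h h0 [s Es]] := key 0; have [g g0 [t Et]] := key 1.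
have E : horner_alg 'X_1 g * s = horner_alg 'X_0 h * t.
  by apply: (mulIf f0); rewrite -!mulrA -Es -Et; ring.
have [c Ec] := coprime_regular (isT : (0 : 'I_2) != 1) g0 h0 E.
exists c; have gA : horner_alg ('X_1 : A) g != 0.
  apply: contraNneq g0 => /(congr1 (@to_bipoly K 1)).
  by rewrite to_bipoly_alg_i rmorph0 => /polyC_inj ->.
by apply: (mulfI gA); rewrite Et Ec; ring.
Qed.

Lemma gradient_regular_pow n a : mdvd (fx * a) -> mdvd (fy ^+ n * a) -> mdvd a.
Proof.
elim: n a => [|n ih] a hx; first by rewrite expr0 mul1r.
rewrite exprSr -mulrA => hy; apply: gradient_regular => //; apply: ih => //.
by rewrite mulrCA; apply: mdvdM.
Qed.

(** The b_n are the coefficients of a form sum b_n xi^n eta^(d-n) whose product with f_y xi - f_x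
    eta vanishes modulo f. Inductively f divides f_x b_n, and telescoping gives f_y^k b_n = f_x^k
    b_(n+k) modulo f, which is zero for large k. *)
Lemma gradient_regular_seq d (b : nat -> A) : (forall n, (d < n)%N -> b n = 0) ->
  mdvd (fx * b 0%N) -> (forall n, mdvd (fy * b n - fx * b n.+1)) ->
  forall n, mdvd (b n).
Proof.
move=> bd b0 bS; suff H n : mdvd (fx * b n) -> mdvd (b n).
  elim=> [|n bn]; first exact: H.
  apply: H; rewrite -[X in mdvd X](subKr (fy * b n)).
  by apply: mdvdB => //; apply: mdvdM.
move=> hx.
have powE k : mdvd (fy ^+ k * b n - fx ^+ k * b (n + k)%N).
  elim: k => [|k ih]; first by rewrite !expr0 addn0 subrr; apply: mdvd0.
  have -> : fy ^+ k.+1 * b n - fx ^+ k.+1 * b (n + k.+1)%N =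
      fy * (fy ^+ k * b n - fx ^+ k * b (n + k)%N)
      + fx ^+ k * (fy * b (n + k)%N - fx * b (n + k).+1).
    by rewrite !exprS addnS; ring.
  by apply: mdvdD; apply: mdvdM.
apply: (@gradient_regular_pow d.+1) => //.
by have := powE d.+1; rewrite [b (n + _)%N]bd ?mulr0 ?subr0 //; lia.
Qed.

End CurveRegularity.

(** * Orders and symbols of operators *)

Section OrderFiltration.
Context (n : nat) (K : numFieldType).
Local Notation A := {mpoly K[n]}.
Local Notation D := (weyl n K).
Local Notation O := (@Fil n K 0 1).
Implicit Types (P R : D) (f : A) (o : int) (i : 'I_n) (g : 'X_{1..n}).
Local Notation coef P g := ((P : {mpoly A[n]})@_g).

Lemma orderP o P : O o P <-> forall g, o < (mdeg g)%:Z -> coef P g = 0.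
Proof.
split=> [[h] g og|h].
  apply/mpolyP => a; rewrite mcoeff0; apply/eqP; apply: contraTT og => nz.
  by have := h (a, g) nz; rewrite /mwt /= => hle; rewrite -leNgt; lia.
split=> -[a g]; rewrite /wc /mwt /=; apply: contraNT; rewrite -ltNge => og.
by rewrite h ?mcoeff0 //; lia.
Qed.

Lemma order_lt0 P : O (-1) P -> P = 0.
Proof. by move=> /orderP h; apply/mpolyP => g; rewrite h ?mcoeff0 //; lia. Qed.

Lemma order_exists P : exists d : nat, O d%:Z P.
Proof.
exists (msize (P : {mpoly A[n]})); apply/orderP => g; rewrite ltz_nat => /ltnW h.
by apply: memN_msupp_eq0; apply: msize_mdeg_ge.
Qed.

Lemma order_wpoly f : O 0 (wpoly f).
Proof.
apply/orderP => g; rewrite ltz_nat => g0; rewrite /wpoly mcoeffC.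
have /negPf -> : g != 0%MM by rewrite -mdeg_eq0 -lt0n.
by rewrite mulr0.
Qed.

Lemma order_wdiff g : O (mdeg g)%:Z (wdiff K g).
Proof.
apply/orderP => m; rewrite /wdiff mcoeffX; case: eqP => // ->.
by rewrite ltxx.
Qed.

Lemma wdiff_comm_wpoly g f :
  O ((mdeg g)%:Z - 1) (wdiff K g * wpoly f - wpoly f * wdiff K g).
Proof.
elim/mnm_ind: g => [|g i ih].
  by rewrite wdiff0 mul1r mulr1 subrr; apply: Fil0.
have -> : wdiff K (g + U_(i)) * wpoly f - wpoly f * wdiff K (g + U_(i)) =
    wd K i * (wdiff K g * wpoly f - wpoly f * wdiff K g) + wpoly f^`M(i) * wdiff K g.
  rewrite wdiffS !mulrA mulrBr !mulrA wd_poly mulrDl opprD addrA.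
  by rewrite -[RHS]addrA addNr addr0.
rewrite mdegD mdeg1; apply: FilD.
  by apply: FilS (@Fil_wd _ _ 0 1 _ i _ _ ih); lia.
have uv : 0 <= 0 + 1 :> int by [].
by apply: FilS (FilM uv (order_wpoly _) (order_wdiff g)); lia.
Qed.

Lemma order_comm_wpoly o R f : O o R -> O (o - 1) (R * wpoly f - wpoly f * R).
Proof.
move: R; apply: Fil_ind => [|P Q hP hQ|c [a g]].
- by rewrite mul0r mulr0 subrr; apply: Fil0.
- have -> : (P + Q) * wpoly f - wpoly f * (P + Q) =
    (P * wpoly f - wpoly f * P) + (Q * wpoly f - wpoly f * Q).
    by rewrite mulrDl mulrDr opprD addrACA.
  exact: FilD.
rewrite /mwt /= => ag; rewrite -scalerAl -scalerAr -scalerBr; apply: FilZ.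
have -> : wmon K (a, g) * wpoly f - wpoly f * wmon K (a, g) =
    wpoly 'X_[a] * (wdiff K g * wpoly f - wpoly f * wdiff K g).
  by rewrite /wmon /= mulrBr !mulrA -!wpolyM [f * _]mulrC.
have uv : 0 <= 0 + 1 :> int by [].
by apply: FilS (FilM uv (order_wpoly _) (wdiff_comm_wpoly g f)); lia.
Qed.

(** The commutator of R with f has smaller order, so f passes through the coefficients of top
    order. *)
Lemma coef_mul_wpoly o R f g : O o R -> (mdeg g)%:Z = o ->
  coef (R * wpoly f) g = f * coef R g.
Proof.
move=> hR go; have /orderP/(_ g) := order_comm_wpoly f hR.
rewrite [coef (_ - _) g]mcoeffB wpoly_mul mcoeffZ => h; apply/eqP.
by rewrite -subr_eq0; apply/eqP; apply: h; rewrite go; lia.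
Qed.

(** A top symbol times f cannot vanish, so R has no terms above the order of R f. The case o = -1 is
    the injectivity of right multiplication by f. *)
Lemma order_mul_wpoly_inv o R f : f != 0 -> -1 <= o -> O o (R * wpoly f) -> O o R.
Proof.
move=> f0 o0 hRf; have [d hd] := order_exists R.
have : O (o + d.+1%:Z) R by apply: FilS hd; lia.
move: (d.+1) => {d hd} d; elim: d => [|d ih]; first by rewrite addr0.
move=> hR; apply: ih; apply/orderP => g og.
have [gd|gd] := ltrP (o + d.+1%:Z) (mdeg g)%:Z; first by have /orderP := hR; apply.
have E : (mdeg g)%:Z = o + d.+1%:Z by lia.
have := coef_mul_wpoly f hR E; have /orderP -> := hRf; last by lia.
by move/esym/eqP; rewrite mulf_eq0 (negPf f0) => /eqP.
Qed.

Lemma mul_wd P i : P * wd K i = (P : {mpoly A[n]}) * 'X_i :> {mpoly A[n]}.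
Proof.
elim/weyl_ind: P => [|a g|P Q ihP ihQ]; first by rewrite !mul0r.
  rewrite -mulrA -wdiffD wterm mpolyXD wterm -scalerAl //.
by rewrite mulrDl ihP ihQ; apply/esym; apply: mulrDl.
Qed.

Lemma coef_mul_wdS P i g : coef (P * wd K i) (g + U_(i)) = coef P g.
Proof. by rewrite mul_wd addmC mcoeffMX. Qed.

Lemma coef_mul_wd0 P i g : g i = 0%N -> coef (P * wd K i) g = 0.
Proof.
move=> gi; rewrite mul_wd; apply: memN_msupp_eq0; rewrite (perm_mem (msuppMX _ _)).
by apply/mapP => -[b _ E]; move: gi; rewrite E mnmDE mnm1E eqxx; lia.
Qed.

End OrderFiltration.

Section PlaneMonomials.

Definition mon2 (a b : nat) : 'X_{1..2} := (U_(0%R) *+ a + U_(1%R) *+ b)%MM.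

Lemma mon2_0 a b : mon2 a b 0 = a.
Proof. by rewrite mnmDE !mulmnE !mnm1E /=; lia. Qed.
Lemma mon2_1 a b : mon2 a b 1 = b.
Proof. by rewrite mnmDE !mulmnE !mnm1E /=; lia. Qed.

Lemma mon2E (g : 'X_{1..2}) : g = mon2 (g 0) (g 1).
Proof.
by apply/mnmP => k; case: (ord2_cases (isT : (0 : 'I_2) != 1) k) => ->;
  rewrite ?mon2_0 ?mon2_1.
Qed.

Lemma mdeg2 (g : 'X_{1..2}) : mdeg g = (g 0%R + g 1%R)%N.
Proof. by rewrite mdegE big_ord_recl big_ord1; congr (_ + g _)%N; apply: val_inj. Qed.

Lemma mdeg_mon2 a b : mdeg (mon2 a b) = (a + b)%N.
Proof. by rewrite mdeg2 mon2_0 mon2_1. Qed.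

Lemma mon2SU a b : mon2 a.+1 b = (mon2 a b + U_(0%R))%MM.
Proof.
by apply/mnmP => k; case: (ord2_cases (isT : (0 : 'I_2) != 1) k) => ->;
  rewrite mnmDE mnm1E ?mon2_0 ?mon2_1 /=; lia.
Qed.

Lemma mon2US a b : mon2 a b.+1 = (mon2 a b + U_(1%R))%MM.
Proof.
by apply/mnmP => k; case: (ord2_cases (isT : (0 : 'I_2) != 1) k) => ->;
  rewrite mnmDE mnm1E ?mon2_0 ?mon2_1 /=; lia.
Qed.

End PlaneMonomials.

Section SymbolIndependence.
Context (K : numFieldType).
Local Notation A := {mpoly K[2]}.
Local Notation D := (weyl 2 K).
Local Notation O := (@Fil 2 K 0 1).
Local Notation coef P g := ((P : {mpoly A[2]})@_g).
Variable f : A.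
Local Notation fx := (f^`M(0)).
Local Notation fy := (f^`M(1)).
Hypothesis f0 : f != 0.
Hypothesis elim_f : forall i : 'I_2, exists c : {poly K}, c != 0 /\
  exists u1 u2 u3 : A, horner_alg 'X_i c = u1 * f + u2 * fx + u3 * fy.

Definition hamiltonian : D := wpoly fy * wd K 0 - wpoly fx * wd K 1.

(** In top order the symbol of Q times f_y xi - f_x eta is a multiple of f, so by regularity the
    coefficients of that symbol are multiples of f. Being in normal form modulo f they vanish, and
    the order of Q drops until Q = 0. The normal form excludes the relation that [hamiltonian]
    commutes with f, where Q = f and R = - [hamiltonian]. *)
Lemma hamiltonian_independent (R Q : D) :
  R * wpoly f + Q * hamiltonian = 0 ->
  (forall ag, wc ag Q != 0 -> ~~ (mlead f <= ag.1)%MM) ->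
  R = 0 /\ Q = 0.
Proof.
move=> E hlead; have uv : 0 <= 0 + 1 :> int by [].
suff Q0 : Q = 0.
  split => //; apply: order_lt0; apply: (order_mul_wpoly_inv f0) => //.
  by move: E; rewrite Q0 mul0r addr0 => ->; apply: Fil0.
have [d0 hd0] := order_exists Q.
suff step d : O d%:Z Q -> O (d%:Z - 1) Q.
  have : O (d0.+1%:Z - 1) Q by apply: FilS hd0; lia.
  elim: d0.+1 => [|d ih] h; first by apply: order_lt0.
  by apply: ih; apply: step; apply: FilS h; lia.
move=> hQ; have Qh : Q * hamiltonian = Q * wpoly fy * wd K 0 - Q * wpoly fx * wd K 1.
  by rewrite /hamiltonian mulrBr !mulrA.
have hR : O (d%:Z + 1) R.
  apply: (order_mul_wpoly_inv f0); first by lia.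
  have -> : R * wpoly f = - (Q * hamiltonian) by apply/eqP; rewrite -addr_eq0 E.
  apply: FilN; rewrite Qh.
  have h (a : A) i : O (d%:Z + 1) (Q * wpoly a * wd K i).
    rewrite -[d%:Z]addr0; apply: FilM => //; last exact: Fil_d.
    by apply: FilM => //; apply: order_wpoly.
  exact: FilB.
(* The coefficient of xi^n eta^(d-n) in the symbol of Q, extended by zero. *)
pose b n := if (n <= d)%N then coef Q (mon2 n (d - n)) else 0.
have bQ (a : A) n : (n <= d)%N -> coef (Q * wpoly a) (mon2 n (d - n)) = a * b n.
  by move=> nd; rewrite (coef_mul_wpoly _ hQ) ?mdeg_mon2 /b ?nd //; lia.
have top g : (mdeg g)%:Z = d%:Z + 1 ->
    mdvd f (coef (Q * wpoly fy * wd K 0) g - coef (Q * wpoly fx * wd K 1) g).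
  move=> gd; exists (- coef R g); rewrite mulNr mulrC -(coef_mul_wpoly f hR gd).
  have : coef (R * wpoly f + (Q * wpoly fy * wd K 0 - Q * wpoly fx * wd K 1)) g = 0.
    by rewrite -Qh E mcoeff0.
  rewrite [coef (_ + _) g]mcoeffD [coef (_ - _) g]mcoeffB => /eqP.
  by rewrite addrC addr_eq0 => /eqP.
have bdvd : forall n, mdvd f (b n).
  apply: (gradient_regular_seq f0 elim_f (d := d)).
  - by move=> n; rewrite ltnNge /b => /negPf ->.
  - have := top (mon2 0 d.+1); rewrite mdeg_mon2 coef_mul_wd0 ?mon2_0 // mon2US.
    rewrite coef_mul_wdS sub0r -[in mon2 0 d](subn0 d) bQ // => h.
    by rewrite -[X in mdvd _ X]opprK -mulN1r; apply: mdvdM; apply: h; lia.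
  move=> n; have [nd|nd] := leqP n d; last first.
    rewrite /b; have /negPf -> : ~~ (n <= d)%N by rewrite -ltnNge.
    have /negPf -> : ~~ (n.+1 <= d)%N by lia.
    by rewrite !mulr0 subr0; apply: mdvd0.
  have := top (mon2 n.+1 (d - n)); rewrite mdeg_mon2 mon2SU coef_mul_wdS bQ //.
  have -> : coef (Q * wpoly fx * wd K 1) (mon2 n (d - n) + U_(0%R)) = fx * b n.+1.
    rewrite -mon2SU; have [nd'|nd'] := ltnP n d.
      have -> : (d - n)%N = (d - n.+1).+1 by lia.
      by rewrite mon2US coef_mul_wdS bQ.
    have -> : (d - n)%N = 0%N by lia.
    rewrite coef_mul_wd0 ?mon2_1 //.
    by rewrite /b leqNgt ltnS nd' /= mulr0.
  by apply; lia.
apply/orderP => g gd; have [gd'|gd'] := ltrP d%:Z (mdeg g)%:Z.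
  by have /orderP := hQ; apply.
have gE : g = mon2 (g 0) (d - g 0).
  have := mdeg2 g => md; rewrite [LHS]mon2E; congr mon2; lia.
have nd : (g 0%R <= d)%N by have := mdeg2 g; lia.
have bE : b (g 0) = coef Q g by rewrite /b nd -gE.
rewrite -bE; apply: (mdvd_lead (bdvd _)) => m; rewrite bE => hm.
exact: (hlead (m, g)).
Qed.

End SymbolIndependence.

(** * Quadratic growth *)

Section BoundedMonomials.
Local Notation mono := ('X_{1..2} * 'X_{1..2})%type.

Definition bmono (k : nat) : finType :=
  {p : 'X_{1..2 < k.+1} * 'X_{1..2 < k.+1} | (mdeg p.1 + mdeg p.2 <= k)%N}.

Definition bmval k (t : bmono k) : mono := ((val t).1 : 'X_{1..2}, (val t).2 : 'X_{1..2}).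

Lemma bmval_deg k (t : bmono k) : (mdeg (bmval t).1 + mdeg (bmval t).2 <= k)%N.
Proof. exact: (valP t). Qed.

Lemma bmval_inj k : injective (@bmval k).
Proof.
move=> [[a g] ha] [[a' g'] hb] [E1 E2]; apply: val_inj; congr pair;
  by apply/eqP; rewrite bmeqP; apply/eqP.
Qed.

Lemma bmvalP k (ag : mono) : (mdeg ag.1 + mdeg ag.2 <= k)%N ->
  exists t : bmono k, bmval t = ag.
Proof.
case: ag => a g /= h; have ha : (mdeg a < k.+1)%N by lia.
have hg : (mdeg g < k.+1)%N by lia.
by exists (@Sub _ _ (bmono k) (BMultinom ha, BMultinom hg) h).
Qed.

Lemma card_bmono k : #|bmono k| = 'C(k + 4, 4).
Proof.
(* The exponents of x, y, d_x, d_y form a 4-tuple of sum at most k. *)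
have <- : #|{: {t : 4.-tuple 'I_k.+1 | (\sum_(i <- t) i <= k)%N}}| = 'C(k + 4, 4).
  rewrite card_sig addnC -card_partial_ord_partitions.
  by apply: eq_card => t; rewrite !inE.
apply/eqP; rewrite eqn_leq; apply/andP; split.
  pose tup (t : bmono k) : 4.-tuple 'I_k.+1 :=
    [tuple inord ((bmval t).1 0); inord ((bmval t).1 1);
           inord ((bmval t).2 0); inord ((bmval t).2 1)].
  have bnd (t : bmono k) : [/\ (bmval t).1 0%R <= k, (bmval t).1 1%R <= k,
      (bmval t).2 0%R <= k & (bmval t).2 1%R <= k]%N.
    by have := bmval_deg t; rewrite !mdeg2; split; lia.
  have tupS t : (\sum_(i <- tup t) i <= k)%N.
    have [h1 h2 h3 h4] := bnd t; have := bmval_deg t.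
    by rewrite !mdeg2 /tup !big_cons big_nil !inordK ?ltnS //; lia.
  pose phi t : {t : 4.-tuple 'I_k.+1 | (\sum_(i <- t) i <= k)%N} := Sub (tup t) (tupS t).
  apply: (@leq_card _ _ phi) => s t /(congr1 val) /= /(congr1 val) /= [].
  have [s1 s2 s3 s4] := bnd s; have [t1 t2 t3 t4] := bnd t.
  move=> /(congr1 val) e1 /(congr1 val) e2 /(congr1 val) e3 /(congr1 val) e4.
  rewrite /= !inordK ?ltnS // in e1 e2 e3 e4.
  apply: bmval_inj; rewrite [bmval s]surjective_pairing [bmval t]surjective_pairing.
  by rewrite (mon2E (bmval s).1) (mon2E (bmval s).2) e1 e2 e3 e4 -!mon2E.
pose ag (t : 4.-tuple 'I_k.+1) : mono :=
  (mon2 (tnth t 0) (tnth t 1), mon2 (tnth t 2%:R) (tnth t 3%:R)).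
have tE (t : 4.-tuple 'I_k.+1) :
    (\sum_(i <- t) i = tnth t 0%R + tnth t 1%R + tnth t 2%:R + tnth t 3%:R)%N.
  case: t => [[|x0 [|x1 [|x2 [|x3 [|]]]]]] //= h.
  by rewrite !big_cons big_nil !(tnth_nth x0) /=; lia.
have agP (t : {t : 4.-tuple 'I_k.+1 | (\sum_(i <- t) i <= k)%N}) :
    exists b : bmono k, bmval b = ag (val t).
  by apply: bmvalP; rewrite !mdeg_mon2; have := valP t; rewrite /= tE; lia.
have /choice[psi hpsi] := agP.
apply: (@leq_card _ _ psi) => s t E; apply: val_inj.
have /pair_equal_spec[E1 E2] : ag (val s) = ag (val t) by rewrite -!hpsi E.
have e0 : tnth (val s) 0 = tnth (val t) 0 :> nat.
  by have := congr1 (fun m : 'X_{1..2} => m 0) E1; rewrite !mon2_0.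
have e1 : tnth (val s) 1 = tnth (val t) 1 :> nat.
  by have := congr1 (fun m : 'X_{1..2} => m 1) E1; rewrite !mon2_1.
have e2 : tnth (val s) 2%:R = tnth (val t) 2%:R :> nat.
  by have := congr1 (fun m : 'X_{1..2} => m 0) E2; rewrite !mon2_0.
have e3 : tnth (val s) 3%:R = tnth (val t) 3%:R :> nat.
  by have := congr1 (fun m : 'X_{1..2} => m 1) E2; rewrite !mon2_1.
case: (val s) e0 e1 e2 e3 => [[|x0 [|x1 [|x2 [|x3 [|]]]]]] //= hx.
case: (val t) => [[|y0 [|y1 [|y2 [|y3 [|]]]]]] //= hy.
rewrite !(tnth_nth x0) /= => e0 e1 e2 e3; apply: val_inj => /=.
by congr [:: _; _; _; _]; apply: val_inj.
Qed.

(** These are the monomials x^a for which [I_wmon_f] does not place the product with f in the ideal;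
    their number is only quadratic in k. *)
Lemma card_bmono_order0 k :
  (#|[pred t : bmono k | (bmval t).2 == 0%MM]| <= k.+1 ^ 2)%N.
Proof.
have -> : (k.+1 ^ 2)%N = #|{: 'I_k.+1 * 'I_k.+1}| by rewrite card_prod card_ord.
rewrite -card_sig.
pose phi (t : {t : bmono k | (bmval t).2 == 0%MM}) : 'I_k.+1 * 'I_k.+1 :=
  (inord ((bmval (val t)).1 0), inord ((bmval (val t)).1 1)).
apply: (@leq_card _ _ phi) => s t /= [/(congr1 val) e1 /(congr1 val) e2].
have h (u : {t : bmono k | (bmval t).2 == 0%MM}) :
    ((bmval (val u)).1 0%R <= k)%N /\ ((bmval (val u)).1 1%R <= k)%N.
  by have := bmval_deg (val u); rewrite !mdeg2; split; lia.
have [s1 s2] := h s; have [t1 t2] := h t.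
rewrite /= !inordK ?ltnS // in e1 e2.
apply: val_inj; apply: bmval_inj.
rewrite [bmval (val s)]surjective_pairing [bmval (val t)]surjective_pairing.
rewrite (eqP (valP s)) (eqP (valP t)); congr pair.
by rewrite [LHS]mon2E e1 e2 -mon2E.
Qed.

Lemma card_bmono_multiples k (l : 'X_{1..2}) : (mdeg l <= k)%N ->
  (#|[pred t : bmono k | (l <= (bmval t).1)%MM]| <= #|bmono (k - mdeg l)|)%N.
Proof.
move=> lk; rewrite -card_sig.
have hP (t : {t : bmono k | (l <= (bmval t).1)%MM}) : exists b : bmono (k - mdeg l),
    bmval b = ((bmval (val t)).1 - l, (bmval (val t)).2)%MM.
  have la : (l <= (bmval (val t)).1)%MM by exact: (valP t).
  move: (bmval_deg (val t)) la; case: (bmval (val t)) => a g /= dk la.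
  apply: bmvalP => /=; have := congr1 (@mdeg 2) (submK la); rewrite mdegD.
  by move=> E; rewrite -E in dk; lia.
have /choice[phi hphi] := hP.
apply: (@leq_card _ _ phi) => s t E; apply: val_inj; apply: bmval_inj.
have : ((bmval (val s)).1 - l, (bmval (val s)).2)%MM =
    ((bmval (val t)).1 - l, (bmval (val t)).2)%MM by rewrite -!hphi E.
have ls : (l <= (bmval (val s)).1)%MM by exact: (valP s).
have lt : (l <= (bmval (val t)).1)%MM by exact: (valP t).
move: ls lt; case: (bmval (val s)) => a g; case: (bmval (val t)) => a' g' /= ls lt.
by move=> /pair_equal_spec[e1 ->]; rewrite -(submK ls) -(submK lt) e1.
Qed.

(* The second difference of ['C(k + 4, 4)] with step [a] is quadratic in [k]. *)
Lemma second_difference a j : ('C(j + 2 * a + 4, 4) + 'C(j + 4, 4) <=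
  2 * 'C(j + a + 4, 4) + a * (a * 'C(j + 2 * a + 2, 2)))%N.
Proof.
have mono2 x y : (x <= y)%N -> ('C(x, 2) <= 'C(y, 2))%N by apply: leq_bin2l.
have step m b : ('C(m + b + 3, 3) <= 'C(m + 3, 3) + b * 'C(m + b + 2, 2))%N.
  elim: b => [|b ih]; first by rewrite addn0 mul0n addn0.
  have -> : (m + b.+1 + 3 = (m + b + 3).+1)%N by lia.
  rewrite binS; have -> : (m + b.+1 + 2 = m + b + 3)%N by lia.
  have := mono2 (m + b + 2)%N (m + b + 3)%N.
  by move: ih; set x := 'C(_, 3); set y := 'C(_, 3); set z := 'C(_, 2); set w := 'C(_, 2); nia.
suff H s : (s <= a)%N -> ('C(j + a + s + 4, 4) + 'C(j + 4, 4) <=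
    'C(j + a + 4, 4) + 'C(j + s + 4, 4) + s * (a * 'C(j + 2 * a + 2, 2)))%N.
  have := H a (leqnn a); have -> : (j + a + a = j + 2 * a)%N by lia.
  lia.
elim: s => [|s ih] sa; first by rewrite !addn0; lia.
have := ih (ltnW sa).
have -> : (j + a + s.+1 + 4 = (j + a + s + 4).+1)%N by lia.
have -> : (j + s.+1 + 4 = (j + s + 4).+1)%N by lia.
rewrite !binS.
have -> : (j + a + s + 4 = (j + s.+1) + a + 3)%N by lia.
have -> : (j + s + 4 = (j + s.+1) + 3)%N by lia.
have h1 := step (j + s.+1)%N a.
have h2 : (a * 'C(j + s.+1 + a + 2, 2) <= a * 'C(j + 2 * a + 2, 2))%N.
  by rewrite leq_mul2l mono2 ?orbT //; lia.
by rewrite (mulSn s); lia.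
Qed.

End BoundedMonomials.

Section BernsteinFiltration.
Context (K : numFieldType).
Local Notation A := {mpoly K[2]}.
Local Notation D := (weyl 2 K).
Local Notation Bf := (@Fil 2 K 1 1).

Lemma wmon_free (T : finType) (e : T -> 'X_{1..2} * 'X_{1..2}) (c : T -> K) :
  injective e -> \sum_t c t *: wmon K (e t) = 0 -> forall t, c t = 0.
Proof.
move=> ei h t; have := congr1 (wc (e t)) h; rewrite raddf0 wc_sum_wmon /=.
rewrite (big_pred1 t) // => s /=.
by rewrite (inj_eq ei).
Qed.

Lemma Fil_span k P : Bf k%:Z P ->
  exists c : bmono k -> K, P = \sum_t c t *: wmon K (bmval t).
Proof.
move=> hP; exists (fun t => wc (bmval t) P); apply: wc_eqP => ag.
rewrite wc_sum_wmon /=; have [P0|P0] := eqVneq (wc ag P) 0.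
  by rewrite P0 big1 // => t /eqP ->.
have [|t E] := @bmvalP k ag; first by have := Fil_wc hP P0; rewrite /mwt; lia.
by rewrite (big_pred1 t) ?E // => s /=; rewrite -E (inj_eq (@bmval_inj k)).
Qed.

Lemma Fil_bmono k (t : bmono k) : Bf k%:Z (wmon K (bmval t)).
Proof. by apply: FilS (@Fil_wmon 2 K 1 1 (bmval t)); rewrite /mwt; have := bmval_deg t; lia. Qed.

Lemma Fil_wpoly d (h : A) : (forall m, h@_m != 0 -> (mdeg m)%:Z <= d) -> Bf d (wpoly h).
Proof.
move=> hd; split=> -[a g]; rewrite /wc /mwt /wpoly /= mcoeffC.
have [->|g0] := eqVneq g 0%MM; last by rewrite mulr0 mcoeff0 eqxx.
by rewrite mulr1 mdeg0 => /hd; lia.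
Qed.

End BernsteinFiltration.

Section QuadraticGrowth.
Context (K : numFieldType).
Local Notation A := {mpoly K[2]}.
Local Notation D := (weyl 2 K).
Local Notation Bf := (@Fil 2 K 1 1).
Variable f : A.
Local Notation fx := (f^`M(0)).
Local Notation fy := (f^`M(1)).
Hypothesis f0 : f != 0.
Hypothesis elim_f : forall i : 'I_2, exists c : {poly K}, c != 0 /\
  exists u1 u2 u3 : A, horner_alg 'X_i c = u1 * f + u2 * fx + u3 * fy.
Variable I : set D.
Hypothesis sI : subsp I.
Hypothesis IM : forall P Q, I Q -> I (P * Q).
Hypothesis Iham : I (hamiltonian f).
Hypothesis Idf : forall i, I (wd K i * wpoly f).

Local Notation al := (mdeg (mlead f)).

(** The monomial order refines the total degree, so [al] is the degree of f. *)
Lemma Fil_wpoly_f : Bf al%:Z (wpoly f).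
Proof.
by apply: Fil_wpoly => m; rewrite mcoeff_eq0 negbK => /msupp_le_mlead /lemc_mdeg.
Qed.

Lemma Fil_hamiltonian : Bf al%:Z (hamiltonian f).
Proof.
have h i j : Bf al%:Z (wpoly f^`M(i) * wd K j).
  have -> : al%:Z = (al%:Z - 1) + 1 by lia.
  apply: FilM => //; last exact: Fil_d.
  apply: Fil_wpoly => m; rewrite mcoeff_mderiv => hm.
  have : f@_(m + U_(i)) != 0 by apply: contraNneq hm => ->; rewrite mul0rn.
  rewrite mcoeff_eq0 negbK => /msupp_le_mlead /lemc_mdeg.
  by rewrite mdegD mdeg1; lia.
by rewrite /hamiltonian; apply: FilB.
Qed.

Lemma I_wmon_f (ag : 'X_{1..2} * 'X_{1..2}) : ag.2 != 0%MM -> I (wmon K ag * wpoly f).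
Proof.
case: ag => a g /= g0; have [i gi] : exists i, g i != 0%N.
  apply/existsP; apply: contraNT g0; rewrite negb_exists => /forallP H.
  by apply/eqP/mnmP => i; rewrite mnm0E; have := H i; rewrite negbK => /eqP.
have -> : g = (g - U_(i) + U_(i))%MM by rewrite submK // lep1mP.
by rewrite /wmon /= wdiffD -!mulrA; do 2!apply: IM; apply: Idf.
Qed.

(** The family v lists elements of I of degree at most k: products with f of monomials containing a
    derivative, and products with [hamiltonian] of monomials whose polynomial part is not divisible
    by [mlead f]. They are independent by [hamiltonian_independent], so their number bounds the
    codimension of I from above. *)
Lemma quadratic_growth : exists C, forall k, (C <= k)%N ->
  exists S : {set bmono k}, (#|S| <= C * k.+1 ^ 2)%N /\
    forall t : bmono k, exists c : bmono k -> K,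
      I (wmon K (bmval t) - \sum_(s in S) c s *: wmon K (bmval s)).
Proof.
(* The summand al^2 comes from the second difference and 1 from the monomials of order 0; 2 al
   ensures that k - 2 al is natural. *)
exists (2 * al + al ^ 2 + 1)%N => k hk.
have [j kE] : exists j, k = (j + 2 * al)%N by exists (k - 2 * al)%N; lia.
pose k1 := (j + al)%N.
pose J1 : finType := {t : bmono k1 | (bmval t).2 != 0%MM}.
pose J2 : finType := {t : bmono k1 | ~~ (mlead f <= (bmval t).1)%MM}.
pose v (x : J1 + J2) : D := match x with
  | inl t => wmon K (bmval (val t)) * wpoly f
  | inr t => wmon K (bmval (val t)) * hamiltonian f end.
have k1k : k%:Z = k1%:Z + al%:Z by rewrite /k1; lia.
have vF x : Bf k%:Z (v x).
  by case: x => t; rewrite k1k; apply: FilM => //; [exact: Fil_bmono | exact: Fil_wpoly_f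
    | exact: Fil_bmono | exact: Fil_hamiltonian].
have [|d E|x|S [cS hS]] := codim_le (e := fun t : bmono k => wmon K (bmval t)) (v := v) sI.
- by case=> t; [apply: I_wmon_f; exact: (valP t) | apply: IM].
- rewrite big_sumType /= in E.
  pose R := \sum_(t : J1) d (inl t) *: wmon K (bmval (val t)).
  pose Q := \sum_(t : J2) d (inr t) *: wmon K (bmval (val t)).
  have ERQ : R * wpoly f + Q * hamiltonian f = 0.
    rewrite -[RHS]E !mulr_suml; congr (_ + _); apply: eq_bigr => t _; exact: esym (scalerAl _ _ _).
  have [|R0 Q0] := hamiltonian_independent f0 elim_f ERQ.
    move=> ag; apply: contra => lag; rewrite /Q wc_sum_wmon big1 // => t /eqP tE.
    have : ~~ (mlead f <= (bmval (val t)).1)%MM by exact: (valP t).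
    by rewrite tE lag.
  by case=> t; [apply: (wmon_free _ R0 t) | apply: (wmon_free _ Q0 t)] => s s' /bmval_inj /val_inj.
- exact: Fil_span.
exists S; split => //.
have c1 : (#|J1| + k1.+1 ^ 2 >= 'C(k1 + 4, 4))%N.
  rewrite -card_bmono -(cardC [pred t : bmono k1 | (bmval t).2 == 0%MM]) addnC.
  by rewrite leq_add ?card_bmono_order0 // card_sig.
have c2 : (#|J2| + 'C(j + 4, 4) >= 'C(k1 + 4, 4))%N.
  have <- : #|bmono (k1 - al)| = 'C(j + 4, 4) by rewrite card_bmono /k1 addnK.
  rewrite -card_bmono -(cardC [pred t : bmono k1 | (mlead f <= (bmval t).1)%MM]) addnC.
  by rewrite leq_add ?card_bmono_multiples // ?card_sig // /k1 leq_addl.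
move: cS; rewrite card_sum card_bmono => cS.
have c3 := second_difference al j.
have c4 : ('C(k + 2, 2) <= k.+1 ^ 2)%N by rewrite bin2; nia.
have c5 : (al * (al * 'C(k + 2, 2)) <= al ^ 2 * k.+1 ^ 2)%N by rewrite mulnA leq_mul.
have c6 : (k1.+1 ^ 2 <= k.+1 ^ 2)%N by rewrite leq_exp2r //; rewrite /k1; lia.
rewrite -kE in c3; rewrite /k1 in c1 c2 c6.
by rewrite !mulnDl mul1n; move: c5 c6; set X := (k.+1 ^ 2)%N; set Y := (al ^ 2 * X)%N; lia.
Qed.

End QuadraticGrowth.

(** * Joseph's argument *)

Section Commutators.
Context (n : nat) (K : numFieldType).
Local Notation A := {mpoly K[n]}.
Local Notation D := (weyl n K).
Local Notation Bf := (@Fil n K 1 1).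
Implicit Types (P Q : D) (i j : 'I_n) (g : 'X_{1..n}).

Lemma wdiff_comm_wx g j :
  wdiff K g * wx K j - wx K j * wdiff K g = (g j)%:R *: wdiff K (g - U_(j)).
Proof.
elim/mnm_ind: g => [|g i ih].
  by rewrite wdiff0 mul1r mulr1 subrr mnm0E scale0r.
have -> : wdiff K (g + U_(i)) * wx K j - wx K j * wdiff K (g + U_(i)) =
    wd K i * (wdiff K g * wx K j - wx K j * wdiff K g) + (i == j)%:R * wdiff K g.
  rewrite wdiffS mulrBr !mulrA wd_wx mulrDl opprD addrA.
  by rewrite -[RHS]addrA addNr addr0.
rewrite ih -scalerAr -wdiffS mnmDE mnm1E.
have [->|ij] := eqVneq i j.
  rewrite addmK mul1r; have [->|gj] := eqVneq (g j) 0%N; first by rewrite scale0r add0r scale1r.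
  by rewrite submK ?lep1mP // addn1 -natr1 scalerDl scale1r.
rewrite mul0r addr0 addn0; have [->|gj] := eqVneq (g j) 0%N; first by rewrite !scale0r.
congr (_ *: wdiff K _); apply/mnmP => k; rewrite mnmDE !mnmBE mnmDE !mnm1E.
by case: (eqVneq j k) => [<-|_]; [rewrite (negPf ij) !addn0 | rewrite !subn0].
Qed.

(** On normally ordered expansions the commutator with x_j is differentiation with respect to the
    symbol d_j; dually, [wc_comm_wd] is differentiation with respect to x_j. Both lower the
    Bernstein degree. *)
Lemma wc_comm_wx P j a g :
  wc (a, g) (P * wx K j - wx K j * P) = wc (a, g + U_(j))%MM P *+ (g j).+1.
Proof.
elim/weyl_ind: P => [|b m|P Q ihP ihQ].
- by rewrite mul0r mulr0 subrr !raddf0 mul0rn.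
- have -> : wpoly b * wdiff K m * wx K j - wx K j * (wpoly b * wdiff K m) =
      wpoly b * (wdiff K m * wx K j - wx K j * wdiff K m).
    by rewrite mulrBr !mulrA /wx -!wpolyM ['X_j * b]mulrC.
  rewrite wdiff_comm_wx -scalerAr wcZ /wc !wterm /= !mcoeffZ !mcoeffX.
  have [->|mg] := eqVneq m (g + U_(j))%MM.
    by rewrite addmK eqxx mnmDE mnm1E eqxx addn1 mulr_natl.
  rewrite mulr0 mcoeff0 mul0rn; have [E|] := eqVneq (m - U_(j))%MM g; last by rewrite mulr0 mcoeff0 mulr0.
  have [->|mj] := eqVneq (m j) 0%N; first by rewrite mul0r.
  by move: mg; rewrite -E submK ?eqxx // lep1mP.
have -> : (P + Q) * wx K j - wx K j * (P + Q) =
    (P * wx K j - wx K j * P) + (Q * wx K j - wx K j * Q).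
  by rewrite mulrDl mulrDr opprD addrACA.
by rewrite [LHS]raddfD [X in _ = X *+ _]raddfD /= ihP ihQ mulrnDl.
Qed.

Lemma wc_comm_wd P j a g :
  wc (a, g) (wd K j * P - P * wd K j) = wc (a + U_(j), g)%MM P *+ (a j).+1.
Proof.
have -> : wd K j * P - P * wd K j = map_mpoly (mderiv j) (P : {mpoly A[n]}).
  rewrite wd_dl weyl_dlE mul_wd [X in X + _ - _]mulrC.
  by rewrite addrC addKr.
by rewrite /wc /= mcoeff_map_mpoly /= mcoeff_mderiv.
Qed.

Lemma Fil_comm_wx k P j : Bf (k + 1) P -> Bf k (P * wx K j - wx K j * P).
Proof.
move=> hP; split=> -[a g]; rewrite wc_comm_wx => nz.
have : wc (a, g + U_(j))%MM P != 0 by apply: contraNneq nz => ->; rewrite mul0rn.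
by move/(Fil_wc hP); rewrite /mwt /= mdegD mdeg1; lia.
Qed.

Lemma Fil_comm_wd k P j : Bf (k + 1) P -> Bf k (wd K j * P - P * wd K j).
Proof.
move=> hP; split=> -[a g]; rewrite wc_comm_wd => nz.
have : wc (a + U_(j), g)%MM P != 0 by apply: contraNneq nz => ->; rewrite mul0rn.
by move/(Fil_wc hP); rewrite /mwt /= mdegD mdeg1; lia.
Qed.

Lemma Fil0_scalar P : Bf 0 P -> P = (wc (0, 0)%MM P)%:A.
Proof.
move=> hP; have E1 : (1 : D) = wmon K (0, 0)%MM by rewrite /wmon mpolyX0 wdiff0 wpoly1 mulr1.
apply: wc_eqP => ag; rewrite E1 wcZ wc_wmon.
have [->|ag0] := eqVneq ag (0, 0)%MM; first by rewrite mulr1.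
rewrite mulr0; apply/eqP; apply: contraNT ag0 => /(Fil_wc hP).
case: ag => a g; rewrite /mwt /= => h; rewrite xpair_eqE -!mdeg_eq0.
by apply/andP; split; lia.
Qed.

Lemma central_scalar P : (forall j, P * wx K j = wx K j * P) ->
  (forall j, wd K j * P = P * wd K j) -> Bf 0 P.
Proof.
move=> hx hd; split=> -[a g] nz; rewrite /mwt /=.
suff [-> ->] : a = 0%MM /\ g = 0%MM by rewrite mdeg0.
have h0 (m : 'X_{1..n}) : (forall j, m j = 0%N) -> m = 0%MM.
  by move=> h; apply/mnmP => j; rewrite mnm0E.
split; apply: h0 => j; apply/eqP; apply: contraNT nz => mj.
  have := wc_comm_wd P j (a - U_(j))%MM g; rewrite hd subrr raddf0 submK ?lep1mP //.
  by move/esym/eqP; rewrite mulrn_eq0.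
have := wc_comm_wx P j a (g - U_(j))%MM; rewrite hx subrr raddf0 submK ?lep1mP //.
by move/esym/eqP; rewrite mulrn_eq0.
Qed.

End Commutators.

Section JosephDescent.
Context (n : nat) (K : numFieldType).
Local Notation D := (weyl n K).
Local Notation Bf := (@Fil n K 1 1).
Variable J : set D.
Hypothesis sJ : subsp J.
Hypothesis JM : forall P Q, J Q -> J (P * Q).

(* Commutators with the generators lower the degree of the operators [P i]
   without leaving the situation, until they become scalars. *)
Lemma joseph_descent (t : D) (N k : nat) (P : 'I_N -> D) :
  (exists i, P i != 0) -> (forall i, Bf k%:Z (P i)) ->
  (forall u, Bf k%:Z u -> J (\sum_i P i * u * t ^+ i)) ->
  exists c : 'I_N -> K, (exists i, c i != 0) /\ J (\sum_i c i *: t ^+ i).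
Proof.
elim: k P => [|k ih] P nzP hP hJ.
  exists (fun i => wc (0, 0)%MM (P i)); split.
    have [i Pi] := nzP; exists i; apply: contraNneq Pi => E.
    by rewrite (Fil0_scalar (hP i)) E scale0r.
  have := hJ 1 (Fil1 _ _ (isT : 0 <= 1 + 1 :> int)).
  by congr J; apply: eq_bigr => i _; rewrite mulr1 [P i in LHS](Fil0_scalar (hP i)) mulr_algl.
have kS : k.+1%:Z = k%:Z + 1 by lia.
have uS u j : Bf k%:Z u -> Bf k.+1%:Z (wx K j * u) /\ Bf k.+1%:Z (wd K j * u).
  by move=> hu; rewrite kS addrC; split; [apply: Fil_wx | apply: Fil_wd].
have [[i [j nz]]|nx] := pselect (exists i j, P i * wx K j - wx K j * P i != 0).
  apply: (ih (fun i => P i * wx K j - wx K j * P i)); first by exists i.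
    by move=> i'; apply: Fil_comm_wx; rewrite -kS.
  move=> u hu; have -> : \sum_i (P i * wx K j - wx K j * P i) * u * t ^+ i =
      \sum_i P i * (wx K j * u) * t ^+ i - wx K j * \sum_i P i * u * t ^+ i.
    by rewrite mulr_sumr -sumrB; apply: eq_bigr => i' _; rewrite !mulrBl !mulrA.
  apply: subspB => //; first by apply: hJ; have [] := uS u j hu.
  by apply: JM; apply: hJ; apply: FilS hu; lia.
have [[i [j nz]]|nd] := pselect (exists i j, wd K j * P i - P i * wd K j != 0).
  apply: (ih (fun i => wd K j * P i - P i * wd K j)); first by exists i.
    by move=> i'; apply: Fil_comm_wd; rewrite -kS.
  move=> u hu; have -> : \sum_i (wd K j * P i - P i * wd K j) * u * t ^+ i =
      wd K j * \sum_i P i * u * t ^+ i - \sum_i P i * (wd K j * u) * t ^+ i.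
    by rewrite mulr_sumr -sumrB; apply: eq_bigr => i' _; rewrite !mulrBl !mulrA.
  apply: subspB => //; last by apply: hJ; have [] := uS u j hu.
  by apply: JM; apply: hJ; apply: FilS hu; lia.
apply: (ih P nzP) => [i|u hu]; last by apply: hJ; apply: FilS hu; lia.
apply: (@FilS _ _ _ _ 0) => //; apply: central_scalar => j; apply/eqP; rewrite -subr_eq0.
  by apply: contrapT => /negP h; apply: nx; exists i, j.
by apply: contrapT => /negP h; apply: nd; exists i, j.
Qed.

End JosephDescent.

(** * Passing from the ideal to its initial ideal *)

Section InitialIdealGrowth.
Context (K : numFieldType).
Local Notation D := (weyl 2 K).
Local Notation Bf := (@Fil 2 K 1 1).
Local Notation th := (theta 2 K).

Lemma lideal_subsp (n : nat) (S : set (weyl n K)) : subsp (lideal S).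
Proof.
by split=> [|c u v hu hv]; [apply: lideal0 | apply: lidealD => //; apply: lidealZ].
Qed.

(** The generators in_w(Q) are homogeneous, hence commute with [theta] up to a constant shift. This
    gives D / J the right action of [theta] that Joseph's argument needs. *)
Lemma inw_ideal_theta (I : set D) P : inw_ideal I P -> inw_ideal I (P * th).
Proof.
move=> [k [a [s [hs ->]]]]; rewrite mulr_suml; apply: lideal_sum => i _.
have [Q hQ <-] := hs i; rewrite -mulrA.
have -> : inw Q * th = (th + (ordw Q)%:~R) * inw Q.
  rewrite mulrDl (theta_whom (whom_wpart _ Q)) mulrBr -/(inw Q).
  by rewrite -[_%:~R * _]commr_int subrK.
by rewrite mulrA; apply: lidealM; apply: lideal_mem; exists Q.
Qed.

(** The initial part of a combination of monomials is a subsum of it. If a nonzero combination were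
    in I, its initial part would be a nontrivial relation modulo the initial ideal. *)
Lemma indep_inw (I : set D) k (S : {set bmono k}) :
  indep_on (inw_ideal I) (fun t => wmon K (bmval t)) S ->
  indep_on I (fun t => wmon K (bmval t)) S.
Proof.
move=> iS d; set P := \sum_(t in S) _ => IP.
have wcP ag : wc ag P = \sum_(t in S | bmval t == ag) d t by rewrite wc_sum_wmon.
have wct t : t \in S -> wc (bmval t) P = d t.
  move=> tS; rewrite wcP (big_pred1 t) // => s /=.
  by rewrite (inj_eq (@bmval_inj k)); case: eqVneq => [->|]; rewrite ?tS ?andbF.
have [P0 t tS|P0] := eqVneq P 0; first by rewrite -wct // P0 raddf0.
have inwE : inw P = \sum_(t in S) (if wweight (bmval t) == ordw P then d t else 0)
    *: wmon K (bmval t).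
  apply: wc_eqP => ag; rewrite wc_wpart wcP wc_sum_wmon.
  case: ifP => wag; last by rewrite big1 // => t /andP[_ /eqP ->]; rewrite wag.
  by apply: eq_bigr => t /andP[_ /eqP ->]; rewrite wag.
have [ag] := ordw_attained P0; rewrite mem_wsupp => agP wag.
have [t tS tE] : exists2 t, t \in S & bmval t = ag.
  apply: contrapT => h; move: agP; rewrite wcP big1 ?eqxx // => t /andP[tS /eqP tE].
  by case: h; exists t.
have Jin : inw_ideal I (inw P) by apply: lideal_mem; exists P.
rewrite inwE in Jin; have := iS _ Jin t tS; rewrite tE wag eqxx => dt.
by move: agP; rewrite -tE wct // dt eqxx.
Qed.

(** A maximal family of monomials independent modulo the initial ideal spans modulo it and stays
    independent modulo I, so it is no larger than a spanning family modulo I. *)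
Lemma growth_inw_ideal (I : set D) k m (S : {set bmono k}) : subsp I ->
  (#|S| <= m)%N ->
  (forall t : bmono k, exists c : bmono k -> K,
     I (wmon K (bmval t) - \sum_(s in S) c s *: wmon K (bmval s))) ->
  exists S' : {set bmono k}, (#|S'| <= m)%N /\
    forall t : bmono k, exists c : bmono k -> K,
      inw_ideal I (wmon K (bmval t) - \sum_(s in S') c s *: wmon K (bmval s)).
Proof.
move=> sI Sm hS; have sJ : subsp (inw_ideal I) by apply: lideal_subsp.
have [S' [iS' hS']] := maximal_independent sJ (fun t : bmono k => wmon K (bmval t)).
exists S'; split => //; apply: leq_trans Sm; rewrite leqNgt; apply/negP => lt.
have iS := indep_inw iS'.
have [t||d [[t dt] dI]] := dependent_family sI
    (e := fun s : {s | s \in S} => wmon K (bmval (val s)))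
    (v := fun t : {t | t \in S'} => wmon K (bmval (val t))).
- have [c hc] := hS (val t); exists (fun s => c (val s)).
  by rewrite -(big_sub S (fun s => c s *: wmon K (bmval s))).
- by rewrite !card_sig.
pose c t := if insub t is Some t' then d t' else 0.
have cE t' : c (val t') = d t' by rewrite /c valK.
have := iS c; rewrite big_sub => H.
suff : c (val t) = 0 by rewrite cE => E; rewrite E eqxx in dt.
apply: H; last exact: (valP t).
by under eq_bigr => s _ do rewrite cE.
Qed.

Lemma span_mod (J : set D) k (S : {set bmono k}) : subsp J ->
  (forall t : bmono k, exists c : bmono k -> K,
     J (wmon K (bmval t) - \sum_(s in S) c s *: wmon K (bmval s))) ->
  forall P, Bf k%:Z P -> exists c : bmono k -> K,
    J (P - \sum_(s in S) c s *: wmon K (bmval s)).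
Proof.
move=> sJ /choice[C hC] P /Fil_span[a ->].
exists (fun s => \sum_t a t * C t s).
have -> : \sum_(s in S) (\sum_t a t * C t s) *: wmon K (bmval s) =
    \sum_t a t *: \sum_(s in S) C t s *: wmon K (bmval s).
  under eq_bigr => s _ do rewrite scaler_suml.
  rewrite exchange_big; apply: eq_bigr => t _ /=; rewrite scaler_sumr.
  by apply: eq_bigr => s _; rewrite scalerA.
rewrite -sumrB; apply: subsp_sum => // t _; rewrite -scalerBr.
exact: subspZ.
Qed.

Lemma Fil_theta_exp i : Bf (2 * i)%N%:Z (th ^+ i).
Proof.
have h : Bf 2 th.
  apply: FilN; apply: Fil_sum => j _; rewrite -[2 : int]/(1 + 1); apply: FilM => //.
    exact: Fil_d.
  exact: Fil_x.
elim: i => [|i ih]; first by rewrite expr0 muln0; apply: Fil1.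
rewrite exprS; have -> : (2 * i.+1)%N%:Z = 2 + (2 * i)%N%:Z by lia.
exact: FilM.
Qed.

End InitialIdealGrowth.

(** * Existence of the b-function *)

Section BFunctionExists.
Context (K : numFieldType).
Local Notation D := (weyl 2 K).
Local Notation Bf := (@Fil 2 K 1 1).
Local Notation th := (theta 2 K).
Variable J : set D.
Hypothesis sJ : subsp J.
Hypothesis JM : forall P Q, J Q -> J (P * Q).
Hypothesis Jth : forall P, J P -> J (P * th).
Variable C : nat.
Hypothesis growth : forall k, (C <= k)%N ->
  exists S : {set bmono k}, (#|S| <= C * k.+1 ^ 2)%N /\
    forall t : bmono k, exists c : bmono k -> K,
      J (wmon K (bmval t) - \sum_(s in S) c s *: wmon K (bmval s)).

Lemma J_theta_exp P i : J P -> J (P * th ^+ i).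
Proof.
by elim: i P => [|i ih] P hP; rewrite ?expr0 ?mulr1 // exprS mulrA; apply: ih; apply: Jth.
Qed.

(* The n^5 products x^a d^g theta^i with exponents < n act, by
   u |-> x^a d^g u theta^i, from the image of degree <= 4 n in D / J to the image
   of degree <= 10 n; both have dimension O(n^2). *)
Lemma theta_polynomial_in : exists2 b : {poly K}, b != 0 & J (horner_alg th b).
Proof.
(* The two quotient dimensions are at most C (5 n)^2 and C (11 n)^2, with product 3025 C^2 n^4,
   which is less than n^5. The summand C makes 4 n and 10 n large enough for [growth]. *)
pose n := (3025 * C ^ 2 + C + 1)%N.
have n0 : (0 < n)%N by rewrite /n addn1.
have [|S [cS hS]] := growth (k := (4 * n)%N); first by rewrite /n; lia.
have [|S' [cS' hS']] := growth (k := (10 * n)%N); first by rewrite /n; lia.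
pose T : finType := (('I_n * 'I_n) * ('I_n * 'I_n))%type.
pose m (t : T) := (mon2 t.1.1 t.1.2, mon2 t.2.1 t.2.2).
have m_inj : injective m.
  move=> [[a b] [c d]] [[a' b'] [c' d']] /pair_equal_spec /= [E1 E2].
  have e1 := congr1 (fun x : 'X_{1..2} => x 0) E1; have e2 := congr1 (fun x : 'X_{1..2} => x 1) E1.
  have e3 := congr1 (fun x : 'X_{1..2} => x 0) E2; have e4 := congr1 (fun x : 'X_{1..2} => x 1) E2.
  rewrite !mon2_0 !mon2_1 in e1 e2 e3 e4.
  by congr ((_, _), (_, _)); apply: val_inj.
have mF t : Bf (4 * n)%N%:Z (wmon K (m t)).
  apply: FilS (@Fil_wmon 2 K 1 1 (m t)); rewrite /mwt /= !mdeg_mon2.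
  by case: t => [[a b] [c d]] /=; have := ltn_ord a; have := ltn_ord b;
    have := ltn_ord c; have := ltn_ord d; lia.
(* A map u |-> x^a d^g u theta^i is recorded by its values on the monomials in S, which span degree
   4 n modulo J; two maps are compared valuewise modulo J. *)
pose E : lmodType K := {ffun {s | s \in S} -> D}.
pose v (x : T * 'I_n) : E := [ffun s => wmon K (m x.1) * wmon K (bmval (val s)) * th ^+ x.2].
pose e (x : {s | s \in S} * {s | s \in S'}) : E :=
  [ffun s => if s == x.1 then wmon K (bmval (val x.2)) else 0].
have sU : subsp [set F : E | forall s, J (F s)].
  split=> [s|c F F' hF hF' s]; first by rewrite ffunE; case: sJ.
  by rewrite !ffunE; apply: subspD => //; apply: subspZ.
have [x||d [[x dx] dJ]] := dependent_family sU (e := e) (v := v).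
- have hx s : exists c : bmono (10 * n) -> K,
      J (v x s - \sum_(s' in S') c s' *: wmon K (bmval s')).
    apply: (span_mod sJ hS'); rewrite ffunE.
    (* The factors x^a d^g and u contribute 4 n each, and theta^i with i < n contributes at most 2
       n. *)
    have -> : (10 * n)%N%:Z = (4 * n)%N%:Z + (4 * n)%N%:Z + (2 * n)%N%:Z by lia.
    apply: FilM => //; first by apply: FilM => //; apply: Fil_bmono.
    by apply: FilS (Fil_theta_exp K x.2); have := ltn_ord x.2; lia.
  have /choice[c hc] := hx; exists (fun y => c y.1 (val y.2)) => s /=.
  have -> // : (v x - \sum_i c i.1 (val i.2) *: e i) s =
      v x s - \sum_(s' in S') c s s' *: wmon K (bmval s').
  rewrite !ffunE sum_ffunE; congr (_ - _).
  rewrite -(pair_bigA _ (fun a b => (c a (val b) *: e (a, b)) s)) /=.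
  rewrite (bigD1 s) //= [X in _ + X]big1 ?addr0 => [|s1 /negPf ns]; last first.
    by rewrite big1 // => s2 _; rewrite !ffunE eq_sym ns scaler0.
  rewrite [RHS]big_sub; apply: eq_bigr => s2 _.
  by rewrite !ffunE eqxx.
- rewrite !card_prod !card_sig !card_ord.
  apply: leq_ltn_trans (leq_mul cS cS') _.
  have a1 : (C * (4 * n).+1 ^ 2 <= C * (5 * n) ^ 2)%N.
    by rewrite leq_mul2l leq_exp2r ?orbT //; lia.
  have a2 : (C * (10 * n).+1 ^ 2 <= C * (11 * n) ^ 2)%N.
    by rewrite leq_mul2l leq_exp2r ?orbT //; lia.
  apply: leq_ltn_trans (leq_mul a1 a2) _.
  have -> : (C * (5 * n) ^ 2 * (C * (11 * n) ^ 2) = 3025 * C ^ 2 * n ^ 4)%N by ring.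
  have -> : (n * n * (n * n) * n = n * n ^ 4)%N by ring.
  by rewrite ltn_pmul2r ?expn_gt0 ?n0 // /n addn1 ltnS leq_addr.
pose P (i : 'I_n) : D := \sum_(t : T) d (t, i) *: wmon K (m t).
have PF i : Bf (4 * n)%N%:Z (P i) by apply: Fil_sum => t _; apply: FilZ.
(* The relation, known on the monomials in S, extends to all u: modulo J, u is a combination w of
   these, and u - w contributes only elements of J because J is stable under right multiplication by
   [theta]. *)
have hP u : Bf (4 * n)%N%:Z u -> J (\sum_i P i * u * th ^+ i).
  move=> hu; have [c hc] := span_mod sJ hS hu.
  set w := \sum_(s in S) _ in hc.
  have -> : \sum_i P i * u * th ^+ i =
      \sum_i P i * (u - w) * th ^+ i + \sum_i P i * w * th ^+ i.
    by rewrite -big_split; apply: eq_bigr => i _ /=; rewrite -mulrDl -mulrDr subrK.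
  apply: subspD => //.
    by apply: subsp_sum => // i _; apply: J_theta_exp; apply: JM.
  have -> : \sum_i P i * w * th ^+ i =
      \sum_(s in S) c s *: \sum_i P i * wmon K (bmval s) * th ^+ i.
    under [RHS]eq_bigr => s _ do rewrite scaler_sumr.
    rewrite [RHS]exchange_big; apply: eq_bigr => i _ /=; rewrite /w mulr_sumr mulr_suml.
    by apply: eq_bigr => s _; rewrite -!scalerAr -!scalerAl.
  apply: subsp_sum => // s sS; apply: subspZ => //.
  have -> : \sum_i P i * wmon K (bmval s) * th ^+ i = (\sum_x d x *: v x) (Sub s sS).
    rewrite sum_ffunE (eq_bigr (fun x => (d (x.1, x.2) *: v (x.1, x.2)) (Sub s sS))); last by case.
    rewrite -(pair_bigA _ (fun a b => (d (a, b) *: v (a, b)) (Sub s sS))) /=.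
    rewrite exchange_big; apply: eq_bigr => i _ /=; rewrite /P !mulr_suml.
    by apply: eq_bigr => t _; rewrite !ffunE -!scalerAl.
  exact: dJ.
have [|c [[i ci] hc]] := joseph_descent sJ JM _ PF hP.
  exists x.2; apply: contraNneq dx => P0.
  case: x P0 => t i /= P0; apply/eqP.
  exact: (wmon_free (c := fun t => d (t, i)) m_inj P0 t).
exists (\poly_(i < n) (if insub i is Some j then c j else 0)).
  apply: contraNneq ci => /(congr1 (fun p : {poly K} => p`_i)).
  by rewrite coef0 coef_poly ltn_ord valK => ->.
rewrite poly_def raddf_sum /=; move: hc; congr J; apply: eq_bigr => j _.
by rewrite valK -mul_polyC rmorphM /= horner_algC rmorphXn /= horner_algX mulr_algl.
Qed.

End BFunctionExists.

(** * Correctness of the algorithm *)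

Section LogAnnihilator.
Context (K : numFieldType).
Local Notation A := {mpoly K[2]}.
Local Notation D := (weyl 2 K).
Variable f : A.
Hypothesis f0 : f != 0.
Local Notation fx := (f^`M(0)).
Local Notation fy := (f^`M(1)).

(* With delta = q d_x - p d_y, which satisfies delta f = r f, this operator is
   delta + r and annihilates 1 / f. *)
Definition log_annihilator (p q r : A) : D :=
  wpoly q * wd K 0 - wpoly p * wd K 1 + wpoly r.

(** The terms q_x - p_y are those created by reordering, that is L = d_x q - d_y p - r, and taking
    the adjoint removes them. *)
Lemma weyl_adj_log_operator p q r : syzygy f p q r ->
  weyl_adj (log_operator f p q) = - log_annihilator p q r.
Proof.
move=> S; rewrite /log_operator (@mquotE _ _ _ f (- r)) //; last first.
  by apply/eqP; rewrite mulNr -addr_eq0 [r * _]mulrC; apply/eqP.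
rewrite weyl_adjD weyl_adjB !weyl_adjM !weyl_adj_poly !weyl_adj_d !mulNr !wd_poly.
rewrite /log_annihilator !wpolyD.
have wN a : wpoly (- a) = - wpoly a :> D by apply/eqP; rewrite -addr_eq0 -wpolyD addNr wpoly0.
rewrite !wN !opprD !opprK.
rewrite [LHS](AC (2*2*3) (1*3*7*(2*5)*(4*6))) /= addNr subrr !addr0.
by [].
Qed.

Variables (m : nat) (p q r : 'I_m -> A).
Hypothesis hpqr : syzygy_generators f p q r.
Local Notation I := (log_adj_ideal f p q).

Lemma log_annihilator_in p' q' r' : syzygy f p' q' r' -> I (log_annihilator p' q' r').
Proof.
case: hpqr => hs hgen /hgen[a [-> -> ->]].
have -> : log_annihilator (\sum_(i < m) a i * p i) (\sum_(i < m) a i * q i)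
    (\sum_(i < m) a i * r i) = \sum_(i < m) wpoly (a i) * log_annihilator (p i) (q i) (r i).
  have ws (F : 'I_m -> A) : wpoly (\sum_(i < m) F i) = \sum_(i < m) wpoly (F i) :> D.
    by apply: (big_morph (@wpoly 2 K)); [apply: wpolyD | apply: wpoly0].
  rewrite /log_annihilator !ws !mulr_suml -sumrB -big_split; apply: eq_bigr => i _ /=.
  by rewrite !wpolyM mulrDr mulrBr !mulrA.
apply: lideal_sum => i _; apply: lidealM; rewrite -[log_annihilator _ _ _]opprK.
by rewrite -(weyl_adj_log_operator (hs i)); apply: lidealN; apply: lideal_mem; exists i.
Qed.

(** The Koszul syzygies (f_x, f_y, 0), (0, f, f_x) and (-f, 0, f_y) hold for every f. The first
    gives [hamiltonian], the other two d_x f and d_y f. *)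
Lemma hamiltonian_in : I (hamiltonian f).
Proof.
have -> : hamiltonian f = log_annihilator fx fy 0.
  by rewrite /log_annihilator wpoly0 addr0.
by apply: log_annihilator_in; rewrite /syzygy; ring.
Qed.

Lemma wd_f_in i : I (wd K i * wpoly f).
Proof.
rewrite wd_poly; case: (ord2_cases (isT : (0 : 'I_2) != 1) i) => ->.
  have -> : wpoly f * wd K 0 + wpoly fx = log_annihilator 0 f fx.
    by rewrite /log_annihilator wpoly0 mul0r subr0.
  by apply: log_annihilator_in; rewrite /syzygy; ring.
have wN : wpoly (- f) = - wpoly f :> D.
  by apply/eqP; rewrite -addr_eq0 -wpolyD addNr wpoly0.
have -> : wpoly f * wd K 1 + wpoly fy = log_annihilator (- f) 0 fy.
  by rewrite /log_annihilator wpoly0 mul0r sub0r wN mulNr opprK.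
by apply: log_annihilator_in; rewrite /syzygy; ring.
Qed.

End LogAnnihilator.

Section Correctness.
Context (K : numClosedFieldType).
Local Notation A := {mpoly K[2]}.
Variable f : A.
Hypothesis hV : dim_le (zeroset [set f; f^`M(0); f^`M(1)]) 0.

Lemma gradient_elimination (i : 'I_2) : exists c : {poly K}, c != 0 /\
  exists u1 u2 u3 : A,
    horner_alg 'X_i c = u1 * f + u2 * f^`M(0) + u3 * f^`M(1).
Proof.
have [j ij] : exists j : 'I_2, i != j.
  by case: (ord2_cases (isT : (0 : 'I_2) != 1) i) => ->; [exists 1 | exists 0].
exact: (zero_dim_elimination ij hV).
Qed.

Lemma zero_dim_neq0 : f != 0.
Proof.
have [c [c0 [u1 [u2 [u3 E]]]]] := gradient_elimination 0.
apply: contraNneq c0 => f0; move: E; rewrite f0 !mderiv0 !mulr0 !addr0.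
move/(congr1 (@to_bipoly K 0)); rewrite to_bipoly_alg_i rmorph0.
by move/polyC_inj ->.
Qed.

Variables (m : nat) (p q r : 'I_m -> A).
Hypothesis hpqr : syzygy_generators f p q r.
Local Notation I := (log_adj_ideal f p q).

Lemma bideal_neq0 : exists2 P, bideal I P & P != 0.
Proof.
have f0 := zero_dim_neq0; have sI : subsp I by apply: lideal_subsp.
have IM P Q : I Q -> I (P * Q) by apply: lidealM.
have [C hC] := quadratic_growth f0 gradient_elimination sI IM
  (hamiltonian_in f0 hpqr) (wd_f_in f0 hpqr).
have [||||b b0 hb] := @theta_polynomial_in K (inw_ideal I) _ _ _ C.
- exact: lideal_subsp.
- by move=> P Q; apply: lidealM.
- exact: inw_ideal_theta.
- by move=> k /hC[S [cS hS]]; exact: (growth_inw_ideal sI cS hS).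
exists (horner_alg (theta 2 K) b); last exact: horner_theta_neq0.
by split => //; exists b.
Qed.

(** The adjoints of the L_i and the Groebner basis generate the same left ideal, so they give the
    same space of relations, to which [final_step_basis] applies. *)
Lemma algorithm_correct (m' : nat) (G : 'I_m' -> weyl 2 K) (hG : groebner I G)
    (b : {poly K}) (N : nat) (c : 'I_N -> A) :
  is_bfunction I b -> final_step b (fun j => weyl_adj (G j)) c ->
  H2_log_basis f (fun i => ratf (c i) / ratf f).
Proof.
move=> [_ hb] hc; apply: (H2_log_basis_opimage zero_dim_neq0 hpqr).
have hbI : inw_ideal I (horner_alg (theta 2 K) b).
  suff [] : bideal I (horner_alg (theta 2 K) b) by [].
  by rewrite hb; exists 1; rewrite ?mul1r.
have := final_step_basis hG hbI hc.
have -> // : opimage (fun j => weyl_adj (G j)) =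
  opimage (fun i => log_operator f (p i) (q i)).
have -> : (fun i => log_operator f (p i) (q i)) =
    (fun i => weyl_adj (weyl_adj (log_operator f (p i) (q i)))).
  by apply/funext => i; rewrite weyl_adjK.
case: hG => GI _; apply/seteqP; split; apply: opimage_sub => j.
  by rewrite -/(log_adj_ideal f p q) -GI; apply: lideal_mem; exists j.
by rewrite GI; apply: lideal_mem; exists j.
Qed.

End Correctness.

Theorem theorem5p2 (R : realType) (f : {mpoly R[i][2]})
  (hV : dim_le (zeroset [set f; f^`M(0); f^`M(1)]) 0)
  (hVx : dim_le (zeroset [set f; f^`M(0)]) 1)
  (hVy : dim_le (zeroset [set f; f^`M(1)]) 1)
  (m : nat) (p q r : 'I_m -> {mpoly R[i][2]})
  (hpqr : syzygy_generators f p q r)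
  (m' : nat) (G : 'I_m' -> weyl 2 R[i])
  (hG : groebner (log_adj_ideal f p q) G) :
  (exists2 P, bideal (log_adj_ideal f p q) P & P != 0) /\
  (forall b : {poly R[i]}, is_bfunction (log_adj_ideal f p q) b ->
   forall (N : nat) (c : 'I_N -> {mpoly R[i][2]}),
     final_step b (fun j => weyl_adj (G j)) c ->
     H2_log_basis f (fun i => ratf (c i) / ratf f)).
Proof.
split; first exact: (@bideal_neq0 R[i] f hV m p q r hpqr).
move=> b hb N c hc; exact: (@algorithm_correct R[i] f hV m p q r hpqr m' G hG b N c hb hc).
Qed.
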